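(* Let $1\le N\le 10$, let $f:\mathbb{R}\to\mathbb{R}$ be locally Lipschitz and nonnegative, and let $u\in C^2(\mathbb{R}^N)$ be bounded below and a stable solution of $$-\Delta u=f(u)\qquad\text{in }\mathbb{R}^N.$$ Then $u$ is constant.
   Context: Stability: let $\Omega\subseteq\mathbb{R}^N$ be open and $f:\mathbb{R}\to\mathbb{R}$ locally Lipschitz. A solution $u\in C^2(\Omega)$ of $-\Delta u=f(u)$ in $\Omega$ is called stable (in $\Omega$) if $$\int_\Omega f'_-(u)\,\varphi^2\,dx\le\int_\Omega|\nabla\varphi|^2\,dx\qquad\text{for every }\varphi\in C^1_c(\Omega),$$ where $f'_-(t):=\liminf_{h\to0}\frac{f(t+h)-f(t)}{h}$; when $f\in C^1(\mathbb{R})$, $f'_-=f'$. *)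

(* Defs.v *)
From HB Require Import structures.
From mathcomp Require Import all_boot all_order all_algebra.
From mathcomp Require Import all_classical all_reals all_analysis.

Set Implicit Arguments.
Unset Strict Implicit.
Unset Printing Implicit Defensive.

Import Order.TTheory GRing.Theory Num.Theory.
Import numFieldTopology.Exports numFieldNormedType.Exports.

Local Open Scope classical_set_scope.
Local Open Scope ring_scope.

(* Lebesgue measure on R^n: the library puts the product sigma-algebra on
   n.-tuple T and provides binary product measures only, so the measure is built
   by recursion on n, as the image of dx \x dt under (x, t) |-> x :: t. *)
Section product_step.
Local Open Scope ereal_scope.
Context {R : realType} (n : nat).
Notation T := (measurableTypeR R).

Definition tcons (p : T * n.-tuple T) : n.+1.-tuple T := [tuple of p.1 :: p.2].
Definition tuncons (t : n.+1.-tuple T) : T * n.-tuple T :=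
  (thead t, [tuple of behead t]).

Lemma tconsK : cancel tcons tuncons.
Proof.
by move=> [x t]; rewrite /tuncons /tcons theadE; congr pair; apply/val_inj.
Qed.

Lemma tunconsK : cancel tuncons tcons.
Proof. by move=> t; rewrite [RHS]tuple_eta. Qed.

Lemma measurable_tcons : measurable_fun [set: T * n.-tuple T] tcons.
Proof. exact: (@measurable_cons _ _ _ _ fst n snd). Qed.

Lemma measurable_tuncons : measurable_fun [set: n.+1.-tuple T] tuncons.
Proof.
apply: measurable_fun_pair; first exact: measurable_tnth.
exact: measurable_behead.
Qed.

Variable m : {sigma_finite_measure set (n.-tuple T) -> \bar R}.

Definition lebesgue_cons : set (n.+1.-tuple T) -> \bar R :=
  pushforward (@lebesgue_measure R \x m) tcons.

Let lebesgue_cons0 : lebesgue_cons set0 = 0.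
Proof. by have mf := measurable_tcons; exact: measure0. Qed.

Let lebesgue_cons_ge0 A : 0 <= lebesgue_cons A.
Proof. by have mf := measurable_tcons; exact: measure_ge0. Qed.

Let lebesgue_cons_sigma_additive : semi_sigma_additive lebesgue_cons.
Proof.
by have mf := measurable_tcons; exact: measure_semi_sigma_additive.
Qed.

HB.instance Definition _ := isMeasure.Build _ _ _ lebesgue_cons
  lebesgue_cons0 lebesgue_cons_ge0 lebesgue_cons_sigma_additive.

Let lebesgue_consE (A : set T) (B : set (n.-tuple T)) :
  measurable A -> measurable B ->
  lebesgue_cons (tuncons @^-1` (A `*` B)) = lebesgue_measure A * m B.
Proof.
move=> mA mB; rewrite -product_measure1E// /lebesgue_cons /pushforward.
rewrite -comp_preimage (_ : tuncons \o tcons = id)//.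
by apply/funext => p /=; rewrite tconsK.
Qed.

Let lebesgue_cons_sigma_finite : sigma_finite setT lebesgue_cons.
Proof.
have /sigma_finiteP[F [TF ndF Foo]] := sigma_finiteT (@lebesgue_measure R).
have /sigma_finiteP[G [TG ndG Goo]] := sigma_finiteT m.
exists (fun k => tuncons @^-1` (F k `*` G k)).
  rewrite -preimage_bigcup (_ : \bigcup_k _ = setT) ?preimage_setT//.
  apply/seteqP; split => // -[x y] _.
  have [i _ Fx] : (\bigcup_i F i) x by rewrite -TF.
  have [j _ Gy] : (\bigcup_i G i) y by rewrite -TG.
  exists (maxn i j) => //; split => /=.
  - by move: x Fx; exact/subsetPset/ndF/leq_maxl.
  - by move: y Gy; exact/subsetPset/ndG/leq_maxr.
move=> k; have [mF Fk] := Foo k; have [mG Gk] := Goo k; split.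
  rewrite -[X in measurable X]setTI; apply: measurable_tuncons => //.
  exact: measurableX.
by rewrite lebesgue_consE// lte_mul_pinfty// ge0_fin_numE.
Qed.

HB.instance Definition _ :=
  Measure_isSigmaFinite.Build _ _ _ lebesgue_cons lebesgue_cons_sigma_finite.

End product_step.

Fixpoint lebesgue_tuple {R : realType} (n : nat) :
    {sigma_finite_measure set (n.-tuple (measurableTypeR R)) -> \bar R} :=
  if n is n'.+1 then lebesgue_cons (lebesgue_tuple n') else \d_[tuple].

Lemma lebesgue_tuple_box (R : realType) (n : nat)
    (A : 'I_n -> set (measurableTypeR R)) :
  (forall i, measurable (A i)) ->
  lebesgue_tuple n [set t | forall i, A i (tnth t i)] =
  (\prod_(i < n) lebesgue_measure (A i))%E.
Proof.
elim: n A => [|n IH] A mA.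
  by rewrite big_ord0 /= diracE mem_set//; case.
have mS : measurable
    [set t : n.-tuple (measurableTypeR R) | forall i, A (lift ord0 i) (tnth t i)].
  rewrite [X in measurable X](_ : _ =
    \big[setI/setT]_(i < n) [set t | A (lift ord0 i) (tnth t i)]).
    apply: bigsetI_measurable => i _.
    by rewrite -[X in measurable X]setTI; exact: measurable_tnth.
  rewrite -bigcap_seq; apply/seteqP; split => t /= H i => [_|].
    exact: H.
  by apply: H => /=; rewrite mem_index_enum.
rewrite big_ord_recl -IH// -product_measure1E//.
rewrite /= /lebesgue_cons /pushforward; congr (_ _).
apply/seteqP; split => [[x t] /= H|[x t] /= [H0 H] i].
  split; first by have := H ord0; rewrite tnth0.
  by move=> i; have := H (lift ord0 i); rewrite tnthS.
by case: (unliftP ord0 i) => [j ->|->]; rewrite ?tnthS ?tnth0.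
Qed.

Section euclidean_calculus.
Context {R : realType} {N : nat}.
Implicit Types (D : set 'rV[R]_N) (u phi : 'rV[R]_N -> R) (x : 'rV[R]_N).

(* The library's measurable structure is on tuples, its normed structure is on
   row vectors; functions on R^N are integrated through this bijection. *)
Definition row_of_tuple (t : N.-tuple (measurableTypeR R)) : 'rV[R]_N :=
  \row_i tnth t i.

Definition integral_RN D (g : 'rV[R]_N -> \bar R) : \bar R :=
  (\int[lebesgue_tuple N]_(t in row_of_tuple @^-1` D) g (row_of_tuple t))%E.

Definition partial (i : 'I_N) u : 'rV[R]_N -> R := 'D_(delta_mx 0 i) u.

Definition gradient u x : 'rV[R]_N := \row_i partial i u x.

(* The library norm on 'rV[R]_N is the sup norm. *)
Definition sqr_euclidean_norm x : R := \sum_(i < N) x 0 i ^+ 2.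

Definition laplacian u x : R := \sum_(i < N) partial i (partial i u) x.

(* u is of class C^k on D, for D open. *)
Fixpoint class_C (k : nat) D u : Prop :=
  if k is k'.+1 then
    (forall x, D x -> differentiable u x) /\
    (forall i, class_C k' D (partial i u))
  else forall x, D x -> {for x, continuous u}.

Definition tsupport phi : set 'rV[R]_N := closure [set x | phi x != 0].

(* C^1_c(D), each function being extended by 0 outside D. *)
Definition C1c D : set ('rV[R]_N -> R) := [set phi |
  [/\ class_C 1 setT phi, compact (tsupport phi) & tsupport phi `<=` D]].

End euclidean_calculus.

Definition locally_lipschitz {R : realType} (f : R -> R) : Prop :=
  forall t : R, exists2 A : set R, nbhs t A & [lipschitz f x | x in A].

(* f'_-(t); lime_inf is taken over punctured neighborhoods. *)
Definition lower_derivative {R : realType} (f : R -> R) (t : R) : \bar R :=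
  lime_inf (fun h : R => ((f (t + h) - f t) / h)%:E) 0.

Definition solution {R : realType} {N : nat} (D : set 'rV[R]_N) (f : R -> R)
    (u : 'rV[R]_N -> R) : Prop :=
  class_C 2 D u /\ forall x, D x -> - laplacian u x = f (u x).

Definition stable {R : realType} {N : nat} (D : set 'rV[R]_N) (f : R -> R)
    (u : 'rV[R]_N -> R) : Prop :=
  forall phi, C1c D phi ->
    (integral_RN D (fun x => lower_derivative f (u x) * (phi x ^+ 2)%:E)
     <= integral_RN D (fun x => (sqr_euclidean_norm (gradient phi x))%:E))%E.

(* Main.v *)
Require Import Defs.
From HB Require Import structures.
From mathcomp Require Import all_boot all_order all_algebra.
From mathcomp Require Import all_classical all_reals all_analysis.
From mathcomp Require Import measurable_realfun ring lra.
Set Implicit Arguments.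
Unset Strict Implicit.
Unset Printing Implicit Defensive.
Import Order.TTheory GRing.Theory Num.Def Num.Theory.
Import numFieldTopology.Exports numFieldNormedType.Exports.
Local Open Scope classical_set_scope.
Local Open Scope ring_scope.

(** Let [F] be the squared length of the gradient of [u], and [h r] the
    integral of [F] over the ball of radius [r] centred at the origin. As
    [f >= 0], [u] is superharmonic; [v], which is [u] minus its infimum, is a
    nonnegative superharmonic function with infimum 0 and the same derivatives.
    The goal is [F = 0]. Three ideas are combined.

    Linearization. Stability provides a bounded potential [d], the derivative
    of [f] at [u], such that the integral of [d phi^2] is at most that of
    [|grad phi|^2], and every derivative [u_i] solves [- Delta u_i = d u_i] in
    the weak sense. As [f] is merely locally Lipschitz, its derivative exists
    off a null set [Z] only; but almost every point with [u] in [Z] is a zero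
    of [u_i] ([null_preimage], [stable_linearized]).

    Decay of the energy. Testing stability with [|grad u|] times a cutoff (the
    method of Sternberg and Zumbrun) controls the Hessian up to its part along
    the gradient; the missing part is recovered from the sign of [Delta u] and
    from a divergence. So the gradient of [F] is bounded in L1 by [F] itself
    ([grad_energy]). A Poincare inequality obtained by translating a weight,
    small where [v] is large, then bounds [F] by its part where [v] is small,
    up to a small multiple of the energy of a larger ball
    ([weighted_poincare]); the part where [v] is small is controlled because a
    concave truncation of [v] is again superharmonic ([trunc_energy]).
    Iterating over concentric balls gives
    [h r <= C r^(- n - 2) (integral of v over the ball of radius 2r)^2]
    ([energy_le_L1]). By the mean value property that integral is at most
    [C r^n v x0] for every fixed [x0] and all large [r], hence [o(r^n)] since
    [v] has infimum 0 ([integ_ball_small]). So [h r = o(r^(n - 2))]. If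
    [n <= 2], this already gives [F = 0].

    Weighted energy. If [n >= 3], stability is tested with [(x . grad u) eta],
    where [eta] is [(1 + |x|^2)^(- (n - 2) / 4)] times a cutoff at scale [r].
    The linearized equation and a Pohozaev identity ([radial_ineq]) leave the
    integral of [eta^2 F / (1 + |x|^2)] on one side, its other terms having a
    favourable sign when [(n - 2) / 2 <= 4], that is [n <= 10]; the
    derivatives of the cutoff contribute [r^(2 - n) h (2 r)], which tends to 0
    ([weighted_energy]). Hence [F = 0] again, and [u] is constant. *)

(** * Borel sets of row vectors are measurable on tuples *)

Section row_measurability.
Context {R : realType}.
Notation T n := (n.-tuple (measurableTypeR R)).

Definition tuple_of_row n (x : 'rV[R]_n) : T n := [tuple x 0 i | i < n].

Lemma tuple_of_rowK n : cancel (@tuple_of_row n) row_of_tuple.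
Proof. by move=> x; apply/rowP => i; rewrite mxE tnth_mktuple. Qed.

Lemma coord_le_norm n (x : 'rV[R]_n) i : `|x 0 i| <= `|x|.
Proof.
rewrite [leRHS]/normr /= mx_normrE; apply/bigmax_geP; right => /=.
by exists (0, i).
Qed.

Lemma norm_le_coord n (x : 'rV[R]_n) r : 0 <= r -> (forall i, `|x 0 i| <= r) -> `|x| <= r.
Proof.
move=> r0 H; rewrite [leLHS]/normr /= mx_normrE; apply/bigmax_leP; split=> // -[i j] _ /=.
by rewrite ord1.
Qed.

Lemma row_ballP n (x y : 'rV[R]_n) e : 0 < e -> (forall i, `|x 0 i - y 0 i| < e) -> ball x e y.
Proof.
by move=> e0 H; split=> // i j; rewrite ord1 /ball /=.
Qed.

(** The boxes with rational centre and radius [1/(k+1)] form a countable base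
    of the topology, and each of them is measurable coordinatewise: they link
    the topology of row vectors with the sigma-algebra of tuples. *)
Definition qbox n (p : 'rV[rat]_n * nat) : set 'rV[R]_n :=
  [set x | forall i, `|x 0 i - ratr (p.1 0 i)| < p.2.+1%:R^-1].

Lemma measurable_qbox n p : measurable (@row_of_tuple R n @^-1` qbox p).
Proof.
rewrite [X in measurable X](_ : _ = \big[setI/setT]_(i < n)
   ((fun t : T n => tnth t i) @^-1` ball (ratr (p.1 0 i) : R) p.2.+1%:R^-1)).
  apply: bigsetI_measurable => i _; rewrite -[X in measurable X]setTI.
  apply: measurable_tnth => //; apply: open_measurable; exact: ball_open.
rewrite -bigcap_seq; apply/seteqP; split => t /= H i => [_|].
  by have := H i; rewrite mxE /ball /= distrC.
by rewrite mxE; have := H i (mem_index_enum _); rewrite /ball /= distrC.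
Qed.

Lemma open_bigcup_qbox n (O : set 'rV[R]_n) : open O ->
  O = \bigcup_(p in [set p | qbox p `<=` O]) qbox p.
Proof.
move=> oO; apply/seteqP; split=> [x Ox|x [p /= pO px]]; last exact: pO.
have /nbhs_ballP[e /= e0 eO] : nbhs x O by move: oO; rewrite openE => /(_ _ Ox).
have [k ke] : exists k : nat, 0 + k.+1%:R^-1 < e / 2 by apply: ltr_add_invr; rewrite divr_gt0.
have hq i : exists q : rat, `|x 0 i - ratr q| < k.+1%:R^-1.
  have k0 : 0 < k.+1%:R^-1 :> R by rewrite invr_gt0.
  have [|q] := @rat_in_itvoo R (x 0 i - k.+1%:R^-1) (x 0 i + k.+1%:R^-1).
    by rewrite ltrBlDr -addrA ltrDl addr_gt0.
  by rewrite in_itv /= => /andP[h1 h2]; exists q; rewrite distrC ltr_distl; apply/andP; split.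
have [q hqq] := choice hq.
exists (\row_i q i, k) => /=; last by move=> i /=; rewrite mxE.
move=> y /= hy; apply: eO; apply: row_ballP => // i.
have := hy i; rewrite mxE /= => h1; have h2 := hqq i.
rewrite (le_lt_trans (ler_distD (ratr (q i)) _ _))// [X in _ + X]distrC.
move: ke; rewrite add0r => ke; rewrite (splitr e); apply: ltrD; exact: lt_trans ke.
Qed.

Lemma measurable_open_row n (O : set 'rV[R]_n) : open O ->
  measurable (@row_of_tuple R n @^-1` O).
Proof.
move=> oO; rewrite (open_bigcup_qbox oO) preimage_bigcup bigcup_mkcond.
apply: countable_bigcupT_measurable => [//|p].
by case: ifP => _; [exact: measurable_qbox|exact: measurable0].
Qed.

Lemma measurable_cont n (g : 'rV[R]_n -> R) : continuous g ->
  measurable_fun setT (g \o row_of_tuple).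
Proof.
move=> cg; apply: (measurability _ (RGenOpens.measurableE R)).
move=> /= _ [_ [a [b ->] <-]]; rewrite setTI comp_preimage.
apply: measurable_open_row.
by move: cg => /continuousP; apply; exact: interval_open.
Qed.

End row_measurability.

(** * Integration of locally bounded functions with bounded support *)

Section bounded_support.
Context {R : realType}.
Notation T n := (n.-tuple (measurableTypeR R)).
Notation mu n := (@lebesgue_tuple R n).

Definition row_measurable n (g : 'rV[R]_n -> R) := measurable_fun [set: T n] (g \o row_of_tuple).
Definition locally_bounded n (g : 'rV[R]_n -> R) :=
  forall r, exists M, forall x, `|x| <= r -> `|g x| <= M.
Definition lbm n (g : 'rV[R]_n -> R) := row_measurable g /\ locally_bounded g.
Definition bsupp n (g : 'rV[R]_n -> R) := exists r : R, forall x, r < `|x| -> g x = 0.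
Definition integ n (g : 'rV[R]_n -> R) : R := (\int[mu n]_t g (row_of_tuple t))%R.

Lemma closed_ball_compact n r : compact [set x : 'rV[R]_n | `|x| <= r].
Proof.
apply: bounded_closed_compact.
  by exists r; split; [exact: num_real|move=> M rM x /= xr; exact: le_trans xr (ltW rM)].
apply: (@closed_comp _ _ (fun x : 'rV[R]_n => `|x|) [set t : R | t <= r]).
  by move=> x _; exact: norm_continuous.
exact: closed_le.
Qed.

Lemma locally_bounded_cont n (g : 'rV[R]_n -> R) : continuous g -> locally_bounded g.
Proof.
move=> cg r.
have /compact_bounded[M [_ HM]] : compact (g @` [set x : 'rV[R]_n | `|x| <= r]).
  apply: continuous_compact; last exact: closed_ball_compact.
  exact: continuous_subspaceT.
exists (M + 1) => x xr; apply: (HM (M + 1)); first by rewrite ltrDl.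
by exists x.
Qed.

Lemma lbm_cont n (g : 'rV[R]_n -> R) : continuous g -> lbm g.
Proof. by move=> cg; split; [exact: measurable_cont|exact: locally_bounded_cont]. Qed.

Lemma lbm_cst n (c : R) : lbm (fun _ : 'rV[R]_n => c).
Proof. by apply: lbm_cont; exact: cst_continuous. Qed.

Lemma lbmD n (f g : 'rV[R]_n -> R) : lbm f -> lbm g -> lbm (fun x => f x + g x).
Proof.
move=> [mf bf] [mg bg]; split; first exact: measurable_funD mf mg.
move=> r; have [M HM] := bf r; have [M' HM'] := bg r.
by exists (M + M') => x xr; rewrite (le_trans (ler_normD _ _))// lerD ?HM ?HM'.
Qed.

Lemma lbmM n (f g : 'rV[R]_n -> R) : lbm f -> lbm g -> lbm (fun x => f x * g x).
Proof.
move=> [mf bf] [mg bg]; split; first exact: measurable_funM mf mg.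
move=> r; have [M HM] := bf r; have [M' HM'] := bg r.
by exists (M * M') => x xr; rewrite normrM ler_pM ?HM ?HM'.
Qed.

Lemma lbmZ n c (f : 'rV[R]_n -> R) : lbm f -> lbm (fun x => c * f x).
Proof. by move=> hf; apply: lbmM => //; exact: lbm_cst. Qed.

Lemma lbmN n (f : 'rV[R]_n -> R) : lbm f -> lbm (fun x => - f x).
Proof. by move=> hf; under eq_fun do rewrite -mulN1r; exact: lbmZ. Qed.

Lemma lbmB n (f g : 'rV[R]_n -> R) : lbm f -> lbm g -> lbm (fun x => f x - g x).
Proof. by move=> hf hg; apply: lbmD => //; exact: lbmN. Qed.

Lemma lbm_sum n (I : Type) (s : seq I) (f : I -> 'rV[R]_n -> R) :
  (forall i, lbm (f i)) -> lbm (fun x => \sum_(i <- s) f i x).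
Proof.
move=> hf; elim: s => [|i s IH].
  by under eq_fun do rewrite big_nil; exact: lbm_cst.
by under eq_fun do rewrite big_cons; exact: lbmD.
Qed.

Lemma lbmX n k (f : 'rV[R]_n -> R) : lbm f -> lbm (fun x => f x ^+ k).
Proof.
move=> hf; elim: k => [|k IH].
  by under eq_fun do rewrite expr0; exact: lbm_cst.
by under eq_fun do rewrite exprS; exact: lbmM.
Qed.

Lemma lbm_abs n (f : 'rV[R]_n -> R) : lbm f -> lbm (fun x => `|f x|).
Proof.
move=> [mf bf]; split; first exact: (measurableT_comp (@normr_measurable _ _) mf).
by move=> r; have [M HM] := bf r; exists M => x xr; rewrite normr_id HM.
Qed.

Lemma lbm_indic_open n (A : set 'rV[R]_n) : open A -> lbm (\1_A : 'rV[R]_n -> R).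
Proof.
move=> oA; split; last first.
  by move=> r; exists 1 => x _; rewrite indicE; case: (_ \in _); rewrite ?normr1 ?normr0.
have mA := measurable_open_row oA.
rewrite /row_measurable (_ : _ \o _ = \1_(row_of_tuple @^-1` A)); first exact: measurable_indic.
by apply/funext => t /=; rewrite !indicE.
Qed.

Lemma bsuppM n (f g : 'rV[R]_n -> R) : bsupp f -> bsupp (fun x => f x * g x).
Proof. by move=> [r hr]; exists r => x xr; rewrite hr// mul0r. Qed.

Lemma bsuppMr n (f g : 'rV[R]_n -> R) : bsupp g -> bsupp (fun x => f x * g x).
Proof. by move=> [r hr]; exists r => x xr; rewrite hr// mulr0. Qed.

Lemma bsuppD n (f g : 'rV[R]_n -> R) : bsupp f -> bsupp g -> bsupp (fun x => f x + g x).
Proof.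
move=> [r hr] [s hs]; exists (maxr r s) => x; rewrite gt_max => /andP[xr xs].
by rewrite hr// hs// addr0.
Qed.

Lemma bsuppN n (f : 'rV[R]_n -> R) : bsupp f -> bsupp (fun x => - f x).
Proof. by move=> [r hr]; exists r => x xr; rewrite hr// oppr0. Qed.

Lemma bsuppB n (f g : 'rV[R]_n -> R) : bsupp f -> bsupp g -> bsupp (fun x => f x - g x).
Proof. by move=> hf hg; apply: bsuppD => //; exact: bsuppN. Qed.

Lemma bsuppX n k (f : 'rV[R]_n -> R) : bsupp f -> bsupp (fun x => f x ^+ k.+1).
Proof. by move=> [r hr]; exists r => x xr; rewrite hr// expr0n. Qed.

Lemma bsupp_abs n (f : 'rV[R]_n -> R) : bsupp f -> bsupp (fun x => `|f x|).
Proof. by move=> [r hr]; exists r => x xr; rewrite hr// normr0. Qed.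

Lemma bsupp_sum n (I : Type) (s : seq I) (f : I -> 'rV[R]_n -> R) :
  (forall i, bsupp (f i)) -> bsupp (fun x => \sum_(i <- s) f i x).
Proof.
move=> hf; elim: s => [|i s IH].
  by exists 0 => x _; rewrite big_nil.
by under eq_fun do rewrite big_cons; exact: bsuppD.
Qed.

Lemma cube_measure n (r : R) : 0 <= r ->
  mu n (row_of_tuple @^-1` [set x : 'rV[R]_n | forall i, `|x 0 i| <= r]) = ((2 * r) ^+ n)%:E.
Proof.
move=> r0; have := @lebesgue_tuple_box R n (fun=> `[-r, r]%classic) (fun=> measurable_itv _).
rewrite (_ : [set t | _] = row_of_tuple @^-1` [set x : 'rV[R]_n | forall i, `|x 0 i| <= r]).
  move=> ->; rewrite (eq_bigr (fun=> (2 * r)%:E)); last first.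
    move=> i _; rewrite lebesgue_measure_itv /= lte_fin.
    case: ltP => h; first by rewrite -EFinD opprK mulr2n mulrDl mul1r.
    suff -> : r = 0 by rewrite mulr0.
    by apply/eqP; rewrite eq_le r0 andbT; rewrite -subr_ge0 -opprD -mulr2n oppr_ge0 pmulrn_lle0 in h.
  by rewrite prodEFin prodr_const card_ord.
by apply/seteqP; split => t /= H i; have := H i; rewrite in_itv /= mxE ler_norml.
Qed.

Lemma measurable_cube n (r : R) :
  measurable (row_of_tuple @^-1` [set x : 'rV[R]_n | forall i, `|x 0 i| <= r]).
Proof.
rewrite [X in measurable X](_ : _ = \big[setI/setT]_(i < n)
   ((fun t : T n => tnth t i) @^-1` `[-r, r])).
  apply: bigsetI_measurable => i _; rewrite -[X in measurable X]setTI.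
  by apply: measurable_tnth => //; exact: measurable_itv.
rewrite -bigcap_seq; apply/seteqP; split => t /= H i => [_|].
  by have := H i; rewrite mxE /= in_itv/= ler_norml.
by rewrite mxE; have := H i (mem_index_enum _); rewrite /= in_itv/= ler_norml.
Qed.

Lemma bsupp_gt0 n (g : 'rV[R]_n -> R) : bsupp g ->
  exists2 r : R, 0 < r & forall x, r < `|x| -> g x = 0.
Proof.
move=> [r hr]; exists (maxr r 1); first by rewrite lt_max ltr01 orbT.
by move=> x; rewrite gt_max => /andP[xr _]; exact: hr.
Qed.

Lemma integrable_lbm n (g : 'rV[R]_n -> R) : lbm g -> bsupp g ->
  (mu n).-integrable setT (EFin \o (g \o row_of_tuple)).
Proof.
move=> [mg bg] /bsupp_gt0[r r0 hr].
set Q := row_of_tuple @^-1` [set x : 'rV[R]_n | forall i, `|x 0 i| <= r].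
have mQ : measurable Q by exact: measurable_cube.
rewrite (_ : EFin \o _ = (EFin \o (g \o row_of_tuple)) \_ Q); last first.
  apply/funext => t; rewrite patchE; case: ifPn => //; rewrite notin_setE => hQ /=.
  rewrite hr// ltNge; apply/negP => h; apply: hQ => i.
  exact: le_trans (coord_le_norm _ _) h.
apply/(integrable_mkcond _ mQ).
apply: (@measurable_bounded_integrable _ _ R (mu n) (g \o row_of_tuple) Q) => //.
- have h : (mu n Q < +oo)%E by rewrite /Q cube_measure ?ltW// ltry.
  exact: h.
- exact: measurable_funTS.
- have [M HM] := bg r; exists M; split; first exact: num_real.
  move=> K MK t Qt /=; rewrite (le_trans _ (ltW MK))// HM//.
  by apply: norm_le_coord; [exact: ltW|exact: Qt].
Qed.

(** The functions integrated below: continuous functions with bounded support,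
    indicators of balls and cubes, and their products with the derivative of [f]
    at [u]. The class is stable by the algebraic operations, and its members are
    integrable. *)
Definition lbmc n (g : 'rV[R]_n -> R) := lbm g /\ bsupp g.

Lemma integrable_lbmc n (g : 'rV[R]_n -> R) : lbmc g ->
  (mu n).-integrable setT (EFin \o (g \o row_of_tuple)).
Proof. by case=> *; exact: integrable_lbm. Qed.

Lemma lbmcD n (f g : 'rV[R]_n -> R) : lbmc f -> lbmc g -> lbmc (fun x => f x + g x).
Proof. by move=> [? ?] [? ?]; split; [exact: lbmD|exact: bsuppD]. Qed.

Lemma lbmcB n (f g : 'rV[R]_n -> R) : lbmc f -> lbmc g -> lbmc (fun x => f x - g x).
Proof. by move=> [? ?] [? ?]; split; [exact: lbmB|exact: bsuppB]. Qed.

Lemma lbmcN n (f : 'rV[R]_n -> R) : lbmc f -> lbmc (fun x => - f x).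
Proof. by move=> [? ?]; split; [exact: lbmN|exact: bsuppN]. Qed.

Lemma lbmcMl n (f g : 'rV[R]_n -> R) : lbmc f -> lbm g -> lbmc (fun x => f x * g x).
Proof. by move=> [? ?] ?; split; [exact: lbmM|exact: bsuppM]. Qed.

Lemma lbmcMr n (f g : 'rV[R]_n -> R) : lbm f -> lbmc g -> lbmc (fun x => f x * g x).
Proof. by move=> ? [? ?]; split; [exact: lbmM|exact: bsuppMr]. Qed.

Lemma lbmcZ n c (f : 'rV[R]_n -> R) : lbmc f -> lbmc (fun x => c * f x).
Proof. by move=> hf; apply: lbmcMr => //; exact: lbm_cst. Qed.

Lemma lbmc_abs n (f : 'rV[R]_n -> R) : lbmc f -> lbmc (fun x => `|f x|).
Proof. by move=> [? ?]; split; [exact: lbm_abs|exact: bsupp_abs]. Qed.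

Lemma lbmc_sum n (I : Type) (s : seq I) (f : I -> 'rV[R]_n -> R) :
  (forall i, lbmc (f i)) -> lbmc (fun x => \sum_(i <- s) f i x).
Proof. by move=> hf; split; [apply: lbm_sum|apply: bsupp_sum] => i; have [] := hf i. Qed.

Lemma lbmcX n k (f : 'rV[R]_n -> R) : lbmc f -> lbmc (fun x => f x ^+ k.+1).
Proof. by move=> [? ?]; split; [exact: lbmX|exact: bsuppX]. Qed.

Lemma integD n (f g : 'rV[R]_n -> R) : lbmc f -> lbmc g ->
  integ (fun x => f x + g x) = integ f + integ g.
Proof. by move=> hf hg; apply: RintegralD => //; exact: integrable_lbmc. Qed.

Lemma integZ n c (f : 'rV[R]_n -> R) : lbmc f -> integ (fun x => c * f x) = c * integ f.
Proof. by move=> hf; apply: RintegralZl => //; exact: integrable_lbmc. Qed.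

Lemma integN n (f : 'rV[R]_n -> R) : lbmc f -> integ (fun x => - f x) = - integ f.
Proof.
move=> hf; rewrite -mulN1r -integZ//; congr integ; apply/funext => x; by rewrite mulN1r.
Qed.

Lemma integB n (f g : 'rV[R]_n -> R) : lbmc f -> lbmc g ->
  integ (fun x => f x - g x) = integ f - integ g.
Proof. by move=> hf hg; rewrite integD ?integN//; exact: lbmcN. Qed.

Lemma integ0 n : integ (fun _ : 'rV[R]_n => 0) = 0.
Proof.
rewrite -[RHS](mul0r (integ (fun _ : 'rV[R]_n => 0))) -integZ; last first.
  by split; [exact: lbm_cst|exists 0].
by under [in RHS]eq_fun do rewrite mulr0.
Qed.

Lemma integ_sum n (I : Type) (s : seq I) (f : I -> 'rV[R]_n -> R) :
  (forall i, lbmc (f i)) -> integ (fun x => \sum_(i <- s) f i x) = \sum_(i <- s) integ (f i).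
Proof.
move=> hf; elim: s => [|i s IH].
  by under eq_fun do rewrite big_nil; rewrite big_nil integ0.
by under eq_fun do rewrite big_cons; rewrite integD// ?IH ?big_cons//; exact: lbmc_sum.
Qed.

Lemma le_integ n (f g : 'rV[R]_n -> R) : lbmc f -> lbmc g -> (forall x, f x <= g x) ->
  integ f <= integ g.
Proof. by move=> hf hg fg; apply: le_Rintegral => //; exact: integrable_lbmc. Qed.

Lemma integ_ge0 n (f : 'rV[R]_n -> R) : (forall x, 0 <= f x) -> 0 <= integ f.
Proof. by move=> f0; apply: Rintegral_ge0. Qed.

Lemma le_abs_integ n (f : 'rV[R]_n -> R) : lbmc f -> `|integ f| <= integ (fun x => `|f x|).
Proof. by move=> hf; apply: le_normr_Rintegral => //; exact: integrable_lbmc. Qed.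

(** The domination is by a constant on a fixed ball. Convergence is allowed to
    fail on a null set, as it will for the difference quotients of [f \o u]. *)
Lemma integ_cvg n (f : nat -> 'rV[R]_n -> R) (g : 'rV[R]_n -> R) (r M : R) (E : set (T n)) :
  (forall k, row_measurable (f k)) -> row_measurable g ->
  (forall k x, `|f k x| <= M) -> (forall k x, r < `|x| -> f k x = 0) ->
  measurable E -> mu n E = 0%E ->
  (forall t, ~ E t -> f ^~ (row_of_tuple t) @ \oo --> g (row_of_tuple t)) ->
  (fun k => integ (f k)) @ \oo --> integ g.
Proof.
move=> mf mg fM fr mE E0 fg.
pose dom x := M * \1_[set x : 'rV[R]_n | `|x| < `|r| + 1] x.
have okd : lbmc dom.
  apply: lbmcZ; split.
    apply: lbm_indic_open; apply: (@open_comp _ _ (fun x : 'rV[R]_n => `|x|) [set t : R | t < `|r| + 1]).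
      by move=> x _; exact: norm_continuous.
    exact: open_lt.
  exists (`|r| + 1) => x xr; rewrite indicE memNset//= => h.
  by have := lt_trans xr h; rewrite ltxx.
have fd k x : `|f k x| <= dom x.
  rewrite /dom indicE; case: (boolP (_ \in _)) => h; rewrite ?mulr1 ?mulr0//.
  rewrite fr ?normr0//; move: h; rewrite notin_setE /= => /negP; rewrite -leNgt.
  by apply: lt_le_trans; rewrite (le_lt_trans (ler_norm r))// ltrDl.
have aeE : (mu n).-negligible E by exists E; split.
have [|||||ig _ H] := @dominated_convergence _ _ R (mu n) setT measurableT
  (fun k => EFin \o (f k \o row_of_tuple)) (EFin \o (g \o row_of_tuple)) (EFin \o (dom \o row_of_tuple)).
- by move=> k; apply/measurable_EFinP; exact: mf.
- by apply/measurable_EFinP; exact: mg.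
- exists E; split => // t /= H; apply: contrapT => nE; apply: H => _.
  by apply: cvg_EFin; [exact: nearW|exact: fg].
- exact: integrable_lbmc.
- by apply: aeW => t k _; rewrite /= lee_fin.
have fing : (\int[mu n]_t (EFin \o (g \o row_of_tuple)) t)%E \is a fin_num.
  exact: integrable_fin_num.
rewrite /integ /Rintegral.
by apply: fine_cvg; rewrite fineK.
Qed.
End bounded_support.

(** * Integration coordinate by coordinate *)

Section slices.
Context {R : realType}.
Notation T n := (n.-tuple (measurableTypeR R)).
Notation mu n := (@lebesgue_tuple R n).
Notation leb := (@lebesgue_measure R).

(** The counterpart of [tcons] for row vectors, by which statements about
    [R^n] are proved by induction on [n]. *)
Definition row_cons n (s : R) (y : 'rV[R]_n) : 'rV[R]_n.+1 :=
  \row_i oapp (fun j => y 0 j) s (unlift ord0 i).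

Lemma row_cons0 n s (y : 'rV[R]_n) : row_cons s y 0 ord0 = s.
Proof. by rewrite mxE unlift_none. Qed.

Lemma row_consS n s (y : 'rV[R]_n) j : row_cons s y 0 (lift ord0 j) = y 0 j.
Proof. by rewrite mxE liftK. Qed.

Lemma row_tcons n s (t : T n) : row_of_tuple (tcons (s, t)) = row_cons s (row_of_tuple t).
Proof.
apply/rowP => i; rewrite mxE; case: (unliftP ord0 i) => [j ->|->].
  by rewrite row_consS tnthS mxE.
by rewrite row_cons0 tnth0.
Qed.

Lemma coordD n (x y : 'rV[R]_n) i : (x + y) 0 i = x 0 i + y 0 i.
Proof. by rewrite mxE. Qed.

Lemma coordB n (x y : 'rV[R]_n) i : (x - y) 0 i = x 0 i - y 0 i.
Proof. by rewrite !mxE. Qed.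

Lemma coordZ n a (x : 'rV[R]_n) i : (a *: x) 0 i = a * x 0 i.
Proof. by rewrite mxE. Qed.

Lemma row_consD n s s' (y y' : 'rV[R]_n) : row_cons s y + row_cons s' y' = row_cons (s + s') (y + y').
Proof.
apply/rowP => i; case: (unliftP ord0 i) => [j ->|->]; rewrite coordD.
  by rewrite !row_consS coordD.
by rewrite !row_cons0.
Qed.

Lemma row_cons_delta0 n h : h *: delta_mx 0 ord0 = row_cons h (0 : 'rV[R]_n).
Proof.
apply/rowP => i; rewrite coordZ; case: (unliftP ord0 i) => [j ->|->].
  by rewrite row_consS !mxE [_ == ord0]eq_sym (negbTE (neq_lift _ _)) andbF mulr0.
by rewrite row_cons0 mxE !eqxx mulr1.
Qed.

Lemma row_cons_deltaS n h (j : 'I_n) :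
  h *: delta_mx 0 (lift ord0 j) = row_cons 0 (h *: delta_mx 0 j : 'rV[R]_n).
Proof.
apply/rowP => i; rewrite coordZ; case: (unliftP ord0 i) => [k ->|->].
  by rewrite row_consS coordZ !mxE (inj_eq lift_inj).
by rewrite row_cons0 mxE (negbTE (neq_lift _ _)) andbF mulr0.
Qed.

Lemma norm_row_cons_le n s (y : 'rV[R]_n) : `|row_cons s y| <= maxr `|s| `|y|.
Proof.
apply: norm_le_coord; first by rewrite le_max normr_ge0.
move=> i; case: (unliftP ord0 i) => [j ->|->].
  by rewrite row_consS le_max coord_le_norm orbT.
by rewrite row_cons0 le_max lexx.
Qed.

Lemma norm_row_cons_ger n s (y : 'rV[R]_n) : `|y| <= `|row_cons s y|.
Proof. by apply: norm_le_coord => // j; rewrite -(row_consS s) coord_le_norm. Qed.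

Lemma norm_row_cons_gel n s (y : 'rV[R]_n) : `|s| <= `|row_cons s y|.
Proof. by rewrite -[X in `|X| <= _](row_cons0 s y) coord_le_norm. Qed.

Lemma row_cons_continuousr n s : continuous (@row_cons n s).
Proof.
move=> y U /nbhs_ballP[e e0 eU]; apply/nbhs_ballP; exists e => // z [_ yz].
apply: eU; split=> // k i; rewrite ord1; case: (unliftP ord0 i) => [j ->|->].
  by rewrite !row_consS; exact: yz.
by rewrite !row_cons0; exact: ballxx.
Qed.

Lemma row_cons_continuousl n (y : 'rV[R]_n) : continuous (fun s => row_cons s y).
Proof.
move=> s; apply/cvgrPdist_lt => e e0; near=> z.
have h : `|s - z| < e by near: z; apply: cvgr_dist_lt => //; exact: cvg_id.
apply: le_lt_trans h; apply: norm_le_coord => // i; case: (unliftP ord0 i) => [j ->|->].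
  by rewrite coordB !row_consS subrr normr0.
by rewrite coordB !row_cons0.
Unshelve. all: by end_near. Qed.

Lemma measurable_tconsr n s : measurable_fun [set: T n] (fun t => tcons (s, t)).
Proof. exact: (measurableT_comp (@measurable_tcons R n) (pair1_measurable s)). Qed.

Lemma measurable_tconsl n (t : T n) : measurable_fun [set: measurableTypeR R] (fun s => tcons (s, t)).
Proof. exact: (measurableT_comp (@measurable_tcons R n) (pair2_measurable t)). Qed.

Lemma tonelli_cons1 n (h : T n.+1 -> \bar R) : measurable_fun setT h ->
  (forall t, 0 <= h t)%E ->
  (\int[mu n.+1]_t h t = \int[leb]_s \int[mu n]_t h (tcons (s, t)))%E.
Proof.
move=> mh h0; rewrite ge0_integral_pushforward//; last exact: measurable_tcons.
rewrite preimage_setT fubini_tonelli1//; last by move=> p; exact: h0.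
exact: (measurableT_comp mh (@measurable_tcons R n)).
Qed.

Lemma tonelli_cons2 n (h : T n.+1 -> \bar R) : measurable_fun setT h ->
  (forall t, 0 <= h t)%E ->
  (\int[mu n.+1]_t h t = \int[mu n]_t \int[leb]_s h (tcons (s, t)))%E.
Proof.
move=> mh h0; rewrite ge0_integral_pushforward//; last exact: measurable_tcons.
rewrite preimage_setT fubini_tonelli2//; last by move=> p; exact: h0.
exact: (measurableT_comp mh (@measurable_tcons R n)).
Qed.

Lemma null_cons1 n (E : set (T n.+1)) : measurable E ->
  (forall s, mu n [set t | E (tcons (s, t))] = 0%E) -> mu n.+1 E = 0%E.
Proof.
move=> mE H; rewrite -[E]setIT -integral_indic//.
rewrite (tonelli_cons1 (h := fun t => (\1_E t)%:E)); last 2 first.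
- by apply/measurable_EFinP; exact: measurable_indic.
- by move=> t; rewrite lee_fin.
rewrite integral0_eq// => s _.
rewrite -(H s) -[X in mu n X]setIT -integral_indic//.
by rewrite -[X in measurable X]setTI; exact: measurable_tconsr.
Qed.

Lemma null_cons2 n (E : set (T n.+1)) : measurable E ->
  (forall t, leb [set s | E (tcons (s, t))] = 0%E) -> mu n.+1 E = 0%E.
Proof.
move=> mE H; rewrite -[E]setIT -integral_indic//.
rewrite (tonelli_cons2 (h := fun t => (\1_E t)%:E)); last 2 first.
- by apply/measurable_EFinP; exact: measurable_indic.
- by move=> t; rewrite lee_fin.
rewrite integral0_eq// => t _.
rewrite -(H t) -[X in leb X]setIT -integral_indic//.
by rewrite -[X in measurable X]setTI; exact: measurable_tconsl.
Qed.

Lemma lbmc_slice n (g : 'rV[R]_n.+1 -> R) s : lbmc g -> lbmc (fun y => g (row_cons s y)).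
Proof.
move=> [[mg bg] [r hr]]; split; first split.
- have := measurableT_comp mg (@measurable_tconsr n s).
  by apply: eq_measurable_fun => t _ /=; rewrite row_tcons.
- move=> r'; have [M HM] := bg (maxr `|s| r'); exists M => y yr; apply: HM.
  by rewrite (le_trans (norm_row_cons_le _ _))// ge_max !le_max lexx yr orbT.
- by exists r => y yr; apply: hr; exact: lt_le_trans (norm_row_cons_ger _ _).
Qed.

Lemma integrable_cons n (g : 'rV[R]_n.+1 -> R) : lbmc g ->
  (leb \x mu n)%E.-integrable setT (fun p => (g (row_cons p.1 (row_of_tuple p.2)))%:E).
Proof.
move=> okg; have /integrableP[mg ig] := integrable_lbmc okg.
have e : (fun p : measurableTypeR R * T n => (g (row_cons p.1 (row_of_tuple p.2)))%:E) =
   (EFin \o (g \o row_of_tuple)) \o @tcons R n.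
  by apply/funext => -[s t] /=; rewrite row_tcons.
rewrite e; apply/integrableP; split.
  exact: (measurableT_comp mg (@measurable_tcons R n)).
move: ig; rewrite ge0_integral_pushforward ?preimage_setT//.
- exact: measurable_tcons.
- exact: measurableT_comp.
Qed.

Lemma integral_cons n (g : 'rV[R]_n.+1 -> R) : lbmc g ->
  (\int[mu n.+1]_t (g (row_of_tuple t))%:E =
   \int[leb \x mu n]_p (g (row_cons p.1 (row_of_tuple p.2)))%:E)%E.
Proof.
move=> okg; have ig := integrable_lbmc okg; have icg := integrable_cons okg.
have e : (fun p : measurableTypeR R * T n => (g (row_cons p.1 (row_of_tuple p.2)))%:E) =
   (EFin \o (g \o row_of_tuple)) \o @tcons R n.
  by apply/funext => -[s t] /=; rewrite row_tcons.
rewrite (@integral_pushforward _ _ _ _ R (@tcons R n) (@measurable_tcons R n) (leb \x mu n)%E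
  setT (fun t => (g (row_of_tuple t))%:E)) ?preimage_setT//.
- by apply: eq_integral => -[s t] _ /=; rewrite row_tcons.
- by case/integrableP: ig.
- by move: icg; rewrite e.
Qed.

Lemma integ_cons n (g : 'rV[R]_n.+1 -> R) : lbmc g ->
  integ g = (\int[leb]_s integ (fun y => g (row_cons s y)))%R.
Proof.
move=> okg; rewrite /integ /Rintegral integral_cons// -integral12_prod_meas1; last exact: integrable_cons.
congr fine; apply: eq_integral => s _; rewrite fineK//.
by apply: integrable_fin_num => //; exact: (integrable_lbmc (lbmc_slice s okg)).
Qed.

Lemma integ_cons_eq0 n (g : 'rV[R]_n.+1 -> R) : lbmc g ->
  (forall y, (\int[leb]_s (g (row_cons s y))%:E = 0)%E) -> integ g = 0.
Proof.
move=> okg H; rewrite /integ /Rintegral integral_cons// -integral21_prod_meas1; last exact: integrable_cons.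
by rewrite integral0_eq// => t _; exact: (H (row_of_tuple t)).
Qed.

(** Both derivatives are limits of the same quotients. *)
Lemma is_derive_line (V W U : normedModType R) (f : V -> U) (g : W -> U) x v y w d :
  (forall h, g (h *: w + y) = f (h *: v + x)) -> is_derive x v f d -> is_derive y w g d.
Proof.
move=> fg [df Df].
have e : (fun h => h^-1 *: ((g \o shift y) (h *: w) - g y)) =
         (fun h => h^-1 *: ((f \o shift x) (h *: v) - f x)).
  apply/funext => h /=; rewrite fg; congr (_ *: (_ - _)).
  by have := fg 0; rewrite !scale0r !add0r.
by split; [rewrite /derivable e|rewrite /derive e].
Qed.

Lemma integral_derive1_eq0 (f f' : R -> R) (r : R) : continuous f' ->
  (forall s : R, is_derive s 1 f (f' s)) -> (forall s, r < `|s| -> f s = 0) ->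
  (forall s, r < `|s| -> f' s = 0) ->
  (\int[leb]_s (f' s)%:E = 0)%E.
Proof.
move=> cf' df hf hf'.
pose a := `|r| + 1.
have a0 : 0 < a by rewrite ltr_wpDl.
have ra (s : R) : a <= `|s| -> r < `|s|.
  by apply: lt_le_trans; rewrite (le_lt_trans (ler_norm r))// ltrDl.
have cf : continuous f by move=> s; apply/differentiable_continuous/derivable1_diffP; exact: ex_derive.
transitivity (\int[leb]_(s in `[(- a)%R, a]) (f' s)%:E)%E.
  rewrite [RHS]integral_mkcond; apply: eq_integral => s _; rewrite patchE.
  case: ifPn => //; rewrite notin_setE/= in_itv/= => /negP; rewrite -ler_norml -ltNge => h.
  by rewrite hf'//; apply/ra/ltW.
rewrite (@continuous_FTC2 _ f' f).
- by rewrite !hf ?subee//; apply: ra; rewrite ?normrN gtr0_norm.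
- by rewrite gt0_cp.
- exact: continuous_subspaceT.
- split=> [s _||]; first exact: ex_derive.
  + by apply: cvg_at_right_filter; exact: cf.
  + by apply: cvg_at_left_filter; exact: cf.
- by move=> s _; rewrite derive1E derive_val.
Qed.

(** Integrate first along the direction of derivation, where this is the
    fundamental theorem of calculus. *)
Lemma integ_partial_eq0 n (i : 'I_n) (f f' : 'rV[R]_n -> R) :
  continuous f' -> (forall x, is_derive x (delta_mx 0 i) f (f' x)) ->
  bsupp f -> bsupp f' -> integ f' = 0.
Proof.
elim: n i f f' => [[]//|n IH] i f f' cf' df bf bf'.
have okf' : lbmc f' by split => //; exact: lbm_cont.
case: (unliftP ord0 i) df => [j ->|->] df.
  rewrite integ_cons//.
  rewrite (_ : (fun s => _) = cst 0); last first.
    apply/funext => s /=; apply: (IH j (fun y => f (row_cons s y))).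
    - by move=> y; apply: continuous_comp; [exact: row_cons_continuousr|exact: cf'].
    - move=> y; apply: (is_derive_line _ (df (row_cons s y))) => h.
      by rewrite row_cons_deltaS row_consD add0r.
    - by case: bf => r hr; exists r => y yr; apply: hr; exact: lt_le_trans (norm_row_cons_ger _ _).
    - by case: bf' => r hr; exists r => y yr; apply: hr; exact: lt_le_trans (norm_row_cons_ger _ _).
  by rewrite /Rintegral integral0_eq.
apply: integ_cons_eq0 => // y.
have [r hr] := bf; have [r' hr'] := bf'.
apply: (@integral_derive1_eq0 (fun s => f (row_cons s y)) _ (maxr r r')).
- by move=> s; apply: continuous_comp; [exact: row_cons_continuousl|exact: cf'].
- move=> s; apply: (is_derive_line _ (df (row_cons s y))) => h.
  by rewrite row_cons_delta0 row_consD add0r [h *: 1]mulr1.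
- by move=> s; rewrite gt_max => /andP[h _]; apply: hr; exact: lt_le_trans (norm_row_cons_gel _ _).
- by move=> s; rewrite gt_max => /andP[_ h]; apply: hr'; exact: lt_le_trans (norm_row_cons_gel _ _).
Qed.
End slices.

(** * Translations, and functions with a continuous gradient *)

Section translations.
Context {R : realType}.
Notation T n := (n.-tuple (measurableTypeR R)).
Notation mu n := (@lebesgue_tuple R n).
Notation leb := (@lebesgue_measure R).

Lemma measurable_shift (a : R) :
  measurable_fun [set: measurableTypeR R] (fun s : measurableTypeR R => s + a : measurableTypeR R).
Proof. by apply: measurable_funD; [exact: measurable_id|exact: measurable_cst]. Qed.

Lemma leb_shift (a : R) (A : set (measurableTypeR R)) : measurable A ->
  leb ((fun s => s + a) @^-1` A) = leb A.
Proof.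
move=> mA; symmetry; have mf := measurable_shift a.
apply: (@lebesgue_measure_unique R (pushforward leb (fun s : measurableTypeR R => s + a : measurableTypeR R))) => //.
move=> _ [[b c] _ <-] /=; rewrite /pushforward.
rewrite (_ : _ @^-1` _ = `](b - a), (c - a)]%classic); last first.
  by apply/seteqP; split => s /=; rewrite !in_itv/= ltrBlDr lerBrDr.
rewrite !lebesgue_measure_itv /= !lte_fin ltrD2r; case: ifP => // _.
by rewrite -!EFinD; congr EFin; ring.
Qed.

Lemma ge0_integral_shift (a : R) (h : measurableTypeR R -> \bar R) :
  measurable_fun setT h -> (forall s, 0 <= h s)%E ->
  (\int[leb]_s h (s + a)%R = \int[leb]_s h s)%E.
Proof.
move=> mh h0; have mf := measurable_shift a.
have := @ge0_integral_pushforward _ _ _ _ R _ mf leb setT h measurableT mh (fun y _ => h0 y).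
rewrite preimage_setT => <-; apply: eq_measure_integral => // A mA _.
by rewrite /pushforward -[RHS](leb_shift a).
Qed.

Lemma measurable_rowD n (z : 'rV[R]_n) :
  measurable_fun [set: T n] (fun t => tuple_of_row (row_of_tuple t + z)).
Proof.
apply/measurable_fun_tnthP => i; rewrite /comp.
apply: (eq_measurable_fun (fun t : T n => tnth t i + z 0 i : measurableTypeR R)).
  by move=> t _; rewrite tnth_mktuple coordD mxE.
apply: measurable_funD; [exact: measurable_tnth|exact: measurable_cst].
Qed.

Lemma row_of_tupleK n : cancel (@row_of_tuple R n) (@tuple_of_row R n).
Proof. by move=> t; apply: eq_from_tnth => i; rewrite tnth_mktuple mxE. Qed.

Lemma ge0_integral_shift_row n (z : 'rV[R]_n) (h : T n -> \bar R) :
  measurable_fun setT h -> (forall t, 0 <= h t)%E ->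
  (\int[mu n]_t h (tuple_of_row (row_of_tuple t + z)) = \int[mu n]_t h t)%E.
Proof.
elim: n z h => [|n IH] z h mh h0.
  by apply: eq_integral => t _; rewrite [tuple_of_row _]tuple0 [t]tuple0.
have [z0 [z' ->]] : exists z0 z', z = row_cons z0 z'.
  exists (z 0 ord0), (\row_j z 0 (lift ord0 j)); apply/rowP => i.
  by case: (unliftP ord0 i) => [j ->|->]; rewrite ?row_consS ?row_cons0 ?mxE.
have e s t : tuple_of_row (row_of_tuple (tcons (s, t)) + row_cons z0 z') =
   tcons (s + z0, tuple_of_row (row_of_tuple t + z')).
  by rewrite -[RHS]row_of_tupleK !row_tcons tuple_of_rowK row_consD.
rewrite tonelli_cons1//; last first.
  exact: (measurableT_comp mh (measurable_rowD _)).
under eq_integral do under eq_integral do rewrite e.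
under eq_integral => s _.
  rewrite (IH z' (fun t => h (tcons (s + z0, t)))); last 2 first.
  - exact: (measurableT_comp mh (measurable_tconsr _)).
  - by move=> t; exact: h0.
  over.
rewrite /= (tonelli_cons1 mh h0).
apply: (@ge0_integral_shift z0 (fun s => (\int[mu n]_t h (tcons (s, t)))%E)).
  apply: (@measurable_fun_fubini_tonelli_F _ _ _ _ R (mu n) (h \o @tcons R n)).
  - exact: (measurableT_comp mh (@measurable_tcons R n)).
  - by move=> p; exact: h0.
by move=> s; apply: integral_ge0 => t _; exact: h0.
Qed.

Lemma lbm_shift n z (g : 'rV[R]_n -> R) : lbm g -> lbm (fun x => g (x + z)).
Proof.
move=> [mg bg]; split.
  have := measurableT_comp mg (measurable_rowD z).
  by apply: eq_measurable_fun => t _ /=; rewrite tuple_of_rowK.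
move=> r; have [M HM] := bg (r + `|z|); exists M => x xr; apply: HM.
by rewrite (le_trans (ler_normD _ _))// lerD2r.
Qed.

Lemma bsupp_shift n z (g : 'rV[R]_n -> R) : bsupp g -> bsupp (fun x => g (x + z)).
Proof.
move=> [r hr]; exists (r + `|z|) => x xr; apply: hr.
by rewrite -(ltrD2r `|z|) (lt_le_trans xr)// -[X in `|X| <= _](addrK z x) ler_normB.
Qed.

Lemma lbmc_shift n z (g : 'rV[R]_n -> R) : lbmc g -> lbmc (fun x => g (x + z)).
Proof. by move=> [? ?]; split; [exact: lbm_shift|exact: bsupp_shift]. Qed.

Lemma integ_shift_ge0 n z (g : 'rV[R]_n -> R) : row_measurable g -> (forall x, 0 <= g x) ->
  integ (fun x => g (x + z)) = integ g.
Proof.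
move=> mg g0; rewrite /integ /Rintegral; congr fine.
rewrite -(ge0_integral_shift_row z (h := fun t => (g (row_of_tuple t))%:E)).
- by under [RHS]eq_integral do rewrite tuple_of_rowK.
- by apply/measurable_EFinP; exact: mg.
- by move=> t; rewrite lee_fin.
Qed.

Lemma integ_swap n (k : 'rV[R]_n -> 'rV[R]_n -> R) :
  measurable_fun [set: T n * T n] (fun p => k (row_of_tuple p.1) (row_of_tuple p.2)) ->
  (forall x y, 0 <= k x y) ->
  (forall x, lbmc (k x)) -> (forall y, lbmc (k^~ y)) ->
  integ (fun x => integ (k x)) = integ (fun y => integ (k^~ y)).
Proof.
move=> mk k0 kr kl; rewrite /integ /Rintegral; congr fine.
have F1 x : (fine (\int[mu n]_t (k x (row_of_tuple t))%:E))%:E = (\int[mu n]_t (k x (row_of_tuple t))%:E)%E.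
  by rewrite fineK//; apply: integrable_fin_num => //; exact: (integrable_lbmc (kr x)).
have F2 y : (fine (\int[mu n]_t (k (row_of_tuple t) y)%:E))%:E = (\int[mu n]_t (k (row_of_tuple t) y)%:E)%E.
  by rewrite fineK//; apply: integrable_fin_num => //; exact: (integrable_lbmc (kl y)).
under eq_integral do rewrite F1.
under [RHS]eq_integral do rewrite F2.
apply: (@fubini_tonelli _ _ _ _ R (mu n) (mu n) (fun p => (k (row_of_tuple p.1) (row_of_tuple p.2))%:E)).
- by apply/measurable_EFinP; exact: mk.
- by move=> p; rewrite lee_fin.
Qed.

Lemma contD (V : topologicalType) (f g : V -> R) :
  continuous f -> continuous g -> continuous (fun x => f x + g x).
Proof. by move=> cf cg x; apply: cvgD; [exact: cf|exact: cg]. Qed.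

Lemma contM (V : topologicalType) (f g : V -> R) :
  continuous f -> continuous g -> continuous (fun x => f x * g x).
Proof. by move=> cf cg x; apply: cvgM; [exact: cf|exact: cg]. Qed.

Lemma contN (V : topologicalType) (f : V -> R) :
  continuous f -> continuous (fun x => - f x).
Proof. by move=> cf x; apply: cvgN; exact: cf. Qed.

Lemma contB (V : topologicalType) (f g : V -> R) :
  continuous f -> continuous g -> continuous (fun x => f x - g x).
Proof. by move=> cf cg; apply: contD => //; exact: contN. Qed.

Lemma contX (V : topologicalType) k (f : V -> R) :
  continuous f -> continuous (fun x => f x ^+ k).
Proof.
move=> cf; elim: k => [|k IH]; first exact: cst_continuous.
by under eq_fun do rewrite exprS; exact: contM.
Qed.

Lemma cont_comp (V : topologicalType) (h : R -> R) (f : V -> R) :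
  continuous h -> continuous f -> continuous (fun x => h (f x)).
Proof. by move=> ch cf x; apply: continuous_comp; [exact: cf|exact: ch]. Qed.

(** Carrying the partial derivatives along as data lets the closure lemmas below
    compute them. *)
Definition C1d n (g : 'rV[R]_n -> R) (dg : 'I_n -> 'rV[R]_n -> R) :=
  [/\ forall x, differentiable g x, forall i x, partial i g x = dg i x
    & forall i, continuous (dg i)].

Lemma C1d_cont n (g : 'rV[R]_n -> R) dg : C1d g dg -> continuous g.
Proof. by move=> [d _ _] x; exact: differentiable_continuous. Qed.

Lemma C1d_contd n (g : 'rV[R]_n -> R) dg i : C1d g dg -> continuous (dg i).
Proof. by case. Qed.

Lemma C1d_is_derive n (g : 'rV[R]_n -> R) dg i x : C1d g dg ->
  is_derive x (delta_mx 0 i) g (dg i x).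
Proof.
by move=> [d p _]; rewrite -p; apply: DeriveDef => //; exact: diff_derivable.
Qed.

Lemma C1d_intro n (g : 'rV[R]_n -> R) dg : (forall x, differentiable g x) ->
  (forall i x, is_derive x (delta_mx 0 i) g (dg i x)) -> (forall i, continuous (dg i)) ->
  C1d g dg.
Proof. by move=> d p c; split=> // i x; rewrite /partial derive_val. Qed.

Lemma C1d_ext n (g h : 'rV[R]_n -> R) dg dh : C1d g dg -> g =1 h ->
  (forall i, dg i =1 dh i) -> C1d h dh.
Proof.
move=> + /funext <- e; suff -> : dg = dh by [].
by apply/funext => i; apply/funext => x; exact: e.
Qed.

Lemma class_C1d n (g : 'rV[R]_n -> R) : class_C 1 setT g -> C1d g (fun i => partial i g).
Proof. by move=> [d c]; split=> // [x|i x]; [exact: d|exact: c]. Qed.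

Lemma C1d_class n (g : 'rV[R]_n -> R) dg : C1d g dg -> class_C 1 setT g.
Proof.
move=> [d p c]; split=> // i x _; have -> : partial i g = dg i by apply/funext => y.
exact: c.
Qed.

Lemma C1d_cst n (c : R) : C1d (fun _ : 'rV[R]_n => c) (fun _ _ => 0).
Proof.
by apply: C1d_intro => [x|i]; [exact: differentiable_cst|exact: cst_continuous].
Qed.

Lemma C1dD n (f g : 'rV[R]_n -> R) df dg : C1d f df -> C1d g dg ->
  C1d (fun x => f x + g x) (fun i x => df i x + dg i x).
Proof.
move=> hf hg; apply: C1d_intro => [x|i x|i].
- by apply: differentiableD; [case: hf|case: hg].
- have := C1d_is_derive i x hf; have := C1d_is_derive i x hg => ? ?.
  exact: is_deriveD.
- by apply: contD; [exact: (C1d_contd hf)|exact: (C1d_contd hg)].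
Qed.

Lemma C1dM n (f g : 'rV[R]_n -> R) df dg : C1d f df -> C1d g dg ->
  C1d (fun x => f x * g x) (fun i x => f x * dg i x + df i x * g x).
Proof.
move=> hf hg; apply: C1d_intro => [x|i x|i].
- by apply: differentiableM; [case: hf|case: hg].
- have := C1d_is_derive i x hf; have := C1d_is_derive i x hg => ? ?.
  by apply: is_derive_eq; rewrite mulrC [g x *: _]mulrC [X in X + _]mulrC.
- apply: contD; apply: contM; [exact: (C1d_cont hf)|exact: (C1d_contd hg)|exact: (C1d_contd hf)|exact: (C1d_cont hg)].
Qed.

Lemma C1dZ n c (f : 'rV[R]_n -> R) df : C1d f df ->
  C1d (fun x => c * f x) (fun i x => c * df i x).
Proof.
move=> hf; apply: (C1d_ext (C1dM (@C1d_cst n c) hf)) => // i x.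
by rewrite mul0r addr0.
Qed.

Lemma C1dN n (f : 'rV[R]_n -> R) df : C1d f df -> C1d (fun x => - f x) (fun i x => - df i x).
Proof. by move=> hf; apply: (C1d_ext (C1dZ (-1) hf)) => [x|i x]; rewrite mulN1r. Qed.

Lemma C1dB n (f g : 'rV[R]_n -> R) df dg : C1d f df -> C1d g dg ->
  C1d (fun x => f x - g x) (fun i x => df i x - dg i x).
Proof. by move=> hf hg; apply: C1dD => //; exact: C1dN. Qed.

Lemma C1d_sum n (I : Type) (s : seq I) (f : I -> 'rV[R]_n -> R) df :
  (forall j, C1d (f j) (df j)) ->
  C1d (fun x => \sum_(j <- s) f j x) (fun i x => \sum_(j <- s) df j i x).
Proof.
move=> hf; elim: s => [|j s IH].
  by apply: (C1d_ext (@C1d_cst n 0)) => [x|i x]; rewrite big_nil.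
by apply: (C1d_ext (C1dD (hf j) IH)) => [x|i x]; rewrite big_cons.
Qed.

Lemma C1d_comp n (h h' : R -> R) (f : 'rV[R]_n -> R) df :
  (forall s : R, is_derive s 1 h (h' s)) -> continuous h' -> C1d f df ->
  C1d (fun x => h (f x)) (fun i x => h' (f x) * df i x).
Proof.
move=> dh ch hf.
have dfh s : differentiable h s by apply/derivable1_diffP; exact: ex_derive.
have dff x : differentiable f x by case: hf.
have E i x : 'd f x 'e_i = df i x by rewrite -deriveE//; case: hf => _ p _; exact: p.
apply: C1d_intro => [x|i x|i].
- exact: differentiable_comp.
- apply: DeriveDef; first by apply: diff_derivable; exact: differentiable_comp.
  rewrite deriveE; last exact: differentiable_comp.
  rewrite (@diff_comp _ _ _ _ f h)//= E -[in LHS](mulr1 (df i x)) -[df i x * 1]/(df i x *: (1 : R^o)).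
  by rewrite linearZ /= -deriveE// derive_val mulrC.
- apply: contM; last exact: (C1d_contd hf).
  by apply: cont_comp => //; exact: (C1d_cont hf).
Qed.

Lemma C1d_coord n (j : 'I_n) : C1d (fun x : 'rV[R]_n => x 0 j) (fun i _ => (i == j)%:R).
Proof.
apply: C1d_intro => [x|i x|i x]; [exact: differentiable_coord| |exact: cst_continuous].
have D : is_derive (0 : R) 1 (fun h : R => h * (i == j)%:R + x 0 j) (i == j)%:R.
  by apply: is_derive_eq; rewrite addr0 scaler0 add0r [_ *: _]mulr1.
apply: (is_derive_line _ D) => h.
by rewrite coordD coordZ !mxE eqxx /= addr0 [h *: 1]mulr1 eq_sym.
Qed.
End translations.

(** * Preimages of null sets under C1 functions *)

Section null_sets.
Context {R : realType}.
Notation T n := (n.-tuple (measurableTypeR R)).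
Notation mu n := (@lebesgue_tuple R n).
Notation leb := (@lebesgue_measure R).

(** Compactness gives one scale below which [f] is Lipschitz with one
    constant; longer segments are cut into pieces of that scale. *)
Lemma lipschitz_on_itv (f : R -> R) (M : R) : locally_lipschitz f ->
  exists2 L : R, 0 < L & forall s t : R, `|s| <= M -> `|t| <= M -> `|f s - f t| <= L * `|s - t|.
Proof.
move=> fl.
pose P (k : nat) (y : R) := forall s t : R, `|s - y| < k.+1%:R^-1 -> `|t - y| < k.+1%:R^-1 ->
  `|f s - f t| <= k.+1%:R * `|s - t|.
have : \forall k \near \oo, `[-M, M]%classic `<=` P k.
  have /compact_near_coveringP := @segment_compact R (-M) M; apply => x xM.
  have [A xA [K [_ HK]]] := fl x.
  have /nbhs_ballP[e /= e0 eA] := xA.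
  have e20 : 0 < e / 2 by rewrite divr_gt0.
  exists (ball x (e / 2), [set k : nat | K < k.+1%:R /\ k.+1%:R^-1 < e / 2]) => /=.
    split; first exact: nbhsx_ballx.
    near=> k; split; last by near: k; exact: (near_infty_natSinv_lt (PosNum e20)).
    by rewrite (@lt_le_trans _ _ k%:R) ?ler_nat//; near: k; exact: nbhs_infty_gtr.
  move=> [y k] /= [yx [kK ke]] s t sy ty.
  have close z : `|z - y| < k.+1%:R^-1 -> A z.
    move=> zy; apply: eA; rewrite /ball /= (le_lt_trans (ler_distD y _ _))// (splitr e) ltrD//.
    by rewrite distrC (lt_trans zy).
  by have := HK _ kK (s, t) => /=; apply; split; exact: close.
move=> [k _ /(_ k (leqnn k)) HP]; exists k.+1%:R => // s t sM tM.
have [N Npos hN] : exists2 N : nat, (0 < N)%N & `|s - t| / N%:R < k.+1%:R^-1.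
  exists (truncn (`|s - t| * k.+1%:R)).+1 => //.
  by rewrite ltr_pdivrMr// mulrC ltr_pdivlMr//; exact: truncnS_gt.
(* the division points of the segment from [s] to [t] *)
pose p i := s + i%:R / N%:R * (t - s).
have N0 : (0 : R) < N%:R by rewrite ltr0n.
have pM i : (i <= N)%N -> P k (p i).
  move=> iN; apply: HP; rewrite /= in_itv/= -ler_norml.
  have c0 : 0 <= i%:R / N%:R :> R by rewrite divr_ge0.
  have c1 : 0 <= 1 - i%:R / N%:R :> R by rewrite subr_ge0 ler_pdivrMr// mul1r ler_nat.
  rewrite (_ : p i = (1 - i%:R / N%:R) * s + i%:R / N%:R * t); last by rewrite /p; ring.
  rewrite (le_trans (ler_normD _ _))// [X in X + _]normrM [X in _ + X]normrM (ger0_norm c0) (ger0_norm c1).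
  rewrite (_ : M = (1 - i%:R / N%:R) * M + i%:R / N%:R * M); last by ring.
  by apply: lerD; apply: ler_wpM2l.
have step i : p i.+1 - p i = (t - s) / N%:R.
  by rewrite /p -natr1; field; rewrite lt0r_neq0.
have -> : f s - f t = - \sum_(0 <= i < N) (f (p i.+1) - f (p i)).
  rewrite telescope_sumr// opprB; congr (_ - f _); rewrite /p ?mul0r ?addr0 ?divff ?lt0r_neq0//.
  by rewrite mul1r addrC subrK.
rewrite normrN (le_trans (ler_norm_sum _ _ _))//.
apply: (@le_trans _ _ (\sum_(0 <= i < N) k.+1%:R * (`|s - t| / N%:R))).
  rewrite big_nat [leRHS]big_nat; apply: ler_sum => i /andP[_ iN].
  rewrite (_ : `|s - t| / N%:R = `|p i.+1 - p i|); last first.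
    by rewrite step normrM normfV (gtr0_norm N0) distrC.
  apply: (pM i (ltnW iN)); last by rewrite subrr normr0 invr_gt0.
  by rewrite step normrM normfV (gtr0_norm N0) distrC.
rewrite sumr_const_nat subn0 -[_ *+ N]mulr_natr -mulrA divfK ?lt0r_neq0//.
Unshelve. all: by end_near. Qed.

(** Cover a null set by intervals of small total length. *)
Lemma null_of_length (nu : {measure set (measurableTypeR R) -> \bar R}) (K : R) :
  0 <= K ->
  (forall a b : R, (a <= b)%R -> (nu `]a, b]%classic <= (K * (b - a))%:E)%E) ->
  forall A, measurable A -> leb A = 0%E -> nu A = 0%E.
Proof.
move=> K0 nuK A mA A0; apply/eqP; rewrite eq_le measure_ge0 andbT.
apply/lee_addgt0Pr => e e0; rewrite add0e.
pose d := e / (K + 1).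
have d0 : 0 < d by rewrite divr_gt0// ltr_wpDl.
have : (leb A < d%:E)%E by rewrite A0 lte_fin.
rewrite /lebesgue_measure /lebesgue_stieltjes_measure /measure_extension /mu_ext => /ereal_inf_lt[_ [F [mF AF] <-]] Fd.
have mF' i : measurable (F i : set (measurableTypeR R)) by apply: sub_sigma_algebra; exact: mF.
apply: (@le_trans _ _ (\sum_(0 <= i <oo) nu (F i))%E).
  apply: (@le_trans _ _ (nu (\bigcup_i F i))).
    by apply: le_measure; rewrite ?inE//; exact: bigcupT_measurable.
  by apply: generalized_Boole_inequality => //; exact: bigcupT_measurable.
apply: (@le_trans _ _ (\sum_(0 <= i <oo) (K%:E * wlength idfun (F i)))%E).
  apply: lee_nneseries; [by move=> *; exact: measure_ge0|move=> i *].
  have [[a b] _ <-] := mF i.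
  have [ab|ba] := leP a b.
    by rewrite wlength_itv_bnd// -EFinM; exact: nuK.
  rewrite (_ : `]a, b]%classic = set0) ?measure0 ?wlength0 ?mule0//.
  by rewrite -subset0 => s /=; rewrite in_itv/= => /andP[h1 h2]; have := lt_le_trans h1 h2; rewrite ltNge (ltW ba).
rewrite nneseriesZl//.
apply: (@le_trans _ _ (K%:E * d%:E)%E); first by apply: lee_wpmul2l => //; exact: ltW.
rewrite -EFinM lee_fin /d mulrA ler_pdivrMr ?ltr_wpDl// mulrC ler_pM2l//; lra.
Qed.

(** On a short interval where [w'] is bounded away from 0, the image under [w]
    of Lebesgue measure is controlled by length, to which [null_of_length]
    applies; countably many such intervals cover the points where [w' != 0]. *)
Lemma null_preimage1 (w w' : R -> R) (Z : set (measurableTypeR R)) :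
  (forall s : R, is_derive s 1 w (w' s)) -> continuous w' -> measurable Z -> leb Z = 0%E ->
  leb [set s | w' s != 0 /\ Z (w s)] = 0%E.
Proof.
move=> dw cw' mZ Z0.
have cw : continuous w by move=> s; apply/differentiable_continuous/derivable1_diffP; exact: ex_derive.
have mw : measurable_fun [set: measurableTypeR R] (w : measurableTypeR R -> measurableTypeR R).
  exact: continuous_measurable_fun.
have mWZ : measurable (w @^-1` Z) by rewrite -[X in measurable X]setTI; exact: mw.
pose I (p : rat * nat) : set R := ball (ratr p.1 : R) p.2.+1%:R^-1.
have mI p : measurable (I p : set (measurableTypeR R)) by apply: open_measurable; exact: ball_open.
(* the intervals on which [w'] stays away from 0, in countable number *)
pose good (p : rat * nat) (m : nat) := forall s : R, I p s -> m.+1%:R^-1 <= `|w' s|.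
have key p m : good p m -> leb (I p `&` w @^-1` Z) = 0%E.
  move=> pm.
  have H s t : I p s -> I p t -> `|s - t| <= m.+1%:R * `|w s - w t|.
    wlog st : s t / s < t => [W Is It|Is It].
      have [st|ts|->] := ltgtP s t; [exact: W| |by rewrite !subrr normr0 mulr0].
      by rewrite distrC [X in _ * X]distrC; exact: W.
    have [c cst e] := MVT st (fun x _ => dw x) (continuous_subspaceT cw).
    rewrite distrC [X in _ * X]distrC e normrM mulrA ler_peMl//.
    rewrite -ler_pdivrMl// mulr1; apply: pm.
    move: cst Is It; rewrite in_itv/= /I /ball /= !ltr_distlC => /andP[h1 h2] /andP[h3 h4] /andP[h5 h6].
    by rewrite (lt_trans h3)//= (lt_trans h2).
  pose nu := pushforward (mrestr leb (mI p)) (w : measurableTypeR R -> measurableTypeR R).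
  have := @null_of_length nu (2 * m.+1%:R) _ _ Z mZ Z0.
  rewrite /nu /pushforward /mrestr /= setIC; apply => //.
  move=> a b ab; rewrite /pushforward /mrestr /=.
  have [|/set0P[s0 [/= s0ab s0I]]] := eqVneq (w @^-1` `]a, b]%classic `&` I p) set0.
    by move=> ->; rewrite measure0 lee_fin mulr_ge0// subr_ge0.
  pose D := m.+1%:R * (b - a).
  have D0 : 0 <= D by rewrite mulr_ge0// subr_ge0.
  apply: (@le_trans _ _ (leb `[s0 - D, s0 + D]%classic)).
    apply: le_measure; rewrite ?inE.
    - apply: measurableI; last exact: mI.
      by rewrite -[X in measurable X]setTI; apply: mw => //; exact: measurable_itv.
    - exact: measurable_itv.
    - move=> s [/= sab sI]; rewrite in_itv/= -ler_distlC.
      apply: le_trans (H _ _ s0I sI) _; rewrite ler_wpM2l// ler_norml.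
      by move: sab s0ab; rewrite !in_itv/= => /andP[? ?] /andP[? ?]; apply/andP; split; lra.
  rewrite lebesgue_measure_itv /= lte_fin; case: ifP => _; last by rewrite lee_fin !mulr_ge0// subr_ge0.
  by rewrite -EFinD lee_fin /D; lra.
pose F j : set (measurableTypeR R) := if @unpickle (rat * nat * nat)%type j is Some pm then
  (if `[< good pm.1 pm.2 >] then I pm.1 `&` w @^-1` Z else set0) else set0.
have F0 j : leb.-negligible (F j).
  rewrite /F; case: (unpickle j) => [[p m]|]; last exact: negligible_set0.
  case: asboolP => [g|_]; last exact: negligible_set0.
  by exists (I p `&` w @^-1` Z); split => //; [exact: measurableI|exact: (key p m)].
have mS : measurable ([set s | w' s != 0 /\ Z (w s)] : set (measurableTypeR R)).
  rewrite (_ : [set s | _] = w' @^-1` (~` [set 0]) `&` w @^-1` Z).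
    apply: measurableI => //; rewrite -[X in measurable X]setTI.
    have := continuous_measurable_fun cw'; apply => //.
    by apply: measurableC; exact: measurable_set1.
  by apply/seteqP; split => t /= [h1 h2]; split => //; apply/eqP.
apply/negligibleP => //.
apply: (negligibleS _ (negligible_bigcup F0)) => s [/= ws0 Zs].
have ws : 0 < `|w' s| by rewrite normr_gt0.
have [m] : exists m : nat, 0 + m.+1%:R^-1 < `|w' s| / 2 by apply: ltr_add_invr; rewrite divr_gt0.
rewrite add0r => hm.
have /cvgrPdist_lt/(_ (`|w' s| / 2)) := cw' s.
rewrite divr_gt0// => /(_ isT)/nbhs_ballP[e /= e0 He].
have [k] : exists k : nat, 0 + k.+1%:R^-1 < e / 2 by apply: ltr_add_invr; rewrite divr_gt0.
rewrite add0r => hk.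
have [|q] := @rat_in_itvoo R (s - k.+1%:R^-1) (s + k.+1%:R^-1).
  by rewrite ltrBlDr -addrA ltrDl addr_gt0.
rewrite in_itv/= -ltr_distlC => qs.
have [j hj] : exists j, unpickle j = Some (q, k, m).
  by exists (pickle (q, k, m)); rewrite pickleK.
exists j; first by []; rewrite /F hj /=.
have gd : good (q, k) m.
  move=> t; rewrite /I /ball /= => tq.
  have /He : ball s e t.
    rewrite /ball /= (le_lt_trans (ler_distD (ratr q) _ _))// (splitr e) ltrD//.
      exact: lt_trans hk.
    exact: lt_trans hk.
  move=> h; rewrite ltW// (lt_trans hm)//.
  have := ler_distD (w' t) (w' s) 0; rewrite !subr0 => h2.
  move: h h2; move: (`|w' s - w' t|) (`|w' s|) (`|w' t|) => x y z; lra.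
rewrite asboolT//; split => //=.
by rewrite /I /ball /= distrC.
Qed.

(** Tonelli's theorem reduces to lines parallel to the [i]-th axis. *)
Lemma null_preimage n (i : 'I_n) (w w' : 'rV[R]_n -> R) (Z : set (measurableTypeR R)) :
  (forall x, is_derive x (delta_mx 0 i) w (w' x)) -> continuous w -> continuous w' ->
  measurable Z -> leb Z = 0%E ->
  measurable [set t : T n | w' (row_of_tuple t) != 0 /\ Z (w (row_of_tuple t))] /\
  mu n [set t : T n | w' (row_of_tuple t) != 0 /\ Z (w (row_of_tuple t))] = 0%E.
Proof.
move=> dw cw cw' mZ Z0.
have ms m (u u' : 'rV[R]_m -> R) : continuous u -> continuous u' ->
    measurable [set t : T m | u' (row_of_tuple t) != 0 /\ Z (u (row_of_tuple t))].
  move=> cu cu'; have mu' := measurable_cont cu'; have mu := measurable_cont cu.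
  rewrite (_ : [set t | _] = (u' \o row_of_tuple) @^-1` (~` [set 0]) `&` (u \o row_of_tuple) @^-1` Z).
    apply: measurableI; rewrite -[X in measurable X]setTI; [apply: mu' => //|exact: mu].
    by apply: measurableC; exact: measurable_set1.
  by apply/seteqP; split => t /= [h1 h2]; split => //; apply/eqP.
split; first exact: ms.
elim: n i w w' dw cw cw' => [[]//|n IH] i w w' dw cw cw'.
case: (unliftP ord0 i) dw => [j ->|->] dw.
  apply: null_cons1 => [|s]; first exact: ms.
  rewrite (_ : [set t | _] = [set t : T n | w' (row_cons s (row_of_tuple t)) != 0 /\ Z (w (row_cons s (row_of_tuple t)))]); last first.
    by apply/seteqP; split => t /=; rewrite row_tcons.
  apply: (IH j (fun y => w (row_cons s y)) (fun y => w' (row_cons s y))).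
  - move=> y; apply: (is_derive_line _ (dw (row_cons s y))) => h.
    by rewrite row_cons_deltaS row_consD add0r.
  - by move=> y; apply: continuous_comp; [exact: row_cons_continuousr|exact: cw].
  - by move=> y; apply: continuous_comp; [exact: row_cons_continuousr|exact: cw'].
apply: null_cons2 => [|t]; first exact: ms.
rewrite (_ : [set s | _] = [set s : measurableTypeR R | w' (row_cons s (row_of_tuple t)) != 0 /\ Z (w (row_cons s (row_of_tuple t)))]); last first.
  by apply/seteqP; split => s /=; rewrite row_tcons.
apply: (@null_preimage1 (fun s => w (row_cons s (row_of_tuple t))) (fun s => w' (row_cons s (row_of_tuple t)))) => //.
- move=> s; apply: (is_derive_line _ (dw (row_cons s _))) => h.
  by rewrite row_cons_delta0 row_consD add0r [h *: 1]mulr1.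
- by move=> s; apply: continuous_comp; [exact: row_cons_continuousl|exact: cw'].
Qed.

Lemma lime_inf_ge (q : R -> \bar R) (c e : R) : 0 < e ->
  (forall h, h != 0 -> `|h| < e -> (c%:E <= q h)%E) -> (c%:E <= lime_inf q 0)%E.
Proof.
move=> e0 H; rewrite lime_infE; apply: ereal_sup_ge.
eexists; first by exists e => //=; rewrite in_itv/= e0.
rewrite leeNr; apply: ge_ereal_sup => _ [h [he /= h0] <-].
rewrite EFinN leeN2; apply: H; first exact/eqP.
by move: he; rewrite /ball /= sub0r normrN.
Qed.
End null_sets.

(** * Almost everywhere differentiability of Lipschitz functions *)

Section lipschitz.
Context {R : realType}.
Notation leb := (@lebesgue_measure R).

Lemma stieltjes_itv (F : cumulative R R) (a b : R) : (a <= b)%R ->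
  lebesgue_stieltjes_measure F `]a, b]%classic = (F b - F a)%:E.
Proof.
move=> ab; rewrite /lebesgue_stieltjes_measure /= /measure_extension measurable_mu_extE/=; last exact: is_ocitv.
by rewrite wlength_itv_bnd.
Qed.

Lemma derive_quot (f : R -> R) (t d e : R) : is_derive t 1 f d -> 0 < e ->
  exists2 r : R, 0 < r & forall h, h != 0 -> `|h| < r -> `|(f (t + h) - f t) / h - d| < e.
Proof.
move=> [df Df] e0; have := df; rewrite /derivable => /cvg_ex[l hl].
have dl : d = l by rewrite -Df /derive; exact/cvg_lim.
move: hl => /cvgrPdist_lt/(_ e e0)/=; rewrite /dnbhs /= /within => /nbhs_ballP[r /= r0 H].
exists r => // h h0 hr; have := H h; rewrite /ball /= sub0r normrN => /(_ hr h0).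
rewrite distrC dl; congr (`|_ - _| < _).
by rewrite [h *: 1]mulr1 [h + t]addrC [LHS]mulrC.
Qed.

Lemma is_derive_bound (f : R -> R) (t d L e : R) : is_derive t 1 f d -> 0 < e ->
  (forall s, `|s - t| < e -> `|f s - f t| <= L * `|s - t|) -> `|d| <= L.
Proof.
move=> df e0 H; apply/ler_addgt0Pr => eps eps0.
have [r r0 Hr] := derive_quot df eps0.
pose h := minr r e / 2.
have h0 : 0 < h by rewrite divr_gt0// lt_min r0.
have hm : h < minr r e by rewrite /h ltr_pdivrMr// ltr_pMr ?ltr1n// lt_min r0.
move: hm; rewrite lt_min => /andP[hr he].
have := Hr h; rewrite (gtr0_norm h0) lt0r_neq0// => /(_ isT hr) h1.
have := H (t + h); rewrite addrAC subrr add0r (gtr0_norm h0) => /(_ he) h2.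
have h3 : `|(f (t + h) - f t) / h| <= L by rewrite normrM normfV (gtr0_norm h0) ler_pdivrMr.
have := ler_distD ((f (t + h) - f t) / h) d 0; rewrite !subr0 distrC.
by move=> /le_trans; apply; rewrite addrC lerD// ltW.
Qed.

Definition clamp (M t : R) : R := maxr (- M) (minr M t).

Lemma clamp_norm M t : 0 <= M -> `|clamp M t| <= M.
Proof.
move=> M0; rewrite ler_norml /clamp le_max lexx /= ge_max ge_min lexx /= andbT.
by rewrite (le_trans _ M0)// oppr_le0.
Qed.

Lemma clamp_id M t : `|t| <= M -> clamp M t = t.
Proof. by rewrite ler_norml => /andP[h1 h2]; rewrite /clamp min_r// max_r. Qed.

Lemma clamp_le M s t : 0 <= M -> s <= t -> 0 <= clamp M t - clamp M s <= t - s.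
Proof.
move=> M0 st; rewrite /clamp /Order.max /Order.min.
by repeat case: ifPn; rewrite -?leNgt => *; apply/andP; split; lra.
Qed.

Lemma lipschitz_continuous (f : R -> R) (K : R) : (forall s t, s <= t -> `|f t - f s| <= K * (t - s)) ->
  continuous f.
Proof.
move=> fK t; apply/cvgrPdist_lt => e e0.
have K0 : 0 <= K by have := le_trans (normr_ge0 _) (fK 0 1 ler01); rewrite subr0 mulr1.
have K1 : 0 < K + 1 by rewrite ltr_wpDl.
apply/nbhs_ballP; exists (e / (K + 1)) => /=; first by rewrite divr_gt0.
move=> s; rewrite /ball /= ltr_pdivlMr// => st.
have h : `|f t - f s| <= K * `|t - s|.
  have [ts|ts] := leP t s.
    by rewrite distrC [`|t - s|]distrC [X in _ * X]ger0_norm ?subr_ge0// fK.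
  by rewrite [X in _ * X]gtr0_norm ?subr_gt0// fK// ltW.
apply: le_lt_trans h _; apply: le_lt_trans st; rewrite mulrC ler_wpM2l//; lra.
Qed.

Lemma clamp_continuous M : 0 <= M -> continuous (clamp M).
Proof.
move=> M0; apply: (@lipschitz_continuous _ 1) => s t st; have /andP[h1 h2] := clamp_le M0 st.
by rewrite mul1r ger0_norm.
Qed.

(** The function [f t + L t], frozen outside [[-M, M]], is nondecreasing and
    Lipschitz, so that its Stieltjes measure is absolutely continuous. By
    Radon-Nikodym it is the integral of a density, which is its derivative off a
    null set [Z] by Lebesgue's theorem. The value [- L] on [Z] is a lower bound
    for all difference quotients: in this way [g] never exceeds the lower
    derivative of [f] inside [[-M, M]]. *)
Lemma lipschitz_ae_derivable (f : R -> R) (M L : R) : 0 < M -> 0 <= L ->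
  (forall s t : R, `|s| <= M -> `|t| <= M -> `|f s - f t| <= L * `|s - t|) ->
  exists (Z : set (measurableTypeR R)) (g : measurableTypeR R -> R),
  [/\ measurable Z, leb Z = 0%E, measurable_fun setT g,
      forall t, `|g t| <= L &
      (forall t : R, Z t -> g t = - L) /\
      (forall t : R, `|t| < M -> ~ Z t -> is_derive t 1 f (g t))].
Proof.
move=> M0 L0 fL.
have M0' := ltW M0.
pose cl := clamp M.
have clM t : `|cl t| <= M by exact: clamp_norm.
have cl_id t : `|t| <= M -> cl t = t by exact: clamp_id.
have cl_nd s t : s <= t -> cl s <= cl t.
  by move=> st; have /andP[] := clamp_le M0' st; rewrite subr_ge0.
have cl_1 s t : s <= t -> cl t - cl s <= t - s.
  by move=> st; have /andP[] := clamp_le M0' st.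
(* [cl] freezes the argument outside [[-M, M]]; adding [L t] makes [F] nondecreasing *)
pose F t := f (cl t) + L * cl t.
have Fnd : {homo F : s t / s <= t}.
  move=> s t st; have := fL (cl s) (cl t) (clM s) (clM t).
  rewrite distrC [`|cl s - _|]distrC [`|cl t - _|]ger0_norm ?subr_ge0 ?cl_nd// ler_norml => /andP[h _].
  by rewrite /F; move: h; rewrite mulrBr; lra.
have FL s t : s <= t -> F t - F s <= (2 * L) * (t - s).
  move=> st; have := fL (cl s) (cl t) (clM s) (clM t).
  rewrite distrC [`|cl s - _|]distrC [`|cl t - _|]ger0_norm ?subr_ge0 ?cl_nd// ler_norml => /andP[_ h].
  have := ler_wpM2l L0 (cl_1 s t st); rewrite /F; move: h; rewrite !mulrBr; lra.
have Fc : continuous F.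
  apply: (@lipschitz_continuous _ (2 * L)) => s t st.
  by rewrite ger0_norm ?subr_ge0 ?Fnd// FL.
have Frc : right_continuous F by move=> t; apply: cvg_at_right_filter; exact: Fc.
pose FF := HB.pack_for (cumulative R R) F (isCumulative.Build R _ R F Fnd Frc).
pose D : set (measurableTypeR R) := `](- M - 1)%R, (M + 1)%R]%classic.
have mD : measurable D by exact: measurable_itv.
have LSD : (lebesgue_stieltjes_measure FF D < +oo)%E.
  by rewrite stieltjes_itv ?ltry//; lra.
pose nu : {finite_measure set (measurableTypeR R) -> \bar R} := mfrestr mD LSD.
have nuleb : nu `<< leb.
  apply/null_content_dominatesP => A mA A0.
  apply: (@null_of_length R nu (2 * L)) => //; first by rewrite mulr_ge0.
  move=> a b ab; apply: (@le_trans _ _ (lebesgue_stieltjes_measure FF `]a, b]%classic)).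
    by apply: le_measure; rewrite ?inE//; apply: measurableI => //; exact: measurable_itv.
  by rewrite stieltjes_itv// lee_fin FL.
have [phi [phi0 phif phii phiE]] := radon_nikodym_sigma_finite nuleb.
pose g0 (t : measurableTypeR R) : R := fine (phi t).
have g0E : EFin \o g0 = phi by apply/funext => t; rewrite /g0 /= fineK.
have mg0 : measurable_fun setT g0.
  by apply/measurable_EFinP; rewrite g0E; case/integrableP: phii.
pose G (y : R) := (\int[leb]_(t in [set` Interval (BRight (- M - 1)) (BRight y)]) (g0 t))%R.
have FG (y : R) : - M - 1 <= y -> y <= M + 1 -> F y = F (- M - 1) + G y.
  move=> y1 y2.
  have : nu `](- M - 1), y]%classic = (F y - F (- M - 1))%:E.
    rewrite -(@stieltjes_itv FF)//= /mfrestr /mrestr /=; congr (lebesgue_stieltjes_measure _ _).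
    by apply/setIidl => s; rewrite /D /= !in_itv/= => /andP[h1 h]; rewrite h1 (le_trans h).
  rewrite phiE; last exact: measurable_itv.
  rewrite /G /Rintegral => h.
  suff -> : fine (\int[leb]_(t in `](- M - 1), y]) (g0 t)%:E) = F y - F (- M - 1) by rewrite addrC subrK.
  rewrite -[RHS]/(fine (F y - F (- M - 1))%:E) -h; congr fine; apply: eq_integral => t _.
  by rewrite -g0E.
have lg0 : locally_integrable setT g0.
  apply: open_integrable_locally; first exact: openT.
  by rewrite g0E.
have [Z [mZ Z0 ZP]] := lebesgue_differentiation lg0.
pose g (t : measurableTypeR R) : R := if t \in Z then - L else clamp L (g0 t - L).
exists Z, g; split => //.
- have -> : g = (fun t => - L * \1_Z t + (1 - \1_Z t) * clamp L (g0 t - L)).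
    apply/funext => t; rewrite /g indicE; case: (t \in Z) => /=.
      by rewrite mulr1 subrr mul0r addr0.
    by rewrite mulr0 subr0 mul1r add0r.
  apply: measurable_funD; apply: measurable_funM.
  + exact: measurable_cst.
  + exact: measurable_indic.
  + by apply: measurable_funB; [exact: measurable_cst|exact: measurable_indic].
  + apply: (measurableT_comp (continuous_measurable_fun (clamp_continuous L0))).
    by apply: measurable_funB => //; exact: measurable_cst.
- by move=> t; rewrite /g; case: ifP => _; [rewrite normrN ger0_norm|exact: clamp_norm].
- split=> [t Zt|t tM nZt]; first by rewrite /g mem_set.
  have lp : lebesgue_pt g0 t by apply: contrapT => h; exact/nZt/ZP.
  move: (tM); rewrite ltr_norml => /andP[t1 t2].
  have [|||dG G'] := @FTC1_lebesgue_pt R g0 (BRight (- M - 1)) t (t + 1) _ _ _ lp.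
  + by rewrite ltrDl.
  + by rewrite g0E; exact: integrableS phii.
  + by rewrite (@lte_fin R); lra.
  have D0 : is_derive t 1 f (g0 t - L).
    have D1 : is_derive t 1 (fun s => F (- M - 1) + G s - L * s) (g0 t - L).
      have ? : is_derive t 1 G (g0 t) by apply: (DeriveDef dG); rewrite -derive1E G'.
      by apply: is_derive_eq; rewrite add0r mul1r [L%:A]mulr1.
    apply: (near_eq_is_derive _ D1).
    apply/nbhs_ballP; exists (M - `|t|) => /=; first by rewrite subr_gt0.
    move=> s; rewrite /ball /= distrC => st.
    have sM : `|s| < M by have := ler_distD t s 0; rewrite !subr0 => h; lra.
    move: (sM); rewrite ltr_norml => /andP[s1 s2].
    by rewrite -FG; [rewrite /F cl_id ?addrK// ltW|lra|lra].
  suff -> : g t = g0 t - L by [].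
  have : `|g0 t - L| <= L.
    have e0 : 0 < M - `|t| by rewrite subr_gt0.
    apply: (is_derive_bound D0 e0) => s st; apply: fL; last exact: ltW.
    have := ler_distD t s 0; rewrite !subr0 => h; lra.
  by move=> h; rewrite /g memNset// clamp_id.
Qed.
End lipschitz.

(** * Mean values, symmetry of second derivatives, integration by parts *)

Section gradients.
Context {R : realType}.
Notation T n := (n.-tuple (measurableTypeR R)).
Notation mu n := (@lebesgue_tuple R n).

Lemma C1d_line n (g : 'rV[R]_n -> R) dg x i s : C1d g dg ->
  is_derive (s : R) 1 (fun s : R => g (x + s *: delta_mx 0 i)) (dg i (x + s *: delta_mx 0 i)).
Proof.
move=> hg; apply: (is_derive_line _ (C1d_is_derive i _ hg)) => h.
by rewrite [h *: 1]mulr1 scalerDl addrCA.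
Qed.

Lemma C1d_mvt n (g : 'rV[R]_n -> R) dg x i h : C1d g dg -> 0 < h ->
  exists2 c, 0 < c < h & g (x + h *: delta_mx 0 i) - g x = h * dg i (x + c *: delta_mx 0 i).
Proof.
move=> hg h0.
have D s := C1d_line x i s hg.
have C : continuous (fun s : R => g (x + s *: delta_mx 0 i)).
  by move=> s; apply/differentiable_continuous/derivable1_diffP; have [] := D s.
have [c ch] := MVT h0 (fun s _ => D s) (continuous_subspaceT C).
by rewrite scale0r addr0 subr0 mulrC => e; exists c.
Qed.

Lemma norm_delta_le n (s : R) (i : 'I_n) : `|s *: delta_mx 0 i : 'rV[R]_n| <= `|s|.
Proof.
apply: norm_le_coord => // j; rewrite coordZ mxE eqxx /= normrM.
by case: (_ == _); rewrite ?normr1 ?normr0 ?mulr1 ?mulr0.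
Qed.

Lemma C1d_incr n (g : 'rV[R]_n -> R) dg i (r : R) : C1d g dg ->
  exists2 M, 0 <= M & forall x h, `|x| <= r -> 0 < h <= 1 -> `|g (x + h *: delta_mx 0 i) - g x| <= M * h.
Proof.
move=> hg; have [M HM] := locally_bounded_cont (C1d_contd (i := i) hg) (r + 1).
exists `|M| => // x h xr /andP[h0 h1].
have [c /andP[c0 ch] ->] := C1d_mvt x i hg h0.
rewrite normrM (gtr0_norm h0) mulrC ler_pM2r//; apply: le_trans (ler_norm M).
apply: HM; rewrite (le_trans (ler_normD _ _))// lerD//.
by rewrite (le_trans (norm_delta_le _ _))// gtr0_norm// (le_trans (ltW ch)).
Qed.

Lemma C1d_shift n (g : 'rV[R]_n -> R) dg z : C1d g dg ->
  C1d (fun x => g (x + z)) (fun i x => dg i (x + z)).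
Proof.
move=> hg.
have cz : continuous (fun x : 'rV[R]_n => x + z).
  move=> x U /nbhs_ballP[e e0 eU]; apply/nbhs_ballP; exists e => // y [_ xy]; apply: eU.
  split => // k j; rewrite ord1 !coordD /ball /= opprD addrACA subrr addr0; exact: xy.
apply: C1d_intro => [x|i x|i].
- have d : differentiable (fun x : 'rV[R]_n => x + z) x.
    by apply: differentiableD.
  by apply: (differentiable_comp d); case: hg.
- by apply: (is_derive_line _ (C1d_is_derive i (x + z) hg)) => h; rewrite addrA.
- by move=> x; apply: continuous_comp; [exact: cz|exact: (C1d_contd hg)].
Qed.

Lemma C1d_quot_step n (g : 'rV[R]_n -> R) dg x i (h : R) : C1d g dg -> h != 0 ->
  (fun k : nat => (g (x + (h / k.+1%:R) *: delta_mx 0 i) - g x) / (h / k.+1%:R)) @ \oo --> dg i x.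
Proof.
move=> hg h0; apply/cvgrPdist_lt => e e0.
have D := C1d_line x i 0 hg; rewrite scale0r addr0 in D.
have [r r0 Hr] := derive_quot D e0.
have rh : 0 < r / `|h| by rewrite divr_gt0// normr_gt0.
near=> k.
have k0 : (0 : R) < k.+1%:R^-1 by rewrite invr_gt0.
have := Hr (h / k.+1%:R); rewrite add0r scale0r addr0 distrC; apply; first by rewrite mulf_neq0// lt0r_neq0.
rewrite normrM mulrC -ltr_pdivlMr ?normr_gt0// gtr0_norm//; near: k; exact: (near_infty_natSinv_lt (PosNum rh)).
Unshelve. all: by end_near. Qed.

Lemma C1d_quot n (g : 'rV[R]_n -> R) dg x i : C1d g dg ->
  (fun k : nat => (g (x + k.+1%:R^-1 *: delta_mx 0 i) - g x) / k.+1%:R^-1) @ \oo --> dg i x.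
Proof.
move=> hg; have := C1d_quot_step (x := x) (i := i) hg (oner_neq0 R).
by under eq_fun do rewrite div1r.
Qed.

(** Both derivatives are limits of the same second difference, to which the
    mean value theorem is applied in either order. *)
Lemma C1d_sym n (u : 'rV[R]_n -> R) du H : C1d u du -> (forall i, C1d (du i) (H i)) ->
  forall i j x, H i j x = H j i x.
Proof.
move=> hu hdu.
have key i j x h : 0 < h -> exists2 p, `|p - x| <= 2 * h &
    u (x + h *: delta_mx 0 i + h *: delta_mx 0 j) - u (x + h *: delta_mx 0 i)
    - (u (x + h *: delta_mx 0 j) - u x) = h * (h * H i j p).
  move=> h0.
  have hw := C1dB (C1d_shift (h *: delta_mx 0 j) hu) hu.
  have [c /andP[c0 ch] e] := C1d_mvt x i hw h0.
  have [c' /andP[c'0 c'h] e'] := C1d_mvt (x + c *: delta_mx 0 i) j (hdu i) h0.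
  exists (x + c *: delta_mx 0 i + c' *: delta_mx 0 j); last by rewrite e e'.
  rewrite -(addrA x) [x + _]addrC addrK.
  rewrite (le_trans (ler_normD _ _))// mulr2n mulrDl mul1r.
  by apply: lerD; rewrite (le_trans (norm_delta_le _ _))// gtr0_norm// ltW.
move=> i j x; apply/eqP; rewrite -subr_eq0 -normr_le0; apply/ler_addgt0Pr => e e0; rewrite add0r.
have e20 : 0 < e / 2 by rewrite divr_gt0.
have c1 := C1d_contd (i := j) (hdu i); have c2 := C1d_contd (i := i) (hdu j).
have /cvgrPdist_lt/(_ _ e20)/nbhs_ballP[r1 /= r10 H1] := c1 x.
have /cvgrPdist_lt/(_ _ e20)/nbhs_ballP[r2 /= r20 H2] := c2 x.
pose h := minr r1 r2 / 4.
have m0 : 0 < minr r1 r2 by rewrite lt_min r10.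
have h0 : 0 < h by rewrite divr_gt0.
have hm : 2 * h < minr r1 r2 by rewrite /h; lra.
have [p px ep] := key i j x h h0.
have [q qq eq] := key j i x h h0.
have E : H i j p = H j i q.
  have hn : h != 0 by rewrite lt0r_neq0.
  apply: (mulfI hn); apply: (mulfI hn); rewrite -ep -eq (addrAC x).
  ring.
have bp : ball x r1 p.
  rewrite mx_norm_ball /ball_ /= distrC (le_lt_trans px)// (lt_le_trans hm)//.
  by rewrite ge_min lexx.
have bq : ball x r2 q.
  rewrite mx_norm_ball /ball_ /= distrC (le_lt_trans qq)// (lt_le_trans hm)//.
  by rewrite ge_min lexx orbT.
have h1 := H1 _ bp; have h2 := H2 _ bq; rewrite /= in h1 h2.
have -> : H i j x - H j i x = (H i j x - H i j p) - (H j i x - H j i q) by rewrite E; ring.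
by rewrite (le_trans (ler_normB _ _))// (splitr e) lerD// ltW.
Qed.

Lemma bsupp_C1d n (g : 'rV[R]_n -> R) dg (r : R) : C1d g dg -> (forall x, r < `|x| -> g x = 0) ->
  forall i x, r < `|x| -> dg i x = 0.
Proof.
move=> hg gr i x xr; have := C1d_is_derive i x hg => D.
have D0 : is_derive x (delta_mx 0 i) g 0.
  apply: (@near_eq_is_derive R _ _ (cst 0)).
  have : \forall y \near x, r < `|y|.
    have := @norm_continuous R 'rV[R]_n x; move=> /(_ [set t | r < t]); apply.
    by apply: open_nbhs_nbhs; split; [exact: open_gt|exact: xr].
  by apply: filterS => y yr; rewrite gr.
by rewrite -(@derive_val _ _ _ _ _ _ _ D) (@derive_val _ _ _ _ _ _ _ D0).
Qed.

Lemma lbmc_C1d n (g : 'rV[R]_n -> R) dg : C1d g dg -> bsupp g -> lbmc g.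
Proof. by move=> hg bg; split => //; apply: lbm_cont; exact: C1d_cont hg. Qed.

Lemma lbmc_C1dd n (g : 'rV[R]_n -> R) dg i : C1d g dg -> bsupp g -> lbmc (dg i).
Proof.
move=> hg [r gr]; split; first by apply: lbm_cont; exact: C1d_contd hg.
by exists r => x xr; exact: (bsupp_C1d hg gr).
Qed.

Lemma lbm_C1d n (g : 'rV[R]_n -> R) dg : C1d g dg -> lbm g.
Proof. by move=> hg; apply: lbm_cont; exact: C1d_cont hg. Qed.

Lemma lbm_C1dd n (g : 'rV[R]_n -> R) dg i : C1d g dg -> lbm (dg i).
Proof. by move=> hg; apply: lbm_cont; exact: C1d_contd hg. Qed.

Lemma integ_partial0 n (g : 'rV[R]_n -> R) dg i : C1d g dg -> bsupp g -> integ (dg i) = 0.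
Proof.
move=> hg bg; apply: (integ_partial_eq0 (i := i) (f := g)) => //.
- exact: C1d_contd hg.
- by move=> x; exact: C1d_is_derive hg.
- by have [] := lbmc_C1dd i hg bg.
Qed.

Lemma integ_by_parts n (f g : 'rV[R]_n -> R) df dg i : C1d f df -> C1d g dg -> bsupp g ->
  integ (fun x => df i x * g x) = - integ (fun x => f x * dg i x).
Proof.
move=> hf hg bg; apply/eqP; rewrite -subr_eq0 opprK -integD.
- have := integ_partial0 i (C1dM hf hg) (@bsuppMr _ _ f _ bg) => /= h.
  by rewrite -[X in _ == X]h; apply/eqP; congr integ; apply/funext => x; rewrite addrC.
- by apply: lbmcMr; [exact: lbm_C1dd hf|exact: lbmc_C1d hg bg].
- by apply: lbmcMr; [exact: lbm_C1d hf|exact: lbmc_C1dd hg bg].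
Qed.

(** The lower derivative of [f] at [u] is not known to be measurable; the
    integral, a difference of suprema over simple functions, is still monotone. *)
Lemma le_integral_nomeas d (X : measurableType d) (m : {measure set X -> \bar R}) (f g : X -> \bar R) :
  (forall x, f x <= g x)%E -> (\int[m]_x f x <= \int[m]_x g x)%E.
Proof.
move=> fg; rewrite /integral !patch_setT; apply: leeB; apply: le_ereal_sup => _ [h hf <-];
  exists h => // x; rewrite (le_trans (hf x))//.
  by rewrite !funeposE ge_max !le_max fg lexx orbT.
by rewrite !funenegE ge_max !le_max leeN2 fg lexx orbT.
Qed.
End gradients.

(** * The linearized equation *)

Section linearization.
Context {R : realType}.
Notation T n := (n.-tuple (measurableTypeR R)).
Notation mu n := (@lebesgue_tuple R n).

Lemma C1d_diffquot n (g : 'rV[R]_n -> R) dg z (h : R) : C1d g dg ->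
  C1d (fun x => (g (x + z) - g x) / h) (fun i x => (dg i (x + z) - dg i x) / h).
Proof.
move=> hg; apply: (C1d_ext (C1dZ h^-1 (C1dB (C1d_shift z hg) hg))) => [x|i x]; exact: mulrC.
Qed.

Lemma lbmc_bounded n (g : 'rV[R]_n -> R) : lbmc g -> exists2 M, 0 <= M & forall x, `|g x| <= M.
Proof.
move=> [[_ bg] [r hr]]; have [M HM] := bg r; exists `|M| => // x.
have [xr|xr] := leP `|x| r; last by rewrite hr// normr0.
by rewrite (le_trans (HM x xr))// ler_norm.
Qed.

Lemma integ_quot_cvg n (g psi : 'rV[R]_n -> R) dg i : C1d g dg -> lbmc psi ->
  (fun k : nat => integ (fun x =>
     (g (x + k.+1%:R^-1 *: delta_mx 0 i) - g x) / k.+1%:R^-1 * psi x)) @ \oo -->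
  integ (fun x => dg i x * psi x).
Proof.
move=> hg okpsi; have [K K0 HK] := lbmc_bounded okpsi.
have [_ [r hr]] := okpsi; have [M M0 HM] := C1d_incr i r hg.
apply: (@integ_cvg R n _ _ r (M * K) set0).
- move=> k; have [[m _] _] := lbmcMr (lbm_C1d (C1d_diffquot (k.+1%:R^-1 *: delta_mx 0 i) k.+1%:R^-1 hg)) okpsi.
  exact: m.
- by have [[]] := lbmcMr (lbm_C1dd i hg) okpsi.
- move=> k x; have k0 : (0 : R) < k.+1%:R^-1 by rewrite invr_gt0.
  have [xr|xr] := leP `|x| r; last by rewrite hr// mulr0 normr0 mulr_ge0.
  rewrite normrM ler_pM// normrM [`|_^-1|]gtr0_norm ?invr_gt0// ler_pdivrMr//.
  by apply: HM; rewrite // k0 invf_le1// ler1n.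
- by move=> k x xr; rewrite hr// mulr0.
- exact: measurable0.
- exact: measure0.
- move=> t _; apply: cvgM; last exact: cvg_cst.
  exact: C1d_quot.
Qed.

Lemma cvg_sumr (I : Type) (s : seq I) (a : I -> nat -> R) (l : I -> R) :
  (forall i, a i @ \oo --> l i) -> (fun k => \sum_(i <- s) a i k) @ \oo --> \sum_(i <- s) l i.
Proof.
move=> al; elim: s => [|i s IH].
  by rewrite big_nil; under eq_fun do rewrite big_nil; exact: cvg_cst.
rewrite big_cons; under eq_fun do rewrite big_cons.
by apply: cvgD => //; exact: al.
Qed.

Lemma locally_lipschitz_continuous (f : R -> R) : locally_lipschitz f -> continuous f.
Proof.
move=> fl t; have [L L0 HL] := lipschitz_on_itv (`|t| + 1) fl.
apply/cvgrPdist_lt => e e0; apply/nbhs_ballP; exists (minr 1 (e / L)) => /=.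
  by rewrite lt_min ltr01 divr_gt0.
move=> s; rewrite /ball /= lt_min => /andP[st1 st2].
apply: le_lt_trans (HL t s _ _) _; first by rewrite lerDl.
  by have := ler_distD t s 0; rewrite !subr0 distrC => h; lra.
by rewrite mulrC -ltr_pdivlMr.
Qed.

(** What is kept of the stability of a solution with gradient [du] and Hessian
    [H]: the potential [d] stands for the derivative of [f] at the solution, and
    the last clause is the weak form of [- Delta u_i = d u_i], with one
    integration by parts. Only test functions supported in the ball of radius
    [r] are allowed because [f] is only locally Lipschitz. *)
Definition stable_potential n (du : 'I_n -> 'rV[R]_n -> R)
    (H : 'I_n -> 'I_n -> 'rV[R]_n -> R) (r L : R) (d : 'rV[R]_n -> R) :=
  [/\ lbm d, forall x, `|d x| <= L,
    forall phi dphi, C1d phi dphi -> (forall x, r < `|x| -> phi x = 0) ->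
      integ (fun x => d x * phi x ^+ 2) <= integ (fun x => \sum_i dphi i x ^+ 2) &
    forall psi dpsi i, C1d psi dpsi -> (forall x, r < `|x| -> psi x = 0) ->
      integ (fun x => d x * du i x * psi x) = integ (fun x => \sum_j H i j x * dpsi j x)].

Definition linearly_stable n (du : 'I_n -> 'rV[R]_n -> R)
    (H : 'I_n -> 'I_n -> 'rV[R]_n -> R) :=
  forall r, exists d L, stable_potential du H r L d.

(** The potential is [g \o u], where [g] is the derivative of [f] off a null
    set [Z]. It is at most the lower derivative, whence the stability
    inequality. The difference quotients of [u] solve an equation whose right
    side, the difference quotient of [f \o u], converges to [d u_i] where
    [u x] is off [Z] and also where [u_i] vanishes, hence almost everywhere. *)
Lemma stable_linearized N (f : R -> R) (u : 'rV[R]_N -> R) du H :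
  locally_lipschitz f -> C1d u du -> (forall i, C1d (du i) (H i)) ->
  (forall x, - (\sum_i H i i x) = f (u x)) -> stable setT f u -> linearly_stable du H.
Proof.
move=> flip hu hdu ueq ust r.
have sym := C1d_sym hu hdu.
have [Mu HMu] := locally_bounded_cont (C1d_cont hu) (r + 1).
pose M := `|Mu| + 1.
have M0 : 0 < M by rewrite ltr_wpDl.
have uM x : `|x| <= r + 1 -> `|u x| < M.
  by move=> xr; rewrite (le_lt_trans (HMu x xr))// (le_lt_trans (ler_norm _))// ltrDl.
have [L L0 fL] := lipschitz_on_itv M flip.
have [Z [g [mZ Z0 mg gL [gZ gd]]]] := lipschitz_ae_derivable M0 (ltW L0) fL.
pose d x := g (u x).
have lbmd : lbm d.
  split; first exact: (measurableT_comp mg (measurable_cont (C1d_cont hu))).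
  by move=> s; exists L => x _; exact: gL.
exists d, L; split => //; first by move=> x; exact: gL.
- move=> phi dphi hphi phir.
  have bphi : bsupp phi by exists r.
  have phiC : C1c setT phi.
    split; [exact: C1d_class hphi| |by []].
    apply: (subclosed_compact _ (@closed_ball_compact R N r)); first exact: closed_closure.
    have cl : closed [set x : 'rV[R]_N | `|x| <= r].
      apply: compact_closed; [exact: norm_hausdorff|exact: closed_ball_compact].
    rewrite /tsupport; apply: (@subset_trans _ (closure [set x : 'rV[R]_N | `|x| <= r])).
      by apply: closure_subset => x /= px; rewrite leNgt; apply/negP => h; rewrite phir ?eqxx in px.
    by rewrite -(closure_id _).1.
  have := ust phi phiC; rewrite /integral_RN preimage_setT => S.
  have ok1 : lbmc (fun x => d x * phi x ^+ 2).
    by apply: lbmcMr => //; apply: lbmcX; exact: lbmc_C1d hphi bphi.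
  have ok2 : lbmc (fun x => \sum_i dphi i x ^+ 2).
    by apply: lbmc_sum => i; apply: lbmcX; exact: lbmc_C1dd hphi bphi.
  rewrite /integ /Rintegral -lee_fin !fineK; last 2 first.
  + exact: (integrable_fin_num measurableT (integrable_lbmc ok2)).
  + exact: (integrable_fin_num measurableT (integrable_lbmc ok1)).
  have e : (\int[mu N]_t (sqr_euclidean_norm (gradient phi (row_of_tuple t)))%:E =
            \int[mu N]_t (\sum_i dphi i (row_of_tuple t) ^+ 2)%:E)%E.
    apply: eq_integral => t _; congr EFin; apply: eq_bigr => i _; rewrite mxE.
    by case: hphi => _ -> _.
  rewrite e in S; apply: le_trans S; apply: le_integral_nomeas => t.
  set x := row_of_tuple t.
  have [->|px] := eqVneq (phi x) 0; first by rewrite expr0n mulr0 mule0.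
  have xr : `|x| <= r by rewrite leNgt; apply/negP => h; rewrite phir ?eqxx in px.
  have uxM : `|u x| < M by apply: uM; rewrite (le_trans xr)// lerDl.
  rewrite EFinM; apply: lee_wpmul2r; first by rewrite lee_fin sqr_ge0.
  have fq (h : R) : `|h| < M - `|u x| -> `|f (u x + h) - f (u x)| <= L * `|h|.
    move=> hm; have := fL (u x + h) (u x); rewrite addrAC subrr add0r; apply; last exact: ltW.
    have := ler_normD (u x) h; move: hm; move: (`|u x + h|) (`|u x|) (`|h|) => a b c; lra.
  have e0 : 0 < M - `|u x| by rewrite subr_gt0.
  rewrite /lower_derivative /d; have [Zu|nZu] := pselect (Z (u x)).
    (* on the exceptional set, [- L] is below every difference quotient *)
    rewrite gZ//; apply: (lime_inf_ge e0) => h h0 hm; rewrite lee_fin.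
    have : `|(f (u x + h) - f (u x)) / h| <= L.
      by rewrite normrM normfV ler_pdivrMr ?normr_gt0// fq.
    by rewrite ler_norml => /andP[].
  have D := gd _ uxM nZu.
  apply/lee_addgt0Pr => eps eps0; rewrite -leeBlDr//.
  have [rr rr0 Hr] := derive_quot D eps0.
  rewrite -EFinB; apply: (lime_inf_ge rr0) => h h0 hr; rewrite lee_fin.
  by have := Hr h h0 hr; rewrite ltr_norml => /andP[h1 _]; lra.
- move=> psi dpsi i hpsi psir.
  have bpsi : bsupp psi by exists r.
  have okpsi := lbmc_C1d hpsi bpsi.
  have okdpsi j := lbmc_C1dd j hpsi bpsi.
  pose hk (k : nat) : R := k.+1%:R^-1.
  have hk0 k : 0 < hk k by rewrite invr_gt0.
  have hk1 k : hk k <= 1 by rewrite invf_le1// ler1n.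
  pose e : 'rV[R]_N := delta_mx 0 i.
  (* weak form of the equation solved by the difference quotient of [u] in direction [i] *)
  pose A k x := \sum_j (du j (x + hk k *: e) - du j x) / hk k * dpsi j x.
  pose B k x := (f (u (x + hk k *: e)) - f (u x)) / hk k * psi x.
  have AB k : integ (A k) = integ (B k).
    rewrite /A integ_sum; last first.
      by move=> j; apply: lbmcMr => //; exact: lbm_C1d (C1d_diffquot _ _ (hdu j)).
    have lbmcB j : lbmc (fun x => (H j j (x + hk k *: e) - H j j x) / hk k * psi x).
      by apply: lbmcMr => //; exact: lbm_C1dd (C1d_diffquot _ _ (hdu j)).
    under eq_bigr => j _.
      rewrite -[integ _]opprK -(integ_by_parts j (C1d_diffquot (hk k *: e) (hk k) (hdu j)) hpsi bpsi).
      over.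
    rewrite sumrN -integ_sum// -integN; last exact: lbmc_sum.
    congr integ; apply/funext => x; rewrite -mulr_suml -mulr_suml sumrB.
    rewrite /B -!ueq; ring.
  have cA : (fun k => integ (A k)) @ \oo --> integ (fun x => \sum_j H j i x * dpsi j x).
    rewrite integ_sum; last by move=> j; apply: lbmcMr => //; exact: lbm_C1dd (hdu j).
    have -> : (fun k => integ (A k)) = (fun k => \sum_j integ (fun x => (du j (x + hk k *: e) - du j x) / hk k * dpsi j x)).
      apply/funext => k; rewrite integ_sum// => j.
      by apply: lbmcMr => //; exact: lbm_C1d (C1d_diffquot _ _ (hdu j)).
    by apply: cvg_sumr => j; exact: integ_quot_cvg.
  have cB : (fun k => integ (B k)) @ \oo --> integ (fun x => d x * du i x * psi x).
    have [K K0 HK] := lbmc_bounded okpsi.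
    have [M1 M10 HM1] := C1d_incr i r hu.
    have cf := locally_lipschitz_continuous flip.
    have [mE E0] := null_preimage (fun x => C1d_is_derive i x hu) (C1d_cont hu) (C1d_contd (i := i) hu) mZ Z0.
    have fb k x : `|x| <= r -> `|f (u (x + hk k *: e)) - f (u x)| <= L * `|u (x + hk k *: e) - u x|.
      move=> xr; apply: fL; apply/ltW/uM.
        by rewrite (le_trans (ler_normD _ _))// lerD// (le_trans (norm_delta_le _ _))// gtr0_norm.
      by rewrite (le_trans xr)// lerDl.
    apply: (@integ_cvg R N _ _ r (L * M1 * K) _ _ _ _ _ mE E0).
    - move=> k.
      have c1 : continuous (fun x : 'rV[R]_N => f (u (x + hk k *: e))).
        by apply: (cont_comp cf); exact: (C1d_cont (C1d_shift (hk k *: e) hu)).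
      have c2 : continuous (fun x : 'rV[R]_N => f (u x)) by apply: (cont_comp cf); exact: C1d_cont hu.
      have l : lbm (fun x : 'rV[R]_N => (f (u (x + hk k *: e)) - f (u x)) / hk k).
        by apply: lbm_cont; apply: contM; [exact: contB|exact: cst_continuous].
      by have [[]] := lbmcMr l okpsi.
    - by have [[]] := lbmcMr (lbmM lbmd (lbm_C1dd i hu)) okpsi.
    - move=> k x; have [xr|xr] := leP `|x| r; last first.
        by rewrite /B psir// mulr0 normr0 !mulr_ge0// ltW.
      rewrite /B normrM ler_pM// normrM normfV [`|hk k|]gtr0_norm// ler_pdivrMr//.
      rewrite (le_trans (fb k x xr))// -mulrA ler_wpM2l ?(ltW L0)//.
      by apply: HM1; rewrite ?hk0 ?hk1.
    - by move=> k x xr; rewrite /B psir// mulr0.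
    - move=> t nE; set x := row_of_tuple t.
      have [xr|xr] := leP `|x| r; last first.
        rewrite psir// mulr0 (_ : B ^~ x = cst 0); first exact: cvg_cst.
        by apply/funext => k; rewrite /B psir// mulr0.
      apply: cvgM; last exact: cvg_cst.
      have qc : (fun k => (u (x + hk k *: e) - u x) / hk k) @ \oo --> du i x by exact: C1d_quot.
      have [du0|du0] := eqVneq (du i x) 0.
        rewrite du0 mulr0.
        apply/cvgr0Pnorm_lt => eps eps0.
        have epsL : 0 < eps / L by rewrite divr_gt0.
        rewrite du0 in qc; move/cvgr0Pnorm_lt/(_ _ epsL) : qc; apply: filterS => k hq.
        rewrite (@le_lt_trans _ _ (L * `|(u (x + hk k *: e) - u x) / hk k|))//; last first.
          by rewrite mulrC -ltr_pdivlMr.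
        rewrite !normrM normfV [`|hk k|]gtr0_norm// mulrA ler_pM2r ?invr_gt0//.
        exact: fb.
      (* here [du i x != 0], so that [u x] is off [Z] and the chain rule applies *)
      have nZ : ~ Z (u x) by move=> Zu; apply: nE.
      have uxM : `|u x| < M by apply: uM; rewrite (le_trans xr)// lerDl.
      have D1 := gd _ uxM nZ.
      have D2 := C1d_line x i 0 hu; rewrite scale0r addr0 in D2.
      have D3 : is_derive (0 : R) 1 (f \o (fun s : R => u (x + s *: e))) (g (u x) * du i x).
        apply: is_derive1_comp => //; by rewrite scale0r addr0.
      apply/cvgrPdist_lt => eps eps0; have [rr rr0 Hr] := derive_quot D3 eps0.
      near=> k; have := Hr (hk k); rewrite add0r /= scale0r addr0 distrC; apply.
        by rewrite lt0r_neq0.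
      by rewrite gtr0_norm//; near: k; exact: (near_infty_natSinv_lt (PosNum rr0)).
  have -> : (fun x => \sum_j H i j x * dpsi j x) = (fun x => \sum_j H j i x * dpsi j x).
    by apply/funext => x; apply: eq_bigr => j _; rewrite sym.
  have eAB : (fun k => integ (A k)) = (fun k => integ (B k)) by apply/funext => k; exact: AB.
  rewrite eAB in cA.
  exact: (cvg_unique _ cB cA).
Unshelve. all: by end_near. Qed.
End linearization.

(** * Algebra of the Hessian *)

Section hessian_algebra.
Context {R : realType}.

Lemma discriminant_le (a b c : R) : 0 <= c -> (forall t, 0 <= a + 2 * b * t + c * t ^+ 2) -> b ^+ 2 <= a * c.
Proof.
move=> c0 H; have [c00|cn] := eqVneq c 0.
  have [->|b0] := eqVneq b 0; first by rewrite c00 mulr0 expr0n.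
  have := H (- (a + 1) / (2 * b)); rewrite c00 mul0r addr0 mulrC divfK ?mulf_neq0 ?pnatr_eq0//.
  lra.
have cp : 0 < c by rewrite lt_neqAle eq_sym cn.
have := H (- b / c); rewrite (_ : a + _ + _ = (a * c - b ^+ 2) / c); last by field.
by rewrite pmulr_lge0 ?invr_gt0// subr_ge0.
Qed.

Lemma cauchy_schwarz_sum (I : finType) (a b : I -> R) :
  (\sum_i a i * b i) ^+ 2 <= (\sum_i a i ^+ 2) * (\sum_i b i ^+ 2).
Proof.
apply: discriminant_le => [|t]; first by apply: sumr_ge0 => i _; exact: sqr_ge0.
rewrite mulr_sumr mulr_suml mulr_suml -!big_split /=.
apply: sumr_ge0 => i _; rewrite (_ : _ + _ = (a i + t * b i) ^+ 2) ?sqr_ge0//; ring.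
Qed.

Section alg.
Variable n : nat.
Variables (h : 'I_n -> 'I_n -> R) (N : 'I_n -> R).
Hypothesis hs : forall i j, h i j = h j i.
Hypothesis N1 : \sum_i N i ^+ 2 <= 1.

Let dot (y z : 'I_n -> R) := \sum_k y k * z k.
(* [q] is the scalar product of the components orthogonal to [N] when [N] is a unit
   vector; it is still nonnegative when [N] is shorter, as will be the case below *)
Let q y z := dot y z - dot N y * dot N z.
Let y0 i := \sum_j h i j * N j.
(* the part of the Hessian which stability controls *)
Let A2 := \sum_i \sum_j h i j ^+ 2 - \sum_i y0 i ^+ 2.
Let nhn := \sum_i N i * y0 i.

Let qC y z : q y z = q z y.
Proof. by rewrite /q /dot [X in _ - X]mulrC; congr (_ - _); apply: eq_bigr => k _; rewrite mulrC. Qed.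

Let q_ge0 y : 0 <= q y y.
Proof.
rewrite /q subr_ge0 -expr2 (le_trans (cauchy_schwarz_sum _ _))//.
rewrite (_ : dot y y = \sum_k y k ^+ 2); last by apply: eq_bigr => k _; rewrite expr2.
by rewrite ler_piMl// sumr_ge0// => k _; exact: sqr_ge0.
Qed.

Let q_sum (I : finType) (c : I -> R) (f : I -> 'I_n -> R) z :
  q (fun k => \sum_l c l * f l k) z = \sum_l c l * q (f l) z.
Proof.
rewrite /q /dot.
under [RHS]eq_bigr do rewrite mulrBr mulrA.
rewrite sumrB; congr (_ - _).
  under eq_bigr do rewrite mulr_suml.
  rewrite exchange_big /=; apply: eq_bigr => l _; rewrite mulr_sumr.
  by apply: eq_bigr => k _; rewrite mulrA.
rewrite -mulr_suml; congr (_ * _).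
under eq_bigr do rewrite mulr_sumr.
rewrite exchange_big /=; apply: eq_bigr => l _; rewrite mulr_sumr.
by apply: eq_bigr => k _; rewrite mulrCA.
Qed.

Let q_lin y z t : q (fun k => y k + t * z k) (fun k => y k + t * z k) = q y y + 2 * q y z * t + q z z * t ^+ 2.
Proof.
have e w : q (fun k => y k + t * z k) w = q y w + t * q z w.
  rewrite /q /dot.
  have -> : \sum_k (y k + t * z k) * w k = \sum_k y k * w k + t * \sum_k z k * w k.
    by rewrite mulr_sumr -big_split /=; apply: eq_bigr => k _; ring.
  have -> : \sum_k N k * (y k + t * z k) = \sum_k N k * y k + t * \sum_k N k * z k.
    by rewrite mulr_sumr -big_split /=; apply: eq_bigr => k _; ring.
  ring.
set Y := (fun k => _) in e *.
by rewrite e (qC y Y) (qC z Y) !e (qC z y); ring.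
Qed.

Let cauchy_schwarz_q y z : q y z ^+ 2 <= q y y * q z z.
Proof. by apply: discriminant_le => // t; rewrite -q_lin. Qed.

Let A2E : A2 = \sum_i q (h i) (h i).
Proof.
rewrite /A2 sumrB; congr (_ - _).
apply: eq_bigr => i _; rewrite -expr2 /y0 /dot; congr (_ ^+ 2).
by apply: eq_bigr => j _; rewrite mulrC.
Qed.

Lemma tangential_ge0 : 0 <= A2.
Proof. by rewrite A2E sumr_ge0. Qed.

(** The trace minus [N . hN] is the sum of the [q (h i) (e i)], where [(e i)]
    is the canonical basis and [q (e i) (e i) <= 1]. *)
Lemma tangential_trace : (\sum_i h i i - nhn) ^+ 2 <= n%:R * A2.
Proof.
pose e (i : 'I_n) : 'I_n -> R := fun k => (k == i)%:R.
have de y i : dot y (e i) = y i.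
  rewrite /dot (bigD1 i)//= /e eqxx mulr1 big1 ?addr0// => k /negbTE ->.
  by rewrite mulr0.
have qe i : q (h i) (e i) = h i i - N i * y0 i.
  rewrite /q !de mulrC; congr (_ - _ * _); rewrite /dot /y0.
  by apply: eq_bigr => j _; rewrite mulrC.
have qee i : q (e i) (e i) <= 1.
  by rewrite /q !de /e eqxx -expr2 lerBlDr lerDl sqr_ge0.
rewrite /nhn -sumrB (eq_bigr (fun i => 1 * q (h i) (e i))); last by move=> i _; rewrite qe mul1r.
apply: le_trans (cauchy_schwarz_sum _ _) _.
under eq_bigr do rewrite expr1n.
rewrite sumr_const card_ord ler_wpM2l// A2E; apply: ler_sum => i _.
by apply: le_trans (cauchy_schwarz_q _ _) _; rewrite ler_piMr.
Qed.

(** The vector [h N] is the combination of the rows of [h] with coefficients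
    [N], so that [q (hN) (hN)] is controlled by the [q (h i) (h i)]. *)
Lemma normal_hessian_le : \sum_i y0 i ^+ 2 <= A2 + nhn ^+ 2.
Proof.
have e : q y0 y0 = \sum_i y0 i ^+ 2 - nhn ^+ 2.
  by rewrite /q -expr2; congr (_ - _); rewrite /dot; apply: eq_bigr => k _; rewrite expr2.
rewrite -lerBlDr -e.
have [->|qn] := eqVneq (q y0 y0) 0; first exact: tangential_ge0.
have qp : 0 < q y0 y0 by rewrite lt_neqAle eq_sym qn q_ge0.
have y0E : y0 = (fun k => \sum_l N l * h l k).
  by apply/funext => k; apply: eq_bigr => l _; rewrite hs mulrC.
rewrite -(ler_pM2r qp) -expr2.
rewrite {1}y0E q_sum; apply: le_trans (cauchy_schwarz_sum _ _) _.
apply: (@le_trans _ _ (1 * \sum_l q (h l) y0 ^+ 2)).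
  by rewrite ler_wpM2r// sumr_ge0// => l _; exact: sqr_ge0.
by rewrite mul1r A2E mulr_suml; apply: ler_sum => l _; exact: cauchy_schwarz_q.
Qed.

(** The previous two bounds control [h N] by the square root of [A2] and by the
    trace. The trace is nonpositive, so its absolute value is absorbed by the
    term [p (tr h + N . hN)], which will be the divergence of [p^2 N] and will
    disappear by integration by parts. *)
Lemma sum_normal_hessian_le (p l : R) : 0 <= p -> 0 < l -> \sum_i h i i <= 0 ->
  \sum_k `|2 * p * y0 k| <=
    - n%:R * (p * (\sum_i h i i + nhn)) +
    (3 * n%:R ^+ 2 + 2 * n%:R) * (p ^+ 2 / l + l * A2).
Proof.
move=> p0 l0 tr0.
pose s := Num.sqrt A2; have s0 : 0 <= s := sqrtr_ge0 _.
have s2 : s ^+ 2 = A2 by rewrite sqr_sqrtr// tangential_ge0.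
set tr := \sum_i h i i in tr0 *.
have n0 : (0 : R) <= n%:R by [].
have nn : (n%:R : R) <= n%:R ^+ 2.
  case: (n) => [|m]; first by rewrite expr0n.
  by rewrite -[leLHS]mulr1 expr2 ler_wpM2l// ler1n.
have h1 : `|tr - nhn| <= n%:R * s.
  rewrite -(@ler_pXn2r _ 2)// ?nnegrE ?mulr_ge0//.
  rewrite real_normK ?num_real// (le_trans tangential_trace)// exprMn s2 ler_wpM2r//; exact: tangential_ge0.
have hy k : `|y0 k| <= s + `|nhn|.
  rewrite -(@ler_pXn2r _ 2)// ?nnegrE ?addr_ge0//.
  rewrite real_normK ?num_real//.
  have : y0 k ^+ 2 <= \sum_i y0 i ^+ 2.
    by rewrite (bigD1 k)//= lerDl sumr_ge0// => i _; exact: sqr_ge0.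
  move=> /le_trans; apply; apply: le_trans normal_hessian_le _.
  rewrite -s2 sqrrD real_normK ?num_real// addrAC lerDl mulrn_wge0// mulr_ge0//.
have hs1 : \sum_k `|y0 k| <= n%:R * (s + `|nhn|).
  apply: le_trans (ler_sum _ (fun k _ => hy k)) _.
  by rewrite sumr_const card_ord mulr_natl.
have -> : \sum_k `|2 * p * y0 k| = 2 * p * \sum_k `|y0 k|.
  by rewrite mulr_sumr; apply: eq_bigr => k _; rewrite normrM ger0_norm// mulr_ge0.
have hn : `|nhn| <= - tr + n%:R * s.
  move: h1; rewrite ler_norml => /andP[a b]; rewrite ler_norml; apply/andP; split; lra.
have ps : p * s <= p ^+ 2 / l + l * A2.
  rewrite -s2 -subr_ge0.
  have -> : p ^+ 2 / l + l * s ^+ 2 - p * s = ((p - l * s) ^+ 2 + p * (l * s)) / l by field; rewrite lt0r_neq0.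
  apply: divr_ge0; last exact: ltW.
  by rewrite addr_ge0 ?sqr_ge0// mulr_ge0// mulr_ge0// ltW.
have nhn2 : tr + nhn <= 2 * tr + n%:R * s.
  by move: h1; rewrite ler_norml => /andP[a b]; lra.
apply: (@le_trans _ _ (2 * p * (n%:R * (s + (- tr + n%:R * s))))).
  rewrite ler_wpM2l ?mulr_ge0// (le_trans hs1)// ler_wpM2l// lerD2l//.
apply: (@le_trans _ _ (- n%:R * (p * (2 * tr + n%:R * s)) + (3 * n%:R ^+ 2 + 2 * n%:R) * (p * s))).
  rewrite le_eqVlt; apply/orP; left; apply/eqP; ring.
apply: lerD; last by rewrite ler_wpM2l// addr_ge0 ?mulr_ge0 ?sqr_ge0.
by rewrite !mulNr lerN2 ler_wpM2l// ler_wpM2l.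
Qed.
End alg.
End hessian_algebra.

(** * Stability bounds the variation of the energy density *)

Section sternberg_zumbrun.
Context {R : realType}.

Lemma C1d_comp_at n (h h' : R -> R) (f : 'rV[R]_n -> R) df :
  (forall x, is_derive (f x) 1 h (h' (f x))) -> continuous (fun x => h' (f x)) -> C1d f df ->
  C1d (fun x => h (f x)) (fun i x => h' (f x) * df i x).
Proof.
move=> dh ch hf.
have dfh x : differentiable h (f x) by apply/derivable1_diffP; exact: ex_derive.
have dff x : differentiable f x by case: hf.
have E i x : 'd f x 'e_i = df i x by rewrite -deriveE//; case: hf => _ p _; exact: p.
apply: C1d_intro => [x|i x|i].
- exact: differentiable_comp.
- apply: DeriveDef; first by apply: diff_derivable; exact: differentiable_comp.
  rewrite deriveE; last exact: differentiable_comp.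
  rewrite (@diff_comp _ _ _ _ f h)//= E -[in LHS](mulr1 (df i x)) -[df i x * 1]/(df i x *: (1 : R^o)).
  by rewrite linearZ /= -deriveE// derive_val mulrC.
- by apply: contM => //; exact: (C1d_contd hf).
Qed.

Lemma is_derive_sqrt (s : R) : 0 < s -> is_derive s 1 Num.sqrt (2 * Num.sqrt s)^-1.
Proof.
move=> s0; have := @is_derive1_powR R 2^-1 s s0.
have -> : 2^-1 * s `^ (2^-1 - 1) = (2 * Num.sqrt s)^-1.
  rewrite invfM; congr (_ * _); rewrite (_ : 2^-1 - 1 = - 2^-1); last by field.
  by rewrite powRN powR12_sqrt// ltW.
apply: near_eq_is_derive.
near=> t; rewrite powR12_sqrt//; apply/ltW; near: t.
exact: lt_nbhsr.
Unshelve. all: by end_near. Qed.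

Lemma contV (V : topologicalType) (f : V -> R) : continuous f -> (forall x, f x != 0) ->
  continuous (fun x => (f x)^-1).
Proof. by move=> cf nz x; apply: (cvgV (nz x)); exact: cf. Qed.

Lemma C1d_sqrt n (f : 'rV[R]_n -> R) df : C1d f df -> (forall x, 0 < f x) ->
  C1d (fun x => Num.sqrt (f x)) (fun i x => (2 * Num.sqrt (f x))^-1 * df i x).
Proof.
move=> hf f0; apply: (C1d_comp_at (h' := fun s => (2 * Num.sqrt s)^-1)) => //.
  by move=> x; exact: is_derive_sqrt.
have nz x : 2 * Num.sqrt (f x) != 0 by rewrite mulf_neq0 ?pnatr_eq0// lt0r_neq0// sqrtr_gt0.
apply: contV => //; apply: contM; first exact: cst_continuous.
by apply: cont_comp; [exact: sqrt_continuous|exact: (C1d_cont hf)].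
Qed.

Lemma eq_integ n (f g : 'rV[R]_n -> R) : f =1 g -> integ f = integ g.
Proof. by move=> /funext ->. Qed.

Section energy_density.
Variables (n : nat) (u : 'rV[R]_n -> R) (du : 'I_n -> 'rV[R]_n -> R)
   (H : 'I_n -> 'I_n -> 'rV[R]_n -> R).
Hypotheses (hu : C1d u du) (hdu : forall i, C1d (du i) (H i)).
Hypothesis tr_le0 : forall x, \sum_i H i i x <= 0.
Hypothesis hst : linearly_stable du H.

Definition sqgrad x := \sum_i du i x ^+ 2.
Definition dsqgrad k x := \sum_i (du i x * H i k x + H i k x * du i x).

Lemma C1d_sqgrad : C1d sqgrad dsqgrad.
Proof.
apply: (C1d_ext (C1d_sum _ (fun i => C1dM (hdu i) (hdu i)))) => [x|i x]; rewrite /sqgrad //.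
Qed.

Lemma sqgrad_ge0 x : 0 <= sqgrad x.
Proof. by apply: sumr_ge0 => i _; exact: sqr_ge0. Qed.

Lemma dsqgradE k x : dsqgrad k x = 2 * \sum_j H k j x * du j x.
Proof.
rewrite /dsqgrad mulr_sumr; apply: eq_bigr => i _; rewrite (C1d_sym hu hdu i k); ring.
Qed.

Section eps.
Variable e : R.
Hypothesis e0 : 0 < e.
(* [e > 0] makes [p] differentiable also where the gradient vanishes *)
Let p x := Num.sqrt (sqgrad x + e).
Let Fe0 x : 0 < sqgrad x + e. Proof. by rewrite ltr_wpDl// sqgrad_ge0. Qed.
Let p0 x : 0 < p x. Proof. by rewrite sqrtr_gt0. Qed.
Let p2 x : p x ^+ 2 = sqgrad x + e. Proof. by rewrite sqr_sqrtr// ltW. Qed.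
Let Nn k x := du k x / p x.
Let y k x := \sum_j H k j x * Nn j x.
Let A2 x := \sum_i \sum_j H i j x ^+ 2 - \sum_i y i x ^+ 2.

Let pNn k x : p x * Nn k x = du k x.
Proof. by rewrite /Nn mulrC divfK// lt0r_neq0. Qed.

Let Nn1 x : \sum_k Nn k x ^+ 2 <= 1.
Proof.
rewrite /Nn; under eq_bigr do rewrite expr_div_n p2.
by rewrite -mulr_suml ler_pdivrMr// mul1r /sqgrad lerDl ltW.
Qed.

Let py k x : p x * y k x = \sum_j H k j x * du j x.
Proof. by rewrite mulr_sumr; apply: eq_bigr => j _; rewrite mulrCA pNn. Qed.

Let C1d_p : C1d p (fun k x => y k x).
Proof.
have h := C1d_sqrt (C1dD C1d_sqgrad (@C1d_cst R n e)) Fe0.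
apply: (C1d_ext h) => // k x; rewrite addr0 dsqgradE -py -/(p x).
by field; rewrite lt0r_neq0.
Qed.

Let lbmH i j : lbm (H i j). Proof. exact: lbm_C1dd (hdu i). Qed.
Let lbmdu i : lbm (du i). Proof. exact: lbm_C1d (hdu i). Qed.
Let lbmp : lbm p. Proof. exact: lbm_C1d C1d_p. Qed.
Let lbmy k : lbm (y k). Proof. exact: lbm_C1dd C1d_p. Qed.
Let lbmA2 : lbm A2.
Proof.
apply: lbmB; apply: lbm_sum => i; last exact: lbmX.
by apply: lbm_sum => j; exact: lbmX.
Qed.

(** Stability is tested with [p z] and the linearized equations with
    [u_i z^2]; in the difference of the two, second derivatives only enter
    through [A2]. The last term is the price of [p^2 = |grad u|^2 + e]. *)
Lemma sternberg_zumbrun_ineq (z : 'rV[R]_n -> R) dz r d L : C1d z dz -> (forall x, r < `|x| -> z x = 0) ->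
  stable_potential du H r L d ->
  integ (fun x => A2 x * z x ^+ 2) <=
    integ (fun x => p x ^+ 2 * \sum_k dz k x ^+ 2) + e * (L * integ (fun x => z x ^+ 2)).
Proof.
move=> hz zr [lbmd dL St Li].
have bz : bsupp z by exists r.
have okz := lbmc_C1d hz bz; have okdz k := lbmc_C1dd k hz bz.
have okz2 : lbmc (fun x => z x ^+ 2) by exact: lbmcX.
have hphi := C1dM C1d_p hz.
have phir x : r < `|x| -> p x * z x = 0 by move=> xr; rewrite zr// mulr0.
have S1 := St _ _ hphi phir.
have L1 i : integ (fun x => d x * du i x * (du i x * z x ^+ 2)) =
    integ (fun x => \sum_j H i j x * (du i x * (2 * z x * dz j x) + H i j x * z x ^+ 2)).
  rewrite (Li _ _ i (C1dM (hdu i) (C1dM hz hz))); last by move=> x xr; rewrite zr// !mulr0.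
  by apply: eq_integ => x; apply: eq_bigr => j _; ring.
have okL i : lbmc (fun x => \sum_j H i j x * (du i x * (2 * z x * dz j x) + H i j x * z x ^+ 2)).
  apply: lbmc_sum => j; apply: lbmcMr => //; apply: lbmcD; apply: lbmcMr => //.
  by apply: lbmcMr => //; apply: lbmZ; exact: lbm_C1d hz.
have okd i : lbmc (fun x => d x * du i x * (du i x * z x ^+ 2)).
  by apply: lbmcMr; [exact: lbmM|exact: lbmcMr].
have L2 : integ (fun x => d x * (sqgrad x * z x ^+ 2)) =
    integ (fun x => \sum_i \sum_j H i j x * (du i x * (2 * z x * dz j x) + H i j x * z x ^+ 2)).
  rewrite integ_sum// -(eq_bigr _ (fun i _ => L1 i)) -integ_sum//.
  apply: eq_integ => x; rewrite /sqgrad mulr_suml mulr_sumr; apply: eq_bigr => i _; ring.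
have okF : lbmc (fun x => d x * (sqgrad x * z x ^+ 2)).
  by apply: lbmcMr => //; apply: lbmcMr => //; exact: lbm_C1d C1d_sqgrad.
have okS : lbmc (fun x => \sum_i (p x * dz i x + y i x * z x) ^+ 2).
  by apply: lbmc_sum => i; apply: lbmcX; apply: lbmcD; exact: lbmcMr.
have okE : lbmc (fun x => p x ^+ 2 * \sum_k dz k x ^+ 2).
  by apply: lbmcMr; [exact: lbmX|apply: lbmc_sum => k; exact: lbmcX].
have okB1 : lbmc (fun x => \sum_i \sum_j H i j x * (du i x * (2 * z x * dz j x) + H i j x * z x ^+ 2)).
  exact: lbmc_sum.
(* the terms in [z dz] are the same on both sides and cancel *)
have E1 : integ (fun x => A2 x * z x ^+ 2) =
   integ (fun x => d x * (sqgrad x * z x ^+ 2)) - integ (fun x => \sum_i (p x * dz i x + y i x * z x) ^+ 2)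
   + integ (fun x => p x ^+ 2 * \sum_k dz k x ^+ 2).
  rewrite L2 -integB// -integD//; last exact: lbmcB.
  apply: eq_integ => x; rewrite /A2.
  have -> : \sum_i \sum_j H i j x * (du i x * (2 * z x * dz j x) + H i j x * z x ^+ 2) =
     \sum_j (2 * z x * dz j x * (p x * y j x)) + (\sum_i \sum_j H i j x ^+ 2) * z x ^+ 2.
    rewrite exchange_big /= [X in _ + X * _]exchange_big /= mulr_suml -big_split /=.
    apply: eq_bigr => j _; rewrite py mulr_sumr mulr_suml -big_split /=.
    by apply: eq_bigr => i _; rewrite (C1d_sym hu hdu j i); ring.
  rewrite mulrBl.
  have -> : \sum_i (p x * dz i x + y i x * z x) ^+ 2 =
     p x ^+ 2 * (\sum_k dz k x ^+ 2) + \sum_j (2 * z x * dz j x * (p x * y j x)) + (\sum_i y i x ^+ 2) * z x ^+ 2.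
    by rewrite mulr_suml mulr_sumr -!big_split /=; apply: eq_bigr => i _; ring.
  ring.
have E2 : integ (fun x => d x * (p x * z x) ^+ 2) =
    integ (fun x => d x * (sqgrad x * z x ^+ 2)) + e * integ (fun x => d x * z x ^+ 2).
  have okdz2 : lbmc (fun x => d x * z x ^+ 2) by exact: lbmcMr.
  rewrite -integZ// -integD//; last exact: lbmcZ.
  by apply: eq_integ => x; rewrite exprMn p2; ring.
have E3 : - integ (fun x => d x * z x ^+ 2) <= L * integ (fun x => z x ^+ 2).
  rewrite -integN ?integZ//; last exact: lbmcMr.
  rewrite -integZ//; apply: le_integ; [by apply: lbmcN; exact: lbmcMr|exact: lbmcZ|].
  move=> x; rewrite -mulNr ler_wpM2r ?sqr_ge0//.
  by have := dL x; rewrite ler_norml => /andP[]; lra.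
rewrite E1; have := ler_wpM2l (ltW e0) E3; rewrite E2 in S1; move: S1.
rewrite mulrN; lra.
Qed.

Let C1 : R := 3 * n%:R ^+ 2 + 2 * n%:R.

(** Twice [p] times the [k]-th component of the Hessian applied to [N] is the
    [k]-th derivative of [|grad u|^2], so [sum_normal_hessian_le] bounds the
    integrand pointwise. *)
Lemma grad_energy_eps (z : 'rV[R]_n -> R) dz r d L l : C1d z dz -> (forall x, r < `|x| -> z x = 0) ->
  stable_potential du H r L d ->
  0 < l ->
  integ (fun x => (\sum_k `|dsqgrad k x|) * z x ^+ 2) <=
    (n%:R + C1) * integ (fun x => (sqgrad x + e) * (z x ^+ 2 / l + l * \sum_k dz k x ^+ 2))
    + C1 * l * (e * (L * integ (fun x => z x ^+ 2))).
Proof.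
move=> hz zr hd l0.
have SZ := sternberg_zumbrun_ineq hz zr hd.
have bz : bsupp z by exists r.
have okz := lbmc_C1d hz bz; have okdz k := lbmc_C1dd k hz bz.
have okz2 : lbmc (fun x => z x ^+ 2) by exact: lbmcX.
have C10 : 0 <= C1 by rewrite addr_ge0 ?mulr_ge0 ?sqr_ge0.
pose nhn x := \sum_i Nn i x * y i x.
pose tr x := \sum_i H i i x.
pose dv x := p x * (tr x + nhn x).
have hsym x i j : H i j x = H j i x by exact: C1d_sym hu hdu i j x.
have ptw x : \sum_k `|dsqgrad k x| <= - n%:R * dv x + C1 * (p x ^+ 2 / l + l * A2 x).
  have := @sum_normal_hessian_le R n (fun i j => H i j x) (fun i => Nn i x) (hsym x) (Nn1 x) (p x) l (ltW (p0 x)) l0 (tr_le0 x).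
  apply: le_trans; rewrite le_eqVlt; apply/orP; left; apply/eqP; apply: eq_bigr => k _.
  by rewrite dsqgradE -py mulrA.
have lbmdv : lbm dv.
  apply: lbmM => //; apply: lbmD; first exact: lbm_sum.
  apply: lbm_sum => i; apply: lbmM => //; apply: lbmM => //.
  apply: lbm_cont; apply: contV; first exact: (C1d_cont C1d_p).
  by move=> x; rewrite lt0r_neq0.
have okA : lbmc (fun x => A2 x * z x ^+ 2) by exact: lbmcMr.
have okE : lbmc (fun x => p x ^+ 2 * \sum_k dz k x ^+ 2).
  by apply: lbmcMr; [exact: lbmX|apply: lbmc_sum => k; exact: lbmcX].
have okp : lbmc (fun x => p x ^+ 2 * z x ^+ 2) by apply: lbmcMr => //; exact: lbmX.
(* [dv] is the divergence of [p grad u] *)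
have dvE : integ (fun x => dv x * z x ^+ 2) = - integ (fun x => \sum_k p x * du k x * (2 * z x * dz k x)).
  have okk k : lbmc (fun x => (p x * H k k x + y k x * du k x) * z x ^+ 2).
    by apply: lbmcMr => //; apply: lbmD; exact: lbmM.
  have okk2 k : lbmc (fun x => p x * du k x * (2 * z x * dz k x)).
    by apply: lbmcMr; [exact: lbmM|apply: lbmcMr => //; apply: lbmZ; exact: lbm_C1d hz].
  rewrite integ_sum// -sumrN.
  have -> : integ (fun x => dv x * z x ^+ 2) = \sum_k integ (fun x => (p x * H k k x + y k x * du k x) * z x ^+ 2).
    rewrite -integ_sum//; apply: eq_integ => x; rewrite -mulr_suml; congr (_ * _).
    rewrite /dv mulrDr /tr /nhn !mulr_sumr -big_split /=; apply: eq_bigr => k _.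
    by rewrite mulrA pNn [du k x * _]mulrC.
  apply: eq_bigr => k _.
  rewrite (integ_by_parts k (C1dM C1d_p (hdu k)) (C1dM hz hz)); last exact: bsuppM.
  by congr (- _); apply: eq_integ => x; ring.
have okSk : lbmc (fun x => \sum_k p x * du k x * (2 * z x * dz k x)).
  apply: lbmc_sum => k; apply: lbmcMr; [exact: lbmM|apply: lbmcMr => //; apply: lbmZ; exact: lbm_C1d hz].
have okT : lbmc (fun x => (sqgrad x + e) * (z x ^+ 2 / l + l * \sum_k dz k x ^+ 2)).
  apply: lbmcMr; first by apply: lbmD; [exact: lbm_C1d C1d_sqgrad|exact: lbm_cst].
  apply: lbmcD; first by under eq_fun do rewrite mulrC; exact: lbmcZ.
  by apply: lbmcZ; apply: lbmc_sum => k; exact: lbmcX.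
have dvB : integ (fun x => \sum_k p x * du k x * (2 * z x * dz k x)) <=
    integ (fun x => (sqgrad x + e) * (z x ^+ 2 / l + l * \sum_k dz k x ^+ 2)).
  apply: le_integ => // x; rewrite -p2.
  apply: (@le_trans _ _ (\sum_k ((du k x * z x) ^+ 2 / l + l * (p x * dz k x) ^+ 2))).
    apply: ler_sum => k _; rewrite -subr_ge0.
    have -> : (du k x * z x) ^+ 2 / l + l * (p x * dz k x) ^+ 2 - p x * du k x * (2 * z x * dz k x) =
       (du k x * z x - l * (p x * dz k x)) ^+ 2 / l by field; rewrite lt0r_neq0.
    by rewrite divr_ge0 ?sqr_ge0// ltW.
  rewrite big_split /= mulrDr; apply: lerD.
    rewrite -mulr_suml mulrA; under eq_bigr do rewrite exprMn.
    by rewrite -mulr_suml ler_wpM2r ?invr_ge0 ?(ltW l0)// ler_wpM2r ?sqr_ge0// p2 /sqgrad lerDl ltW.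
  by rewrite le_eqVlt !mulr_sumr; apply/orP; left; apply/eqP; apply: eq_bigr => k _; ring.
have TE : integ (fun x => (sqgrad x + e) * (z x ^+ 2 / l + l * \sum_k dz k x ^+ 2)) =
   l^-1 * integ (fun x => p x ^+ 2 * z x ^+ 2) + l * integ (fun x => p x ^+ 2 * \sum_k dz k x ^+ 2).
  rewrite -!integZ// -integD; [|exact: lbmcZ..].
  by apply: eq_integ => x; rewrite -p2; ring.
have step : integ (fun x => (\sum_k `|dsqgrad k x|) * z x ^+ 2) <=
   - n%:R * integ (fun x => dv x * z x ^+ 2) + C1 * (l^-1 * integ (fun x => p x ^+ 2 * z x ^+ 2)
     + l * integ (fun x => A2 x * z x ^+ 2)).
  have okdv : lbmc (fun x => dv x * z x ^+ 2) by exact: lbmcMr.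
  rewrite -!integZ// -integD; [|exact: lbmcZ..].
  rewrite -integZ; last by apply: lbmcD; exact: lbmcZ.
  rewrite -integD; [|exact: lbmcZ|by apply: lbmcZ; apply: lbmcD; exact: lbmcZ].
  apply: le_integ.
  - apply: lbmcMr => //; apply: lbm_sum => k; apply: lbm_abs; exact: lbm_C1dd C1d_sqgrad.
  - apply: lbmcD; first exact: lbmcZ.
    by apply: lbmcZ; apply: lbmcD; exact: lbmcZ.
  - move=> x; apply: (@le_trans _ _ ((- n%:R * dv x + C1 * (p x ^+ 2 / l + l * A2 x)) * z x ^+ 2)).
      by rewrite ler_wpM2r ?sqr_ge0.
    by rewrite le_eqVlt; apply/orP; left; apply/eqP; ring.
apply: le_trans step _; rewrite dvE mulrNN.
have h1 := ler_wpM2l (ler0n R n) dvB.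
have h2 : C1 * l * integ (fun x => A2 x * z x ^+ 2) <= C1 * l * (integ (fun x => p x ^+ 2 * \sum_k dz k x ^+ 2) + e * (L * integ (fun x => z x ^+ 2))).
  by apply: ler_wpM2l => //; rewrite mulr_ge0// ltW.
move: h1 h2; rewrite TE.
move: (integ _) (integ _) (integ _) (integ _) (integ _) => a b c dd ee; nra.
Qed.

End eps.

(** Let [e] tend to 0 in [grad_energy_eps]. *)
Lemma grad_energy (z : 'rV[R]_n -> R) dz l : C1d z dz -> bsupp z -> 0 < l ->
  integ (fun x => (\sum_k `|dsqgrad k x|) * z x ^+ 2) <=
    (3 * n%:R ^+ 2 + 3 * n%:R) * integ (fun x => sqgrad x * (z x ^+ 2 / l + l * \sum_k dz k x ^+ 2)).
Proof.
move=> hz [r zr] l0; have [d [L hd]] := hst r.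
have bz : bsupp z by exists r.
have okz := lbmc_C1d hz bz; have okdz k := lbmc_C1dd k hz bz.
have okW : lbmc (fun x => z x ^+ 2 / l + l * \sum_k dz k x ^+ 2).
  apply: lbmcD; first by under eq_fun do rewrite mulrC; apply: lbmcZ; exact: lbmcX.
  by apply: lbmcZ; apply: lbmc_sum => k; exact: lbmcX.
set C1 : R := 3 * n%:R ^+ 2 + 2 * n%:R.
have -> : 3 * n%:R ^+ 2 + 3 * n%:R = n%:R + C1 :> R by rewrite /C1; ring.
set W := (fun x => _ / l + _) in okW *.
set Y := integ (fun x => sqgrad x * _); set X := integ _.
(* [K - 1] is the factor of [e] in the error, in absolute value *)
pose K := `|(n%:R + C1) * integ W + C1 * l * (L * integ (fun x => z x ^+ 2))| + 1.
have K0 : 0 < K by rewrite ltr_wpDl.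
apply/ler_addgt0Pr => eta eta0.
have eK : 0 < eta / K by rewrite divr_gt0.
have := grad_energy_eps eK hz zr hd l0; rewrite -/C1 -/X => h0.
apply: le_trans h0 _.
have -> : integ (fun x => (sqgrad x + eta / K) * (z x ^+ 2 / l + l * \sum_k dz k x ^+ 2)) =
    Y + eta / K * integ W.
  rewrite -integZ// -integD; [|by apply: lbmcMr => //; exact: lbm_C1d C1d_sqgrad|exact: lbmcZ].
  by apply: eq_integ => x; rewrite mulrDl.
have h : eta / K * ((n%:R + C1) * integ W + C1 * l * (L * integ (fun x => z x ^+ 2))) <= eta.
  rewrite -[leRHS](divfK (lt0r_neq0 K0)) ler_pM2l//.
  by rewrite (le_trans (ler_norm _))// lerDl.
apply: le_trans (lerD (lexx _) h); rewrite le_eqVlt; apply/orP; left; apply/eqP; ring.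
Qed.
End energy_density.
End sternberg_zumbrun.

(** * Radial test functions *)

Section radial.
Context {R : realType}.

(** A quadratic remainder in the first order expansion is available for the
    piecewise quadratic functions below and for their integrals against [v]. *)
Lemma is_derive_quad (f : R -> R) (t d K : R) : 0 <= K ->
  (forall h, `|h| <= 1 -> `|f (t + h) - f t - d * h| <= K * h ^+ 2) -> is_derive t 1 f d.
Proof.
move=> K0 H.
have c : h^-1 *: (f (h *: 1 + t) - f t) @[h --> (0 : R)^'] --> d.
  apply/cvgrPdist_lt => e e0.
  have K1 : 0 < K + 1 by rewrite ltr_wpDl.
  rewrite /dnbhs /within /=; apply/nbhs_ballP; exists (minr 1 (e / (K + 1))) => /=.
    by rewrite lt_min ltr01 divr_gt0.
  move=> h; rewrite /ball /= sub0r normrN lt_min => /andP[h1 h2] h0.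
  have hp : 0 < `|h| by rewrite normr_gt0.
  have := H h (ltW h1); rewrite [h *: 1]mulr1 [h + t]addrC distrC => h3.
  rewrite distrC; have -> : h^-1 *: (f (t + h) - f t) - d = h^-1 * - (d * h - (f (t + h) - f t)).
    by rewrite opprB mulrBr [d * h]mulrC mulKf.
  rewrite normrM normfV normrN mulrC ltr_pdivrMr// (le_lt_trans h3)//.
  rewrite -real_normK ?num_real// expr2 mulrA ltr_pM2r//.
  move: h2; rewrite ltr_pdivlMr// => h2; apply: le_lt_trans h2; rewrite mulrC ler_wpM2l//; lra.
by split; [apply/cvg_ex; exists d|exact/cvg_lim].
Qed.

Definition pos_part (t : R) := maxr t 0.

Lemma pos_ge0 t : 0 <= pos_part t. Proof. by rewrite le_max lexx orbT. Qed.
Lemma pos_id t : 0 <= t -> pos_part t = t. Proof. by move=> h; rewrite /pos_part max_l. Qed.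
Lemma pos_le0 t : t <= 0 -> pos_part t = 0. Proof. by move=> h; rewrite /pos_part max_r. Qed.

Lemma pos_lip s t : s <= t -> 0 <= pos_part t - pos_part s <= t - s.
Proof.
move=> st; rewrite /pos_part /Order.max; repeat case: ifPn; rewrite -?leNgt => *; apply/andP; split; lra.
Qed.

Lemma pos_cont : continuous pos_part.
Proof.
apply: (@lipschitz_continuous _ _ 1) => s t st; have /andP[h1 h2] := pos_lip st.
by rewrite mul1r ger0_norm.
Qed.

Lemma pos_mul t : pos_part t * t = pos_part t ^+ 2.
Proof.
have [h|h] := leP 0 t; first by rewrite pos_id// expr2.
by rewrite pos_le0 ?ltW// mul0r expr0n.
Qed.

Lemma pos2_quad t h : `|pos_part (t + h) ^+ 2 - pos_part t ^+ 2 - 2 * pos_part t * h| <= h ^+ 2.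
Proof.
rewrite /pos_part /Order.max ler_norml; repeat case: ifPn; rewrite -?leNgt => *; apply/andP; split; nra.
Qed.

Lemma is_derive_pos2 (t : R) : is_derive t 1 (fun s => pos_part s ^+ 2) (2 * pos_part t).
Proof. by apply: (@is_derive_quad _ _ _ 1) => // h _; rewrite mul1r; exact: pos2_quad. Qed.

Lemma pos2_cont : continuous (fun t => 2 * pos_part t).
Proof. by apply: contM; [exact: cst_continuous|exact: pos_cont]. Qed.

(** The [C^1] step from 0 to 1 whose derivative is the hat function on [[0, 1]]
    with height 2. *)
Definition step (t : R) := 2 * pos_part t ^+ 2 - 4 * pos_part (t - 2^-1) ^+ 2 + 2 * pos_part (t - 1) ^+ 2.
Definition dstep (t : R) := 4 * pos_part t - 8 * pos_part (t - 2^-1) + 4 * pos_part (t - 1).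

Lemma step_le0 t : t <= 0 -> step t = 0.
Proof. move=> t0; rewrite /step !pos_le0 ?expr0n; lra. Qed.

Lemma step_ge1 t : 1 <= t -> step t = 1.
Proof.
by move=> t1; rewrite /step !pos_id; [field|lra|lra|lra].
Qed.

Lemma step_bnd t : 0 <= step t <= 1.
Proof.
have [t0|t0] := leP t 0; first by rewrite step_le0// lexx ler01.
have [t1|t1] := leP 1 t; first by rewrite step_ge1// lexx ler01.
rewrite /step (pos_id (ltW t0)) (@pos_le0 (t - 1)) ?expr0n; last lra.
have [t2|t2] := leP t 2^-1; first by rewrite pos_le0 ?expr0n ?subr_le0//=; apply/andP; split; nra.
have t3 : 0 <= t - 2^-1 by rewrite subr_ge0 ltW.
rewrite (pos_id t3) mulr0 addr0; apply/andP; split; nra.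
Qed.

Lemma dstep_bnd t : `|dstep t| <= 2.
Proof.
rewrite /dstep /pos_part /Order.max ler_norml; repeat case: ifPn; rewrite -?leNgt => *; apply/andP; split; lra.
Qed.

Lemma dstep_ge0 t : 0 <= dstep t.
Proof.
rewrite /dstep /pos_part /Order.max; repeat case: ifPn; rewrite -?leNgt => *; lra.
Qed.

Lemma dstep_out t : t <= 0 \/ 1 <= t -> dstep t = 0.
Proof.
by case=> h; rewrite /dstep; [rewrite !pos_le0|rewrite !pos_id]; lra.
Qed.

Lemma dstep_cont : continuous dstep.
Proof.
have c a : continuous (fun t : R => pos_part (t - a)).
  by apply: (cont_comp pos_cont); apply: contB; [exact: (fun=> cvg_id)|exact: cst_continuous].
apply: contD; [apply: contB|]; apply: contM; try exact: cst_continuous; try exact: c.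
exact: pos_cont.
Qed.

Lemma is_derive_step (t : R) : is_derive t 1 step (dstep t).
Proof.
have c a : is_derive (t : R) 1 (fun t : R => pos_part (t - a) ^+ 2) (2 * pos_part (t - a)).
  apply: (is_derive_line _ (is_derive_pos2 (t - a))) => h; by rewrite addrA.
apply: (@is_derive_quad _ _ _ 8) => // h _; rewrite /step /dstep.
have := pos2_quad t h; have := pos2_quad (t - 2^-1) h; have := pos2_quad (t - 1) h.
rewrite ![t + h - _]addrAC !ler_norml => /andP[a1 a2] /andP[b1 b2] /andP[c1 c2].
by apply/andP; split; lra.
Qed.

Definition rho n (x : 'rV[R]_n) := \sum_i x 0 i ^+ 2.

Lemma rho_ge0 n (x : 'rV[R]_n) : 0 <= rho x.
Proof. by apply: sumr_ge0 => i _; exact: sqr_ge0. Qed.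

Lemma C1d_rho n : C1d (@rho n) (fun i x => 2 * x 0 i).
Proof.
apply: (C1d_ext (C1d_sum _ (fun j => C1dM (@C1d_coord R n j) (@C1d_coord R n j)))) => // i x.
rewrite (bigD1 i)//= eqxx big1 ?addr0 => [|j /negbTE ji]; first by rewrite /= mulr1 mul1r mulr2n mulrDl mul1r.
by rewrite eq_sym ji mulr0 mul0r addr0.
Qed.

Lemma coord_rho n (x : 'rV[R]_n) i : x 0 i ^+ 2 <= rho x.
Proof. by rewrite /rho (bigD1 i)//= lerDl sumr_ge0// => j _; exact: sqr_ge0. Qed.

Lemma norm_rho n (x : 'rV[R]_n) (r : R) : 0 <= r -> rho x <= r ^+ 2 -> `|x| <= r.
Proof.
move=> r0 h; apply: norm_le_coord => // i.
by rewrite -(@ler_pXn2r _ 2)// real_normK ?num_real// (le_trans (coord_rho x i)).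
Qed.

Lemma bsupp_rho n (g : 'rV[R]_n -> R) (t : R) : (forall x, t <= rho x -> g x = 0) -> bsupp g.
Proof.
move=> H; exists (maxr 1 t) => x xr; apply: H.
rewrite leNgt; apply/negP => h.
have r1 : 1 <= maxr 1 t by rewrite le_max lexx.
have hx : `|x| <= maxr 1 t; last by have := le_lt_trans hx xr; rewrite ltxx.
apply: norm_rho; first exact: le_trans r1.
apply: (le_trans (ltW h)); apply: (@le_trans _ _ (maxr 1 t)); first by rewrite le_max lexx orbT.
by rewrite expr2 ler_peMl// (le_trans _ r1).
Qed.

(** The powers of this function are the test functions for superharmonicity: the
    cube is of class [C^2], with a Laplacian made of the lower powers. *)
Definition bump n (t : R) (x : 'rV[R]_n) := pos_part (t - rho x).

Lemma C1d_subr_rho n (t : R) : C1d (fun x : 'rV[R]_n => t - rho x) (fun i x => - (2 * x 0 i)).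
Proof.
by apply: (C1d_ext (C1dB (@C1d_cst R n t) (@C1d_rho n))) => // i x; rewrite sub0r.
Qed.

Lemma cont_bump n t : continuous (@bump n t).
Proof. by apply: (cont_comp pos_cont); exact: (C1d_cont (@C1d_subr_rho n t)). Qed.

Lemma C1d_bump2 n t : C1d (fun x : 'rV[R]_n => bump t x ^+ 2) (fun i x => - (4 * bump t x * x 0 i)).
Proof.
apply: (C1d_ext (C1d_comp is_derive_pos2 pos2_cont (@C1d_subr_rho n t))) => // i x.
rewrite /bump; ring.
Qed.

Lemma C1d_bump3 n t : C1d (fun x : 'rV[R]_n => bump t x ^+ 3) (fun i x => - (6 * bump t x ^+ 2 * x 0 i)).
Proof.
apply: (C1d_ext (C1dM (@C1d_bump2 n t) (@C1d_subr_rho n t))) => [x|i x].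
  by rewrite expr2 -mulrA {2}/bump pos_mul -/(bump t x); ring.
rewrite -/(bump t x) (_ : - (4 * bump t x * x 0 i) * (t - rho x) = - (4 * x 0 i * (bump t x * (t - rho x)))); last ring.
rewrite pos_mul -/(bump t x); ring.
Qed.

Lemma C1d_dbump3 n t j : C1d (fun x : 'rV[R]_n => - (6 * bump t x ^+ 2 * x 0 j))
   (fun i x => 24 * bump t x * x 0 i * x 0 j - 6 * bump t x ^+ 2 * (i == j)%:R).
Proof.
apply: (C1d_ext (C1dN (C1dM (C1dZ 6 (@C1d_bump2 n t)) (@C1d_coord R n j)))) => // i x.
ring.
Qed.

Lemma bsupp_bump n t : bsupp (@bump n t).
Proof. by apply: (@bsupp_rho n _ t) => x h; rewrite /bump pos_le0// subr_le0. Qed.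

Lemma lbmc_bump n t : lbmc (@bump n t).
Proof. by split; [apply: lbm_cont; exact: cont_bump|exact: bsupp_bump]. Qed.

Lemma laplacian_bump3 n t (x : 'rV[R]_n) :
  \sum_i (24 * bump t x * x 0 i * x 0 i - 6 * bump t x ^+ 2 * (i == i)%:R) =
  24 * t * bump t x - (24 + 6 * n%:R) * bump t x ^+ 2.
Proof.
rewrite sumrB.
have -> : \sum_i 24 * bump t x * x 0 i * x 0 i = 24 * (bump t x * rho x).
  by rewrite /rho !mulr_sumr; apply: eq_bigr => i _; ring.
under eq_bigr do rewrite eqxx mulr1.
rewrite sumr_const card_ord -mulr_natr.
have -> : bump t x * rho x = t * bump t x - bump t x ^+ 2.
  by have := pos_mul (t - rho x); rewrite -/(bump t x) => <-; ring.
ring.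
Qed.
End radial.

(** * Mean values of superharmonic functions *)

Section mean_value.
Context {R : realType}.

Lemma green_identity n (v : 'rV[R]_n -> R) dv W phi dphi ddphi :
  C1d v dv -> (forall i, C1d (dv i) (W i)) -> C1d phi dphi -> (forall i, C1d (dphi i) (ddphi i)) ->
  bsupp phi ->
  integ (fun x => v x * \sum_i ddphi i i x) = integ (fun x => (\sum_i W i i x) * phi x).
Proof.
move=> hv hdv hp hdp bp.
have okp := lbmc_C1d hp bp; have okdp i := lbmc_C1dd i hp bp.
have bdp i : bsupp (dphi i) by case: (okdp i).
have okddp i := lbmc_C1dd i (hdp i) (bdp i).
have -> : integ (fun x => v x * \sum_i ddphi i i x) = \sum_i integ (fun x => v x * ddphi i i x).
  rewrite -integ_sum; first by apply: eq_integ => x; rewrite mulr_sumr.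
  by move=> i; apply: lbmcMr => //; exact: lbm_C1d hv.
have -> : integ (fun x => (\sum_i W i i x) * phi x) = \sum_i integ (fun x => W i i x * phi x).
  rewrite -integ_sum; first by apply: eq_integ => x; rewrite mulr_suml.
  by move=> i; apply: lbmcMr => //; exact: lbm_C1dd (hdv i).
apply: eq_bigr => i _.
rewrite (integ_by_parts i (hdv i) hp bp).
by rewrite (integ_by_parts i hv (hdp i) (bdp i)) opprK.
Qed.

Definition ball_ind n (r : R) : 'rV[R]_n -> R := \1_[set x | rho x < r ^+ 2].

Lemma open_rho n (t : R) : open [set x : 'rV[R]_n | rho x < t].
Proof.
apply: (@open_comp _ _ (fun x : 'rV[R]_n => rho x) [set s : R | s < t]); last exact: open_lt.
by move=> x _; exact: (C1d_cont (@C1d_rho R n)).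
Qed.

Lemma lbmc_ball n r : lbmc (@ball_ind n r).
Proof.
split; first by apply: lbm_indic_open; exact: open_rho.
apply: (@bsupp_rho _ _ _ (r ^+ 2)) => x h; rewrite /ball_ind indicE memNset//= => h2.
by have := lt_le_trans h2 h; rewrite ltxx.
Qed.

Lemma ball_in n r (x : 'rV[R]_n) : rho x < r ^+ 2 -> ball_ind r x = 1.
Proof. by move=> h; rewrite /ball_ind indicE mem_set. Qed.

Lemma ball_out n r (x : 'rV[R]_n) : r ^+ 2 <= rho x -> ball_ind r x = 0.
Proof. by move=> h; rewrite /ball_ind indicE memNset//= => h2; have := lt_le_trans h2 h; rewrite ltxx. Qed.

Lemma ball_ge0 n r (x : 'rV[R]_n) : 0 <= ball_ind r x.
Proof. by rewrite /ball_ind indicE. Qed.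

Definition cube_ind n (a : R) : 'rV[R]_n -> R := \1_[set x : 'rV[R]_n | forall i, `|x 0 i| <= a].

Lemma cube_in n a (x : 'rV[R]_n) : (forall i, `|x 0 i| <= a) -> cube_ind a x = 1.
Proof. by move=> h; rewrite /cube_ind indicE mem_set. Qed.

Lemma cube_out n a (x : 'rV[R]_n) : ~ (forall i, `|x 0 i| <= a) -> cube_ind a x = 0.
Proof. by move=> h; rewrite /cube_ind indicE memNset. Qed.

Lemma cube_ge0 n a (x : 'rV[R]_n) : 0 <= cube_ind a x.
Proof. by rewrite /cube_ind indicE. Qed.

Lemma lbmc_cube n (a : R) : 0 <= a -> lbmc (@cube_ind n a).
Proof.
move=> a0; split; last first.
  exists a => x ax; apply: cube_out => h; have := norm_le_coord a0 h.
  by move=> /(lt_le_trans ax); rewrite ltxx.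
split; last by move=> r; exists 1 => x _; rewrite /cube_ind indicE; case: (_ \in _); rewrite ?normr1 ?normr0.
have mA := @measurable_cube R n a.
rewrite /row_measurable (_ : _ \o _ = \1_(row_of_tuple @^-1` [set x : 'rV[R]_n | forall i, `|x 0 i| <= a])); first exact: measurable_indic.
by apply/funext => t /=; rewrite /cube_ind !indicE.
Qed.

Lemma integ_cube n (a : R) : 0 <= a -> integ (@cube_ind n a) = (2 * a) ^+ n.
Proof.
move=> a0; rewrite /integ /Rintegral.
have := @cube_measure R n a a0; rewrite -[X in lebesgue_tuple n X]setIT -integral_indic//; last exact: measurable_cube.
by move=> h; exact: (congr1 fine h).
Qed.

Section superharmonic_mean.
Variables (n : nat) (v : 'rV[R]_n -> R) (dv : 'I_n -> 'rV[R]_n -> R) (W : 'I_n -> 'I_n -> 'rV[R]_n -> R).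
Hypotheses (hv : C1d v dv) (hdv : forall i, C1d (dv i) (W i)).
Hypotheses (v0 : forall x, 0 <= v x) (sup : forall x, \sum_i W i i x <= 0).

Let J t := integ (fun x => v x * bump t x ^+ 2).
Let I1 t := integ (fun x => v x * bump t x).
Let lbmv : lbm v := lbm_C1d hv.
Let okJ t : lbmc (fun x => v x * bump t x ^+ 2).
Proof. by apply: lbmcMr => //; apply: lbmcX; exact: lbmc_bump. Qed.
Let okI t : lbmc (fun x => v x * bump t x).
Proof. by apply: lbmcMr => //; exact: lbmc_bump. Qed.

Let J_ge0 t : 0 <= J t.
Proof. by apply: integ_ge0 => x; rewrite mulr_ge0// sqr_ge0. Qed.

(** Green's identity with the cube of the bump as test function. *)
Lemma bump_mean_ineq t : 4 * t * I1 t <= (4 + n%:R) * J t.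
Proof.
have bp : bsupp (fun x : 'rV[R]_n => bump t x ^+ 3) by apply: bsuppX; exact: bsupp_bump.
have := green_identity hv hdv (@C1d_bump3 R n t) (@C1d_dbump3 R n t) bp.
have -> : integ (fun x => v x * \sum_i (24 * bump t x * x 0 i * x 0 i - 6 * bump t x ^+ 2 * (i == i)%:R)) =
   24 * t * I1 t - (24 + 6 * n%:R) * J t.
  rewrite -!integZ// -integB; [|exact: lbmcZ..].
  by apply: eq_integ => x; rewrite laplacian_bump3; ring.
have : integ (fun x => (\sum_i W i i x) * bump t x ^+ 3) <= 0.
  rewrite -[X in _ <= X](integ0 n); apply: le_integ.
  - apply: lbmcMr; first by apply: lbm_sum => i; exact: lbm_C1dd (hdv i).
    by apply: lbmcX; exact: lbmc_bump.
  - by split; [exact: lbm_cst|exists 0].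
  - by move=> x; rewrite mulr_le0_ge0// exprn_ge0// pos_ge0.
lra.
Qed.

Let bump_mean_derive (t : R) : is_derive t 1 J (2 * I1 t).
Proof.
apply: (@is_derive_quad _ _ _ _ (integ (fun x => v x * bump (t + 2) x))).
  by apply: integ_ge0 => x; rewrite mulr_ge0// pos_ge0.
move=> h h1.
have okD1 : lbmc (fun x => v x * bump (t + h) x ^+ 2 - v x * bump t x ^+ 2 - 2 * h * (v x * bump t x)).
  by apply: lbmcB; [exact: lbmcB|exact: lbmcZ].
have -> : J (t + h) - J t - 2 * I1 t * h =
   integ (fun x => v x * bump (t + h) x ^+ 2 - v x * bump t x ^+ 2 - 2 * h * (v x * bump t x)).
  by rewrite !integB ?integZ//; [rewrite /J /I1; ring|exact: lbmcB|exact: lbmcZ].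
apply: le_trans (le_abs_integ okD1) _.
rewrite [leRHS]mulrC -integZ; last by apply: lbmcMr => //; exact: lbmc_bump.
apply: le_integ; [exact: lbmc_abs|apply: lbmcZ; apply: lbmcMr => //; exact: lbmc_bump|].
move=> x.
have -> : v x * bump (t + h) x ^+ 2 - v x * bump t x ^+ 2 - 2 * h * (v x * bump t x) =
  v x * (bump (t + h) x ^+ 2 - bump t x ^+ 2 - 2 * bump t x * h) by ring.
rewrite normrM (ger0_norm (v0 x)) mulrCA ler_wpM2l//.
move: h1; rewrite ler_norml => /andP[ha hb].
have [hx|hx] := leP (t - rho x) (- 1).
  rewrite /bump (@pos_le0 _ (t + h - rho x)) ?(@pos_le0 _ (t - rho x)); [|lra..].
  by rewrite expr0n mulr0 mul0r !subrr normr0 mulr_ge0 ?sqr_ge0 ?pos_ge0.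
apply: (@le_trans _ _ (h ^+ 2)).
  by have := pos2_quad (t - rho x) h; rewrite /bump [t - _ + h]addrAC.
by rewrite ler_peMr ?sqr_ge0// /bump pos_id; lra.
Qed.

(** By [bump_mean_ineq] the logarithmic derivative of [J] is at most
    [(n + 4) / (2 t)]. *)
Lemma bump_mean_mono s t : 0 < s -> s <= t -> J t ^+ 2 / t ^+ (n + 4) <= J s ^+ 2 / s ^+ (n + 4).
Proof.
move=> s0 st.
pose m (t : R) := J t ^+ 2 * (t ^+ (n + 4))^-1.
have dm (r : R) : 0 < r -> is_derive r 1 m (J r * (4 * r * I1 r - (4 + n%:R) * J r) / r ^+ (n + 5)).
  move=> r0.
  have dJJ := is_deriveM (bump_mean_derive r) (bump_mean_derive r).
  have dX : is_derive r 1 (fun y => y ^+ (n + 4)) ((n + 4)%:R * r ^+ (n + 3)).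
    have := is_deriveX (n + 4) (is_derive_id r 1).
    rewrite (_ : id ^+ (n + 4) = fun y : R => y ^+ (n + 4)).
      by rewrite addnS /= => h; apply: is_derive_eq h _; rewrite [_ *: _]mulr1.
    by apply/funext => y; rewrite exprfctE.
  have r1 : r ^+ (n + 4) != 0 by rewrite expf_eq0 (gt_eqF r0) andbF.
  have dV := @is_deriveV R (fun y => y ^+ (n + 4)) r _ 1 r1 dX.
  have := is_deriveM dJJ dV.
  rewrite (_ : _ * _ = m); last by apply/funext => y; rewrite /m expr2.
  move=> h; apply: is_derive_eq h _.
  have e5 : (n + 5 = (n + 3).+2)%N by rewrite !addnS.
  have e4 : (n + 4 = (n + 3).+1)%N by rewrite !addnS.
  rewrite natrD e5 e4 !exprS.
  have r2 : r ^+ (n + 3) != 0 by rewrite expf_eq0 (gt_eqF r0) andbF.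
  rewrite /GRing.scale /= -![(J * J) r]/(J r * J r); field.
  by rewrite r2 gt_eqF.
have neg r : 0 < r -> J r * (4 * r * I1 r - (4 + n%:R) * J r) / r ^+ (n + 5) <= 0.
  move=> r0; rewrite mulr_le0_ge0 ?invr_ge0 ?exprn_ge0 ?(ltW r0)//.
  by rewrite mulr_ge0_le0// subr_le0 bump_mean_ineq.
have gs r : s <= r -> 0 < r := lt_le_trans s0.
apply: (@ler0_derive1_nincr R m s t) => //.
- by move=> r; rewrite in_itv /= => /andP[/ltW/gs/dm[]].
- by move=> r; rewrite in_itv /= => /andP[/ltW/gs r0 _]; rewrite derive1E; case: (dm r r0) => _ ->; exact: neg.
- apply: derivable_within_continuous => r; rewrite in_itv /= => /andP[/gs r0 _]; by case: (dm r r0).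
Qed.

(** By monotonicity it is enough to estimate [J] for small parameters, for which
    [v] is close to [v 0] on the support of the bump; that ball is enclosed in
    a cube. *)
Lemma bump_mean_le t : 0 < t -> J t ^+ 2 <= v 0 ^+ 2 * 4 ^+ n * t ^+ (n + 4).
Proof.
move=> t0.
suff H e : 0 < e -> J t ^+ 2 <= (v 0 + e) ^+ 2 * 4 ^+ n * t ^+ (n + 4).
  have C0 : 0 < 4 ^+ n * t ^+ (n + 4) by rewrite mulr_gt0// exprn_gt0.
  rewrite -mulrA -ler_pdivrMr//; set q := _ / _.
  have q0 : 0 <= q by rewrite divr_ge0 ?sqr_ge0// ltW.
  rewrite -[q]sqr_sqrtr// ler_pXn2r ?nnegrE ?sqrtr_ge0 ?v0//.
  apply/ler_addgt0Pr => e e0; rewrite -(@ler_pXn2r _ 2)// ?nnegrE ?sqrtr_ge0 ?addr_ge0 ?v0 ?(ltW e0)//.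
  by rewrite sqr_sqrtr// ler_pdivrMr// mulrA; exact: H.
move=> e0.
have vc := C1d_cont hv; have /cvgrPdist_lt/(_ e e0)/nbhs_ballP[d /= d0 Hd] := vc 0.
(* the ball of radius [sqrt s] lies in the one where [v] is below [v 0 + e] *)
pose s := minr t ((d / 2) ^+ 2).
have s0 : 0 < s by rewrite lt_min t0 exprn_gt0// divr_gt0.
have st : s <= t by rewrite ge_min lexx.
have sd : s <= (d / 2) ^+ 2 by rewrite ge_min lexx orbT.
have K0 : 0 <= v 0 + e by rewrite addr_ge0// ltW.
have Js : J s <= (v 0 + e) * s ^+ 2 * (2 * Num.sqrt s) ^+ n.
  rewrite -integ_cube ?sqrtr_ge0// -integZ//; last by apply: lbmc_cube; exact: sqrtr_ge0.
  apply: le_integ => //; first by apply: lbmcZ; apply: lbmc_cube; exact: sqrtr_ge0.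
  move=> x; have [xs|xs] := leP s (rho x).
    by rewrite /bump pos_le0 ?subr_le0// expr0n /= mulr0 !mulr_ge0 ?cube_ge0// ltW.
  rewrite cube_in ?mulr1; last first.
    move=> i; rewrite -(@ler_pXn2r _ 2)// ?nnegrE ?sqrtr_ge0// sqr_sqrtr ?(ltW s0)//.
    by rewrite real_normK ?num_real// (le_trans (coord_rho x i))// ltW.
  apply: ler_pM; rewrite ?v0 ?sqr_ge0//.
    have d2 : 0 <= d / 2 by rewrite divr_ge0// ltW.
    have xd : `|x| < d.
      by apply: le_lt_trans (norm_rho d2 (le_trans (ltW xs) sd)) _; rewrite ltr_pdivrMr// ltr_pMr ?ltr1n.
    have : `|v 0 - v x| < e by apply: Hd; rewrite -ball_normE /= sub0r normrN.
    rewrite distrC ltr_norml => /andP[_]; lra.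
  rewrite ler_pXn2r// ?nnegrE ?pos_ge0 ?(ltW s0)//.
  by rewrite /bump pos_id ?subr_ge0 ?(ltW xs)// gerBl rho_ge0.
have := bump_mean_mono s0 st; rewrite ler_pdivrMr ?exprn_gt0// => /le_trans; apply.
rewrite ler_wpM2r ?exprn_ge0 ?(ltW t0)// ler_pdivrMr ?exprn_gt0//.
apply: (@le_trans _ _ (((v 0 + e) * s ^+ 2 * (2 * Num.sqrt s) ^+ n) ^+ 2)).
  by rewrite ler_pXn2r// nnegrE ?J_ge0// !mulr_ge0// ?exprn_ge0 ?mulr_ge0 ?sqrtr_ge0// ltW.
rewrite le_eqVlt; apply/orP; left; apply/eqP.
have alg (K q : R) : (K * (q ^+ 2) ^+ 2 * (2 * q) ^+ n) ^+ 2 = K ^+ 2 * 4 ^+ n * (q ^+ 2) ^+ (n + 4).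
  have -> : 4 ^+ n = (2 ^+ n) ^+ 2 :> R by rewrite exprAC; congr (_ ^+ n); ring.
  by rewrite !exprMn exprD; ring.
by have := alg (v 0 + e) (Num.sqrt s); rewrite sqr_sqrtr// ltW.
Qed.
End superharmonic_mean.
End mean_value.

(** * Decay of the means of a superharmonic function with infimum zero *)

Section decay.
Context {R : realType}.

Lemma rhoB_le n (x y : 'rV[R]_n) : rho (x - y) <= 2 * rho x + 2 * rho y.
Proof.
rewrite /rho !mulr_sumr -big_split /=; apply: ler_sum => i _.
by rewrite coordB -subr_ge0 [X in 0 <= X](_ : _ = (x 0 i + y 0 i) ^+ 2) ?sqr_ge0//; ring.
Qed.

Section decay.
Variables (n : nat) (v : 'rV[R]_n -> R) (dv : 'I_n -> 'rV[R]_n -> R) (W : 'I_n -> 'I_n -> 'rV[R]_n -> R).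
Hypotheses (hv : C1d v dv) (hdv : forall i, C1d (dv i) (W i)).
Hypotheses (v0 : forall x, 0 <= v x) (sup : forall x, \sum_i W i i x <= 0).

(** Around [x0] apply [bump_mean_le] with parameter [8 r^2]: the bump is at least
    [4 r^2] on the ball of radius [r] centred at 0. *)
Lemma integ_ball_le (r : R) x0 : 0 < r -> rho x0 <= r ^+ 2 ->
  integ (fun x => v x * ball_ind r x) <= 4 * 6 ^+ n * v x0 * r ^+ n.
Proof.
move=> r0 hx0.
pose w x := v (x + x0).
have hw : C1d w (fun i x => dv i (x + x0)) := C1d_shift x0 hv.
have hdw i : C1d (fun x => dv i (x + x0)) (fun j x => W i j (x + x0)) := C1d_shift x0 (hdv i).
have t0 : 0 < 8 * r ^+ 2 by rewrite mulr_gt0// exprn_gt0.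
have := bump_mean_le hw hdw (fun x => v0 (x + x0)) (fun x => sup (x + x0)) t0.
rewrite /w add0r.
set t := 8 * r ^+ 2.
have lbmv := lbm_C1d hv.
have okg : lbmc (fun y => v y * bump t (y - x0) ^+ 2).
  apply: lbmcMr => //; have := lbmc_shift (- x0) (lbmcX 1 (@lbmc_bump R n t)).
  by [].
have -> : integ (fun x => v (x + x0) * bump t x ^+ 2) = integ (fun y => v y * bump t (y - x0) ^+ 2).
  rewrite -[RHS](integ_shift_ge0 x0); first by apply: eq_integ => x; rewrite addrK.
    by case: okg => -[].
  by move=> x; rewrite mulr_ge0// sqr_ge0.
set J := integ _; set V := integ _ => HJ.
have V0 : 0 <= V by apply: integ_ge0 => x; rewrite mulr_ge0// ball_ge0.
have HV : 16 * r ^+ 4 * V <= J.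
  rewrite -integZ; last by apply: lbmcMr => //; exact: lbmc_ball.
  apply: le_integ => //; first by apply: lbmcZ; apply: lbmcMr => //; exact: lbmc_ball.
  move=> x; have [xr|xr] := leP (r ^+ 2) (rho x).
    by rewrite ball_out// !mulr0 mulr_ge0// sqr_ge0.
  rewrite ball_in// mulr1 mulrC ler_wpM2l//.
  have h : 4 * r ^+ 2 <= bump t (x - x0).
    have := rhoB_le x x0; rewrite /bump /t => h1; rewrite pos_id; lra.
  have h0 : 0 <= 4 * r ^+ 2 by rewrite mulr_ge0// exprn_ge0// ltW.
  have -> : 16 * r ^+ 4 = (4 * r ^+ 2) ^+ 2 by ring.
  by rewrite ler_pXn2r// nnegrE// (le_trans h0).
have rn : 0 <= r ^+ n by rewrite exprn_ge0// ltW.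
have H : (16 * r ^+ 4 * V) ^+ 2 <= v x0 ^+ 2 * 4 ^+ n * t ^+ (n + 4).
  apply: le_trans HJ; rewrite ler_pXn2r// nnegrE ?integ_ge0//.
    by rewrite !mulr_ge0// ?exprn_ge0// ltW.
  by move=> x; rewrite mulr_ge0// sqr_ge0.
rewrite -(@ler_pXn2r _ 2)// ?nnegrE//; last by rewrite !mulr_ge0// exprn_ge0.
have r8 : 0 < 256 * r ^+ 8 by apply: mulr_gt0; [exact: ltr0n|exact: exprn_gt0].
rewrite -(ler_pM2l r8).
have -> : 256 * r ^+ 8 * V ^+ 2 = (16 * r ^+ 4 * V) ^+ 2 by ring.
apply: le_trans H _.
have -> : v x0 ^+ 2 * 4 ^+ n * t ^+ (n + 4) = 4096 * r ^+ 8 * v x0 ^+ 2 * (r ^+ n) ^+ 2 * 32 ^+ n.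
  rewrite /t exprD exprMn (_ : 32 = 4 * 8); last ring.
  by rewrite [(4 * 8) ^+ n]exprMn [r ^+ 2 ^+ n]exprAC; ring.
have -> : 256 * r ^+ 8 * (4 * 6 ^+ n * v x0 * r ^+ n) ^+ 2 = 4096 * r ^+ 8 * v x0 ^+ 2 * (r ^+ n) ^+ 2 * 36 ^+ n.
  rewrite (_ : 36 = 6 ^+ 2); last ring.
  by rewrite [6 ^+ 2 ^+ n]exprAC; ring.
apply: ler_wpM2l; last by apply: lerXn2r; rewrite ?nnegrE ?ler0n ?ler_nat.
have a0 : 0 <= 4096 * r ^+ 8 by apply: mulr_ge0; [exact: ler0n|apply: exprn_ge0; exact: ltW].
by apply: mulr_ge0; [apply: mulr_ge0; [exact: a0|]|]; exact: sqr_ge0.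
Qed.

(** Use [integ_ball_le] around a point where [v] is small. *)
Lemma integ_ball_small (e : R) : 0 < e -> (forall e, 0 < e -> exists x, v x < e) ->
  exists2 r0 : R, 0 < r0 & forall r, r0 <= r -> integ (fun x => v x * ball_ind r x) <= e * r ^+ n.
Proof.
move=> e0 inf0.
have c0 : 0 < 4 * 6 ^+ n :> R by rewrite mulr_gt0// exprn_gt0.
have [x0 vx0] := inf0 _ (divr_gt0 e0 c0).
exists (1 + rho x0); first by have := rho_ge0 x0; lra.
move=> r rr; have r0 : 0 < r by apply: lt_le_trans rr; have := rho_ge0 x0; lra.
apply: (le_trans (@integ_ball_le r x0 r0 _)).
  by have := rho_ge0 x0; nra.
rewrite ler_wpM2r ?exprn_ge0 ?(ltW r0)// mulrC -ler_pdivlMr//; exact: ltW.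
Qed.
End decay.
End decay.

(** * Energy where the solution is small *)

Section truncation.
Context {R : realType}.

Lemma C1d_truncation n (l : R) (v : 'rV[R]_n -> R) dv : 0 < l -> C1d v dv -> (forall x, 0 <= v x) ->
  C1d (fun x => l / (l + v x)) (fun i x => - (l^-1 * (l / (l + v x)) ^+ 2 * dv i x)).
Proof.
move=> l0 hv v0.
have p x : 0 < l + v x by apply: ltr_wpDr.
have dh x : is_derive (v x) 1 (fun t => l / (l + t)) (- (l^-1 * (l / (l + v x)) ^+ 2)).
  have h0 : l + v x != 0 by rewrite gt_eqF.
  have h1 : is_derive (v x) 1 (fun t => l + t) 1.
    have := is_deriveD (is_derive_cst l (v x) 1) (is_derive_id (v x) 1).
    by move=> h; apply: is_derive_eq h _; rewrite add0r.
  have := is_deriveZ l (is_deriveV (f := fun t => l + t) h0 h1).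
  move=> h; apply: is_derive_eq h _.
  by rewrite /GRing.scale /=; field; rewrite h0 gt_eqF.
apply: (C1d_ext (C1d_comp_at (h' := fun t => - (l^-1 * (l / (l + t)) ^+ 2)) dh _ hv)) => // [|i x]; last first.
  by rewrite mulNr.
have cq : continuous (fun x => l / (l + v x)).
  apply: contM; first exact: cst_continuous.
  apply: contV => [|x]; last by rewrite gt_eqF.
  by apply: contD; [exact: cst_continuous|exact: C1d_cont hv].
by apply: contN; apply: contM; [exact: cst_continuous|exact: contX].
Qed.

Section trunc.
Variables (n : nat) (v : 'rV[R]_n -> R) (dv : 'I_n -> 'rV[R]_n -> R) (W : 'I_n -> 'I_n -> 'rV[R]_n -> R).
Hypotheses (hv : C1d v dv) (hdv : forall i, C1d (dv i) (W i)).
Hypotheses (v0 : forall x, 0 <= v x) (sup : forall x, \sum_i W i i x <= 0).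

(** With [q = l / (l + v)], the function [(l^2 / 2) (q - 1)] is decreasing and
    convex in [v]. Since [v] is superharmonic, its Laplacian is at least
    [q^3 |grad v|^2], while its absolute value is at most [l v / 2]: move the
    Laplacian to the test function. *)
Lemma trunc_energy (l s : R) : 0 < l -> 0 < s ->
  integ (fun x => sqgrad dv x * (l / (l + v x)) ^+ 3 * bump (s ^+ 2) x ^+ 3) <=
  l * (3 * n%:R + 12) * s ^+ 4 * integ (fun x => v x * ball_ind s x).
Proof.
move=> l0 s0; set t := s ^+ 2.
have t0 : 0 < t by rewrite exprn_gt0.
have hq := C1d_truncation l0 hv v0.
pose q x := l / (l + v x); rewrite -/q in hq.
have p x : 0 < l + v x by apply: ltr_wpDr.
have q0 x : 0 <= q x by rewrite divr_ge0// ltW.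
have hP : C1d (fun x => l ^+ 2 / 2 * (q x - 1)) (fun i x => - (l / 2 * q x ^+ 2 * dv i x)).
  apply: (C1d_ext (C1dZ (l ^+ 2 / 2) (C1dB hq (@C1d_cst R n 1)))) => // i x.
  by rewrite subr0 -/(q x); field; rewrite gt_eqF.
have hdP i : C1d (fun x => - (l / 2 * q x ^+ 2 * dv i x))
    (fun j x => q x ^+ 3 * dv i x * dv j x - l / 2 * q x ^+ 2 * W i j x).
  apply: (C1d_ext (C1dN (C1dZ (l / 2) (C1dM (C1dM hq hq) (hdv i))))) => [x|j x].
    by rewrite expr2 mulrA.
  by rewrite /= -/(q x); field; rewrite gt_eqF.
have bp : bsupp (fun x : 'rV[R]_n => bump t x ^+ 3) by apply: bsuppX; exact: bsupp_bump.
have G := green_identity hP hdP (@C1d_bump3 R n t) (@C1d_dbump3 R n t) bp.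
have okp : lbmc (fun x : 'rV[R]_n => bump t x ^+ 3) by apply: lbmcX; exact: lbmc_bump.
have lF : lbm (sqgrad dv) := lbm_C1d (C1d_sqgrad hdv).
have lq : lbm q := lbm_C1d hq.
apply: (@le_trans _ _ (integ (fun x => (\sum_i (q x ^+ 3 * dv i x * dv i x - l / 2 * q x ^+ 2 * W i i x)) * bump t x ^+ 3))).
  apply: le_integ.
  - by apply: lbmcMr => //; apply: lbmM => //; exact: lbmX.
  - by apply: lbmcMr => //; apply: lbm_sum => i; exact: lbm_C1dd (hdP i).
  move=> x; apply: ler_wpM2r; first by rewrite exprn_ge0// pos_ge0.
  rewrite sumrB -mulr_sumr -/(q x) ler_wpDr//.
    by rewrite oppr_ge0 mulr_ge0_le0// mulr_ge0 ?sqr_ge0// divr_ge0// ltW.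
  by rewrite /sqgrad mulrC mulr_sumr le_eqVlt; apply/orP; left; apply/eqP; apply: eq_bigr => i _; ring.
rewrite -G -integZ; last by apply: lbmcMr; [exact: lbm_C1d hv|exact: lbmc_ball].
apply: le_integ.
- apply: lbmcMr; first exact: lbm_C1d hP.
  have bdp i : bsupp (fun x : 'rV[R]_n => - (6 * bump t x ^+ 2 * x 0 i)) by case: (lbmc_C1dd i (@C1d_bump3 R n t) bp).
  by apply: lbmc_sum => i; exact: (lbmc_C1dd i (@C1d_dbump3 R n t i)).
- by apply: lbmcZ; apply: lbmcMr; [exact: lbm_C1d hv|exact: lbmc_ball].
move=> x; rewrite laplacian_bump3; have [xr|xr] := leP t (rho x).
  by rewrite ball_out// /bump pos_le0 ?subr_le0// expr0n !mulr0 subr0 mulr0.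
rewrite ball_in// mulr1.
have /andP[a0 a1] : 0 <= bump t x <= t.
  by rewrite pos_ge0 /bump pos_id ?subr_ge0 ?(ltW xr)// gerBl rho_ge0.
have h1 : 0 <= 1 - q x <= v x / l.
  have -> : 1 - q x = v x / (l + v x) by rewrite /q; field; rewrite gt_eqF.
  rewrite divr_ge0 ?(ltW (p x))//= ler_wpM2l// lef_pV2 ?posrE// lerDl//.
have n0 : 0 <= n%:R :> R by [].
set a := bump t x in a0 a1 *; set b := 1 - q x in h1.
have -> : l ^+ 2 / 2 * (q x - 1) * (24 * t * a - (24 + 6 * n%:R) * a ^+ 2) =
  (l ^+ 2 / 2 * ((24 + 6 * n%:R) * a ^+ 2 - 24 * t * a)) * b by rewrite /b; ring.
apply: (@le_trans _ _ ((l ^+ 2 / 2 * ((24 + 6 * n%:R) * t ^+ 2)) * b)).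
  case/andP: h1 => b0 _; apply: ler_wpM2r => //; apply: ler_wpM2l; first by rewrite divr_ge0// sqr_ge0.
  have := mulr_ge0 (ltW t0) a0; have : a ^+ 2 <= t ^+ 2 by rewrite ler_pXn2r// nnegrE// ltW.
  move=> h2 h3; rewrite lerBlDr ler_wpDr//; first by rewrite -mulrA mulr_ge0.
  by rewrite ler_wpM2l// addr_ge0// mulr_ge0.
apply: (@le_trans _ _ ((l ^+ 2 / 2 * ((24 + 6 * n%:R) * t ^+ 2)) * (v x / l))).
  case/andP: h1 => _ b1; apply: ler_wpM2l => //.
  apply: mulr_ge0; first by rewrite divr_ge0// sqr_ge0.
  by rewrite mulr_ge0 ?sqr_ge0// addr_ge0// mulr_ge0.
rewrite le_eqVlt; apply/orP; left; apply/eqP; rewrite /t; field; by rewrite gt_eqF.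
Qed.
End trunc.
End truncation.

(** * Translations in L1 *)

Section translation_estimate.
Context {R : realType}.
Notation T n := (n.-tuple (measurableTypeR R)).

Section trans.
Variables (n : nat) (G : 'rV[R]_n -> R) (dG : 'I_n -> 'rV[R]_n -> R).
Hypotheses (hG : C1d G dG) (bG : bsupp G).

Let phi (z : 'rV[R]_n) := integ (fun x => `|G (x + z) - G x|).

Let okG : lbmc G := lbmc_C1d hG bG.
Let okp z : lbmc (fun x => `|G (x + z) - G x|).
Proof. by apply: lbmc_abs; apply: lbmcB => //; exact: lbmc_shift. Qed.

Let phi_shift z w : phi z = integ (fun x => `|G (x + w + z) - G (x + w)|).
Proof.
by rewrite /phi -[LHS](@integ_shift_ge0 _ _ w (fun x => `|G (x + z) - G x|))//; have [[]] := okp z.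
Qed.

Let phiD z w : phi (z + w) <= phi z + phi w.
Proof.
rewrite (phi_shift w z) -integD//; last first.
  by apply: lbmc_abs; apply: lbmcB; [rewrite (_ : (fun x => _) = fun x => G (x + (z + w))); [exact: lbmc_shift|by apply/funext => x; rewrite addrA]|exact: lbmc_shift].
apply: le_integ => //.
  apply: lbmcD => //; apply: lbmc_abs; apply: lbmcB; last exact: lbmc_shift.
  by rewrite (_ : (fun x => _) = fun x => G (x + (z + w))); [exact: lbmc_shift|by apply/funext => x; rewrite addrA].
move=> x; have -> : x + (z + w) = x + z + w by rewrite addrA.
have -> : G (x + z + w) - G x = (G (x + z) - G x) + (G (x + z + w) - G (x + z)) by ring.
exact: ler_normD.
Qed.

Let phi0 : phi 0 = 0.
Proof. by rewrite -[RHS](integ0 n); apply: eq_integ => x; rewrite addr0 subrr normr0. Qed.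

Let phiN z : phi (- z) = phi z.
Proof. by rewrite (phi_shift (- z) z); apply: eq_integ => x; rewrite addrK distrC. Qed.

Let phi_mul k z : phi (k%:R *: z) <= k%:R * phi z.
Proof.
elim: k => [|k IH]; first by rewrite scale0r phi0 mul0r.
by rewrite -natr1 scalerDl scale1r mulrDl mul1r (le_trans (phiD _ _))// lerD2r.
Qed.

Let phi_delta_gt0 i (h : R) : 0 < h -> phi (h *: delta_mx 0 i) <= h * integ (fun x => `|dG i x|).
Proof.
move=> h0.
have okd := lbmc_C1dd i hG bG.
have [M M0 HM] := lbmc_bounded okd.
have [r hr] := bG.
have hk0 k : 0 < h / k.+1%:R by rewrite divr_gt0.
have C : (fun k : nat => integ (fun x => `|(G (x + (h / k.+1%:R) *: delta_mx 0 i) - G x) / (h / k.+1%:R)|)) @ \oo -->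
    integ (fun x => `|dG i x|).
  apply: (@integ_cvg R n _ _ (r + h) M set0).
  - move=> k; have [[m _] _] := lbmc_abs (lbmcZ (h / k.+1%:R)^-1 (lbmcB (lbmc_shift ((h / k.+1%:R) *: delta_mx 0 i) okG) okG)).
    by move: m; congr row_measurable; apply/funext => x; rewrite mulrC.
  - by have [[]] := lbmc_abs okd.
  - move=> k x; have [c _ ->] := C1d_mvt x i hG (hk0 k).
    by rewrite [_ * dG _ _]mulrC mulfK ?gt_eqF// normr_id.
  - move=> k x xr; rewrite (hr x) ?(hr (x + _)) ?subr0 ?mul0r ?normr0//.
      have : `|(h / k.+1%:R) *: delta_mx 0 i : 'rV[R]_n| <= h.
        apply: (le_trans (norm_delta_le _ _)); by rewrite gtr0_norm// ler_piMr ?(ltW h0)// invf_le1// ler1n.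
      have : `|x| <= `|x + (h / k.+1%:R) *: delta_mx 0 i| + `|(h / k.+1%:R) *: delta_mx 0 i : 'rV[R]_n|.
        by rewrite -[X in `|X| <= _](addrK ((h / k.+1%:R) *: delta_mx 0 i) x) ler_normB.
      by move: xr; lra.
    by apply: lt_trans xr; rewrite ltrDl.
  - exact: measurable0.
  - exact: measure0.
  - by move=> t _; apply: cvg_norm; apply: (C1d_quot_step hG); rewrite gt_eqF.
rewrite mulrC -ler_pdivrMr//; apply: (cvgr_to_ge C); apply: nearW => k.
rewrite ler_pdivrMr//.
have -> : integ (fun x => `|(G (x + (h / k.+1%:R) *: delta_mx 0 i) - G x) / (h / k.+1%:R)|) =
   (h / k.+1%:R)^-1 * phi ((h / k.+1%:R) *: delta_mx 0 i).
  rewrite /phi -integZ//; apply: eq_integ => x.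
  by rewrite normrM mulrC normfV (gtr0_norm (hk0 k)).
have := phi_mul k.+1 ((h / k.+1%:R) *: delta_mx 0 i).
rewrite scalerA mulrC divfK// => /le_trans; apply.
by rewrite invfM invrK mulrAC [h^-1 * _]mulrC mulfVK ?gt_eqF.
Qed.

Let phi_delta i (h : R) : phi (h *: delta_mx 0 i) <= `|h| * integ (fun x => `|dG i x|).
Proof.
have [h0|h0|->] := ltgtP h 0; last by rewrite scale0r phi0 normr0 mul0r.
  by rewrite -phiN -scaleNr ltr0_norm//; apply: phi_delta_gt0; rewrite oppr_gt0.
by rewrite gtr0_norm//; exact: phi_delta_gt0.
Qed.

(** The left side is subadditive in [z], which reduces to arbitrarily small steps
    along the axes; for these the difference quotients converge. *)
Lemma integ_trans_le (z : 'rV[R]_n) :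
  integ (fun x => `|G (x + z) - G x|) <= \sum_i `|z 0 i| * integ (fun x => `|dG i x|).
Proof.
rewrite -/(phi z) {1}(row_sum_delta z).
elim/big_ind2 : _ => [|z1 s1 z2 s2 h1 h2|i _]; first by rewrite phi0.
  by rewrite (le_trans (phiD _ _))// lerD.
exact: phi_delta.
Qed.
End trans.
End translation_estimate.

(** * A weighted Poincare inequality *)

Section poincare.
Context {R : realType}.
Notation T n := (n.-tuple (measurableTypeR R)).

Lemma measurable_row_add n :
  measurable_fun [set: T n * T n] (fun p => tuple_of_row (row_of_tuple p.1 + row_of_tuple p.2)).
Proof.
apply/measurable_fun_tnthP => i; rewrite /comp.
apply: (eq_measurable_fun (fun p : T n * T n => tnth p.1 i + tnth p.2 i : measurableTypeR R)).
  by move=> t _; rewrite tnth_mktuple coordD !mxE.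
apply: measurable_funD.
  exact: (measurableT_comp (measurable_tnth i) measurable_fst).
exact: (measurableT_comp (measurable_tnth i) measurable_snd).
Qed.

(** Squeezing by an integrable function suffices to compare integrals by
    [le_integral_nomeas]; [f] and [g] will be inner integrals of double ones. *)
Lemma le_integ_dom n (f g h : 'rV[R]_n -> R) : lbmc h -> (forall x, 0 <= f x) ->
  (forall x, f x <= g x) -> (forall x, g x <= h x) -> integ f <= integ g.
Proof.
move=> okh f0 fg gh; rewrite /integ /Rintegral.
have hfin : (\int[@lebesgue_tuple R n]_t (h (row_of_tuple t))%:E < +oo)%E.
  by have := integrable_fin_num measurableT (integrable_lbmc okh); rewrite fin_numE => /andP[_]; rewrite ltey.
have g_le : (\int[@lebesgue_tuple R n]_t (g (row_of_tuple t))%:E <= \int[@lebesgue_tuple R n]_t (h (row_of_tuple t))%:E)%E.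
  by apply: le_integral_nomeas => t; rewrite lee_fin.
have f_le : (\int[@lebesgue_tuple R n]_t (f (row_of_tuple t))%:E <= \int[@lebesgue_tuple R n]_t (g (row_of_tuple t))%:E)%E.
  by apply: le_integral_nomeas => t; rewrite lee_fin.
have f_ge0 : (0 <= \int[@lebesgue_tuple R n]_t (f (row_of_tuple t))%:E)%E.
  by apply: integral_ge0 => t _; rewrite lee_fin.
have g_fin := le_lt_trans g_le hfin.
apply: fine_le => //; rewrite ge0_fin_numE//; first exact: le_lt_trans f_le g_fin.
exact: le_trans f_le.
Qed.

Lemma rho_add_lt n (m d : R) (x z : 'rV[R]_n) : 0 < m -> 0 < d -> rho x < m ^+ 2 -> rho z <= d ^+ 2 ->
  rho (x + z) < (m + d) ^+ 2.
Proof.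
move=> m0 d0 hx hz.
have h : rho (x + z) <= (1 + d / m) * rho x + (1 + m / d) * rho z.
  rewrite /rho !mulr_sumr -big_split /=; apply: ler_sum => i _; rewrite coordD -subr_ge0.
  have -> : (1 + d / m) * x 0 i ^+ 2 + (1 + m / d) * z 0 i ^+ 2 - (x 0 i + z 0 i) ^+ 2 =
    (d * x 0 i - m * z 0 i) ^+ 2 / (d * m) by field; rewrite !gt_eqF.
  by rewrite divr_ge0 ?sqr_ge0// mulr_ge0// ltW.
apply: (le_lt_trans h).
have -> : (m + d) ^+ 2 = (1 + d / m) * m ^+ 2 + (1 + m / d) * d ^+ 2 by field; rewrite !gt_eqF.
by apply: ltr_leD; [rewrite ltr_pM2l|rewrite ler_wpM2l//]; rewrite ?addr_gt0 ?addr_ge0 ?divr_gt0 ?divr_ge0// ltW.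
Qed.

Lemma rho_cube n (z : 'rV[R]_n) (a : R) : (forall i, `|z 0 i| <= a) -> rho z <= n%:R * a ^+ 2.
Proof.
move=> za; apply: (@le_trans _ _ (\sum_(i < n) a ^+ 2)).
  apply: ler_sum => i _; rewrite -real_normK ?num_real//; apply: lerXn2r (za i); rewrite nnegrE//.
  exact: le_trans (normr_ge0 _) (za i).
by rewrite sumr_const card_ord mulr_natl.
Qed.

Section poinc.
Variables (n : nat) (v : 'rV[R]_n -> R) (dv : 'I_n -> 'rV[R]_n -> R).
Hypotheses (hv : C1d v dv) (v0 : forall x, 0 <= v x).
Variables (G : 'rV[R]_n -> R) (dG : 'I_n -> 'rV[R]_n -> R).
Hypotheses (hG : C1d G dG) (G0 : forall x, 0 <= G x).

(** The mean of [v] over a cube of half-side [a] inside the ball is at most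
    [l / 6], so that the mean of the weight [(l / (l + v))^3] over a cube centred
    in the support of [G] is at least 1/2. Replacing the weight by its mean
    costs a translation of [G], hence the gradient of [G]. *)
Lemma weighted_poincare (m d a V : R) : 0 < m -> 0 < d -> 0 < a -> n%:R * a ^+ 2 <= d ^+ 2 ->
  (forall x, m ^+ 2 <= rho x -> G x = 0) ->
  0 < V -> integ (fun x => v x * ball_ind (m + d) x) <= V ->
  2^-1 * integ G <=
  integ (fun x => G x * (let l := 6 * V / (2 * a) ^+ n in l / (l + v x)) ^+ 3) +
  a * \sum_i integ (fun x => `|dG i x|).
Proof.
move=> m0 d0 a0 nad G_out V0 hV /=; set l := 6 * V / (2 * a) ^+ n.
have A0 : 0 < (2 * a) ^+ n by rewrite exprn_gt0// mulr_gt0.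
set A := (2 * a) ^+ n in l A0 *.
have l0 : 0 < l by rewrite divr_gt0// mulr_gt0.
pose X x := (l / (l + v x)) ^+ 3.
have hq := C1d_truncation l0 hv v0.
have p x : 0 < l + v x by apply: ltr_wpDr.
have q01 x : 0 <= l / (l + v x) <= 1.
  by rewrite divr_ge0 ?(ltW l0) ?(ltW (p x))//= ler_pdivrMr// mul1r lerDl.
have X01 x : 0 <= X x <= 1.
  by have /andP[? ?] := q01 x; rewrite /X exprn_ge0//= exprn_ile1.
have Xlow x : 1 - 3 * (v x / l) <= X x.
  rewrite /X; set q := l / (l + v x); have /andP[q0 q1] := q01 x.
  have : 1 - q <= v x / l.
    have -> : 1 - q = v x / (l + v x) by rewrite /q; field; rewrite gt_eqF.
    by rewrite ler_wpM2l// lef_pV2 ?posrE// lerDl.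
  move=> hh; have h3 : 0 <= (q - 1) ^+ 2 * (q + 2) by rewrite mulr_ge0 ?sqr_ge0// addr_ge0.
  move: h3; rewrite (_ : (q - 1) ^+ 2 * (q + 2) = q ^+ 3 - 3 * q + 2); [lra|ring].
have cX : continuous X by apply: contX; exact: C1d_cont hq.
have lX : lbm X := lbm_cont cX.
have bG : bsupp G by exact: bsupp_rho G_out.
have okG : lbmc G := lbmc_C1d hG bG.
pose Q := @cube_ind R n a.
have okQ : lbmc Q by apply: lbmc_cube; exact: ltW.
have lv : lbm v := lbm_C1d hv.
have Q0 z : 0 <= Q z := cube_ge0 a z.
have iQ : integ Q = A by rewrite /Q integ_cube// ltW.
have Qsupp (z : 'rV[R]_n) : (forall i, `|z 0 i| <= a) /\ Q z = 1 \/ Q z = 0.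
  have [za|za] := pselect (forall i, `|z 0 i| <= a); [left|right]; last exact: cube_out.
  by split => //; exact: cube_in.
rewrite -[X in integ X + _]/(fun x => G x * X x).
clearbody Q X.
pose D := \sum_i integ (fun x => `|dG i x|).
(* Both orders of integration of [G x * Q z * X (x + z)]: integrated in [z], it shows the
   mean of the weight around [x]; integrated in [x], a translate of [G]. *)
have swap : integ (fun x => integ (fun z => G x * Q z * X (x + z))) =
            integ (fun z => integ (fun x => G x * Q z * X (x + z))).
  apply: (@integ_swap R n (fun x z => G x * Q z * X (x + z))).
  - apply: measurable_funM; first apply: measurable_funM.
    + have [[mG _] _] := okG; exact: (measurableT_comp mG measurable_fst).
    + have [[mQ _] _] := okQ; exact: (measurableT_comp mQ measurable_snd).
    + have := measurableT_comp lX.1 (@measurable_row_add n).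
      by apply: eq_measurable_fun => t _ /=; rewrite tuple_of_rowK.
  - move=> x y; have /andP[? _] := X01 (x + y).
    by apply: mulr_ge0 => //; apply: mulr_ge0.
  - move=> x; rewrite (_ : (fun z => _) = fun z => G x * (Q z * X (z + x))); first by apply: lbmcZ; exact: (lbmcMl okQ (lbm_shift x lX)).
    by apply/funext => z; rewrite [z + x]addrC mulrA.
  - move=> z; rewrite (_ : (fun z => _) = fun x => Q z * (G x * X (x + z))); first by apply: lbmcZ; exact: (lbmcMl okG (lbm_shift z lX)).
    by apply/funext => x; ring.
have low x : 2^-1 * A * G x <= integ (fun z => G x * Q z * X (x + z)).
  have [xm|xm] := leP (m ^+ 2) (rho x).
    rewrite (G_out x xm) mulr0; apply: integ_ge0 => z.
    by rewrite !mul0r.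
  have -> : integ (fun z => G x * Q z * X (x + z)) = G x * integ (fun z => Q z * X (z + x)).
    rewrite -integZ; last exact: (lbmcMl okQ (lbm_shift x lX)).
    by apply: eq_integ => z; rewrite mulrA [z + x]addrC.
  rewrite [leLHS]mulrC; apply: ler_wpM2l; first exact: G0.
  have h1 : integ (fun z => Q z * v (z + x)) <= V.
    apply: le_trans hV.
    rewrite -[leRHS](@integ_shift_ge0 _ _ x); last by move=> y; rewrite mulr_ge0// ball_ge0.
      apply: le_integ.
      - exact: (lbmcMl okQ (lbm_shift x lv)).
      - exact: (lbmcMr (lbm_shift x lv) (lbmc_shift x (@lbmc_ball R n (m + d)))).
      move=> z; rewrite [leLHS]mulrC; apply: ler_wpM2l; first exact: v0.
      have [[zc ->]|->] := Qsupp z; last exact: ball_ge0.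
      have hz : rho z <= d ^+ 2.
        exact: le_trans (rho_cube zc) nad.
      have hb : rho (z + x) < (m + d) ^+ 2 by rewrite addrC; exact: rho_add_lt.
      by rewrite (ball_in hb).
    by have [[? _] _] := lbmcMr lv (@lbmc_ball R n (m + d)).
  have okQv : lbmc (fun z => Q z * v (z + x)) := lbmcMl okQ (lbm_shift x lv).
  have h2 : integ (fun z => Q z - 3 / l * (Q z * v (z + x))) <= integ (fun z => Q z * X (z + x)).
    apply: le_integ; [exact: (lbmcB okQ (lbmcZ _ okQv))|exact: (lbmcMl okQ (lbm_shift x lX))|].
    move=> z; have -> : Q z - 3 / l * (Q z * v (z + x)) = Q z * (1 - 3 * (v (z + x) / l)) by ring.
    by apply: ler_wpM2l; [exact: Q0|exact: Xlow].
  apply: le_trans h2; rewrite (integB okQ (lbmcZ _ okQv)) (integZ _ okQv).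
  rewrite iQ.
  have -> : 2^-1 * A = A - 3 / l * V by rewrite /l; field; rewrite !gt_eqF.
  have l3 : 0 <= 3 / l by apply: divr_ge0; [exact: ler0n|exact: ltW].
  by rewrite lerD2l lerN2; exact: (ler_wpM2l l3 h1).
have up z : integ (fun x => G x * Q z * X (x + z)) <= (integ (fun x => G x * X x) + a * D) * Q z.
  have -> : integ (fun x => G x * Q z * X (x + z)) = Q z * integ (fun x => G x * X (x + z)).
    by rewrite -integZ; [apply: eq_integ => x; ring|exact: (lbmcMl okG (lbm_shift z lX))].
  rewrite mulrC; have [[za _]|->] := Qsupp z; last by rewrite !mulr0.
  apply: ler_wpM2r; first exact: Q0.
  have -> : integ (fun x => G x * X (x + z)) = integ (fun y => G (y - z) * X y).
    rewrite -[RHS](@integ_shift_ge0 _ _ z); first by apply: eq_integ => x; rewrite addrK.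
      by have [[? _] _] := lbmcMl (lbmc_shift (- z) okG) lX.
    by move=> y; have /andP[? _] := X01 y; apply: mulr_ge0.
  have okd : lbmc (fun y => `|G (y - z) - G y|) := lbmc_abs (lbmcB (lbmc_shift (- z) okG) okG).
  have okGX : lbmc (fun y => G y * X y) := lbmcMl okG lX.
  apply: (@le_trans _ _ (integ (fun y => G y * X y + `|G (y - z) - G y|))).
    apply: le_integ; [exact: (lbmcMl (lbmc_shift (- z) okG) lX)|exact: lbmcD|].
    move=> y; have /andP[X0 X1] := X01 y; have := ler_norm (G (y - z) - G y); have := normr_ge0 (G (y - z) - G y).
    set g1 := G (y - z); set g2 := G y; set e := `|_| => e0 e1.
    apply: (@le_trans _ _ ((g2 + e) * X y)); first by apply: (ler_wpM2r X0); rewrite -lerBlDl.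
    by rewrite mulrDl lerD2l ler_piMr.
  rewrite (integD okGX okd) lerD2l /D mulr_sumr; apply: (le_trans (integ_trans_le hG bG (- z))).
  apply: ler_sum => i _; apply: ler_wpM2r; first by apply: integ_ge0 => y; exact: normr_ge0.
  have -> : (- z) 0 i = - z 0 i by rewrite mxE.
  by rewrite normrN; exact: za.
have up1 x : integ (fun z => G x * Q z * X (x + z)) <= A * G x.
  rewrite [leRHS]mulrC -iQ -(integZ _ okQ).
  apply: le_integ; [|exact: (lbmcZ _ okQ)|].
    rewrite (_ : (fun z => _) = fun z => G x * (Q z * X (z + x))); first by apply: lbmcZ; exact: (lbmcMl okQ (lbm_shift x lX)).
    by apply/funext => z; rewrite [z + x]addrC mulrA.
  move=> z; have /andP[_ X1] := X01 (x + z); apply: (ler_piMr _ X1); exact: mulr_ge0.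
have kge0 x z : 0 <= G x * Q z * X (x + z).
  by have /andP[X0 _] := X01 (x + z); apply: (mulr_ge0 _ X0); exact: mulr_ge0.
have hA : 0 <= 2^-1 * A by apply: mulr_ge0; [rewrite invr_ge0; exact: ler0n|exact: ltW].
have : integ (fun x => 2^-1 * A * G x) <= integ (fun z => (integ (fun x => G x * X x) + a * D) * Q z).
  apply: (@le_trans _ _ (integ (fun x => integ (fun z => G x * Q z * X (x + z))))).
    by apply: (le_integ_dom (lbmcZ A okG) _ low up1) => x; exact: (mulr_ge0 hA (G0 x)).
  rewrite swap.
  apply: (le_integ_dom (lbmcZ (integ (fun x => G x * X x) + a * D) okQ) _ up _) => z; last exact: lexx.
  by apply: integ_ge0 => x; exact: kge0.
rewrite (integZ _ okG) (integZ _ okQ) iQ.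
rewrite mulrAC ler_pM2r//; exact.
Qed.
End poinc.
End poincare.

(** * Energies of concentric balls *)

Section local_energy.
Context {R : realType}.

Definition cutoff n (r m : R) (x : 'rV[R]_n) : R := step ((m ^+ 2 - rho x) / (m ^+ 2 - r ^+ 2)).
Definition dcutoff n (r m : R) (i : 'I_n) (x : 'rV[R]_n) : R :=
  - (dstep ((m ^+ 2 - rho x) / (m ^+ 2 - r ^+ 2)) * (2 * x 0 i) / (m ^+ 2 - r ^+ 2)).

Lemma C1d_cutoff n r m : C1d (@cutoff n r m) (@dcutoff n r m).
Proof.
have h := C1dZ (m ^+ 2 - r ^+ 2)^-1 (@C1d_subr_rho R n (m ^+ 2)).
apply: (C1d_ext (C1d_comp is_derive_step dstep_cont h)) => [x|i x].
  by rewrite /cutoff mulrC.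
by rewrite /dcutoff (mulrC _^-1 (m ^+ 2 - rho x)); ring.
Qed.

Section cutoff_bounds.
Variables (n : nat) (r m : R).
Hypotheses (r0 : 0 <= r) (rm : r < m).
Let m0 : 0 < m. Proof. exact: le_lt_trans rm. Qed.
Let D0 : 0 < m ^+ 2 - r ^+ 2.
Proof. by rewrite subr_gt0 ltr_pXn2r// nnegrE// ltW. Qed.

Lemma cutoff_bnd (x : 'rV[R]_n) : 0 <= cutoff r m x <= 1.
Proof. exact: step_bnd. Qed.

Lemma cutoff_in (x : 'rV[R]_n) : rho x <= r ^+ 2 -> cutoff r m x = 1.
Proof. by move=> h; apply: step_ge1; rewrite ler_pdivlMr// mul1r lerD2l lerN2. Qed.

Lemma cutoff_out (x : 'rV[R]_n) : m ^+ 2 <= rho x -> cutoff r m x = 0.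
Proof. by move=> h; apply: step_le0; rewrite pmulr_lle0 ?invr_gt0// subr_le0. Qed.

Lemma dcutoff_out (x : 'rV[R]_n) i : m ^+ 2 <= rho x -> dcutoff r m i x = 0.
Proof.
move=> h; rewrite /dcutoff dstep_out ?mul0r ?oppr0//; left.
by rewrite pmulr_lle0 ?invr_gt0// subr_le0.
Qed.

Lemma bsupp_cutoff : bsupp (@cutoff n r m).
Proof. by apply: (@bsupp_rho R n _ (m ^+ 2)) => x; exact: cutoff_out. Qed.

Lemma grad_cutoff (x : 'rV[R]_n) : \sum_i dcutoff r m i x ^+ 2 <= 16 / (m - r) ^+ 2.
Proof.
have mr0 : 0 < m - r by rewrite subr_gt0.
have B0 : 0 <= 16 / (m - r) ^+ 2 by rewrite divr_ge0// sqr_ge0.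
have [xm|xm] := leP (m ^+ 2) (rho x).
  by rewrite big1// => i _; rewrite dcutoff_out// expr0n.
move: D0; rewrite /dcutoff; set D := m ^+ 2 - r ^+ 2 => D1; set t := dstep _; have t0 : 0 <= t := dstep_ge0 _.
have -> : \sum_i (- (t * (2 * x 0 i) / D)) ^+ 2 = t ^+ 2 * 4 * rho x / D ^+ 2.
  rewrite /rho -mulrA mulr_suml mulr_sumr; apply: eq_bigr => i _; field; by rewrite gt_eqF.
have t2 : t ^+ 2 <= 4.
  have := dstep_bnd ((m ^+ 2 - rho x) / D); rewrite -/t => h.
  by rewrite -real_normK ?num_real// (_ : 4 = 2 ^+ 2); [rewrite ler_pXn2r ?nnegrE|ring].
apply: (@le_trans _ _ (4 * 4 * m ^+ 2 / D ^+ 2)).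
  rewrite ler_wpM2r ?invr_ge0 ?sqr_ge0//; apply: ler_pM => //; rewrite ?rho_ge0 ?mulr_ge0 ?sqr_ge0//; last exact: ltW.
  by rewrite ler_wpM2r.
have -> : D ^+ 2 = (m - r) ^+ 2 * (m + r) ^+ 2 by rewrite /D; ring.
have mr1 : 0 < m + r by rewrite ltr_wpDr.
rewrite ler_pdivrMr ?mulr_gt0 ?exprn_gt0//.
have -> : 16 / (m - r) ^+ 2 * ((m - r) ^+ 2 * (m + r) ^+ 2) = 16 * (m + r) ^+ 2 by field; rewrite gt_eqF.
have -> : 4 * 4 * m ^+ 2 = 16 * m ^+ 2 by ring.
apply: ler_wpM2l => //; apply: lerXn2r; rewrite ?nnegrE ?(ltW m0) ?(ltW mr1)//.
by rewrite lerDl.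
Qed.
End cutoff_bounds.

Definition energy n (du : 'I_n -> 'rV[R]_n -> R) (r : R) := integ (fun x => sqgrad du x * ball_ind r x).

Definition grad_cst n : R := 17 * (3 * n%:R ^+ 2 + 3 * n%:R) + n%:R + 16.

Section step.
Variables (n : nat) (v : 'rV[R]_n -> R) (dv : 'I_n -> 'rV[R]_n -> R) (W : 'I_n -> 'I_n -> 'rV[R]_n -> R).
Hypotheses (hv : C1d v dv) (hdv : forall i, C1d (dv i) (W i)).
Hypotheses (v0 : forall x, 0 <= v x) (sup : forall x, \sum_i W i i x <= 0).
Hypothesis hst : linearly_stable dv W.

Let h := energy dv.
Let lF : lbm (sqgrad dv) := lbm_C1d (C1d_sqgrad hdv).
Let okh r : lbmc (fun x => sqgrad dv x * ball_ind r x) := lbmcMr lF (@lbmc_ball R n r).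
Let K := grad_cst n.

Let grad_G (r m : R) : 0 <= r -> r < m ->
  \sum_i integ (fun x => `|sqgrad dv x * (cutoff r m x * dcutoff r m i x + dcutoff r m i x * cutoff r m x) +
      dsqgrad dv W i x * (cutoff r m x * cutoff r m x)|) <= K / (m - r) * h m.
Proof.
move=> r0 rm; set d := m - r; have d0 : 0 < d by rewrite subr_gt0.
pose z : 'rV[R]_n -> R := @cutoff n r m; pose dz : 'I_n -> 'rV[R]_n -> R := @dcutoff n r m.
have hz : C1d z dz := C1d_cutoff n r m.
have bz : bsupp z := bsupp_cutoff n r0 rm.
have okz : lbmc z := lbmc_C1d hz bz.
have okdz i : lbmc (dz i) := lbmc_C1dd i hz bz.
have ldF i : lbm (dsqgrad dv W i) := lbm_C1dd i (C1d_sqgrad hdv).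
have F0 x : 0 <= sqgrad dv x := sqgrad_ge0 dv x.
have gs x : \sum_i dz i x ^+ 2 <= 16 / d ^+ 2 := grad_cutoff r0 rm x.
have z01 x : 0 <= z x <= 1 := cutoff_bnd r m x.
have zout x : m ^+ 2 <= rho x -> z x = 0 /\ forall i, dz i x = 0.
  by move=> hx; split; [exact: cutoff_out|move=> i; exact: dcutoff_out].
rewrite -/z; under eq_bigr do rewrite -/(dz _).
clearbody z dz.
have e1 : integ (fun x => (\sum_i `|dsqgrad dv W i x|) * z x ^+ 2) <= (3 * n%:R ^+ 2 + 3 * n%:R) * (17 / d * h m).
  apply: le_trans (grad_energy hv hdv sup hst hz bz d0) _.
  apply: ler_wpM2l; first by rewrite addr_ge0// mulr_ge0// sqr_ge0.
  rewrite /h /energy -integZ//; apply: le_integ; last 1 first.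
  - move=> x; have [xm|xm] := leP (m ^+ 2) (rho x).
      have [-> zi] := zout x xm; rewrite ball_out// big1 ?expr0n//=; last by move=> i _; rewrite zi expr0n.
      by rewrite mul0r mulr0 addr0 !mulr0.
    rewrite ball_in// mulr1 mulrC; apply: ler_wpM2r => //.
    have -> : 17 / d = 1 / d + d * (16 / d ^+ 2) by field; rewrite gt_eqF.
    apply: lerD; last by rewrite ler_wpM2l// ltW.
    by rewrite ler_wpM2r ?invr_ge0 ?(ltW d0)//; have /andP[? ?] := z01 x; rewrite exprn_ile1.
  - apply: (lbmcMr lF); apply: lbmcD.
      by have := lbmcZ d^-1 (lbmcX 1 okz); congr lbmc; apply/funext => x; rewrite mulrC.
    by apply: lbmcZ; apply: lbmc_sum => i; exact: lbmcX.
  - exact: lbmcZ.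
have e2 : integ (fun x => sqgrad dv x * \sum_i (z x ^+ 2 / d + d * dz i x ^+ 2)) <= (n%:R + 16) / d * h m.
  rewrite /h /energy -integZ//; apply: le_integ; last 1 first.
  - move=> x; have [xm|xm] := leP (m ^+ 2) (rho x).
      have [-> zi] := zout x xm; rewrite ball_out// big1; last by move=> i _; rewrite zi expr0n mul0r mulr0 addr0.
      by rewrite !mulr0.
    rewrite ball_in// mulr1 [leRHS]mulrC; apply: ler_wpM2l => //.
    have -> : (n%:R + 16) / d = n%:R / d + 16 / d by rewrite mulrDl.
    rewrite big_split /= sumr_const card_ord -mulr_sumr; apply: lerD.
      rewrite -[leLHS]mulr_natl; apply: ler_wpM2l => //.
      by rewrite ler_piMl ?invr_ge0 ?(ltW d0)//; have /andP[? ?] := z01 x; rewrite exprn_ile1.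
    by rewrite mulrC -ler_pdivlMr// (le_trans (gs x))// le_eqVlt; apply/orP; left; apply/eqP; field; rewrite gt_eqF.
  - apply: (lbmcMr lF); apply: lbmc_sum => i; apply: lbmcD; last by apply: lbmcZ; exact: lbmcX.
    by have := lbmcZ d^-1 (lbmcX 1 okz); congr lbmc; apply/funext => x; rewrite mulrC.
  - exact: lbmcZ.
have -> : K / d * h m = (n%:R + 16) / d * h m + (3 * n%:R ^+ 2 + 3 * n%:R) * (17 / d * h m) by rewrite /K /grad_cst; ring.
apply: le_trans (lerD e2 e1).
have okA i : lbmc (fun x => sqgrad dv x * (z x * dz i x + dz i x * z x) + dsqgrad dv W i x * (z x * z x)).
  apply: lbmcD; first by apply: (lbmcMr lF); apply: lbmcD; [exact: (lbmcMl okz (okdz i).1)|exact: (lbmcMl (okdz i) okz.1)].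
  by apply: (lbmcMr (ldF i)); exact: (lbmcMl okz okz.1).
have okB1 : lbmc (fun x => sqgrad dv x * \sum_i (z x ^+ 2 / d + d * dz i x ^+ 2)).
  apply: (lbmcMr lF); apply: lbmc_sum => i; apply: lbmcD; last by apply: lbmcZ; exact: lbmcX.
  by have := lbmcZ d^-1 (lbmcX 1 okz); congr lbmc; apply/funext => x; rewrite mulrC.
have okB2 : lbmc (fun x => (\sum_i `|dsqgrad dv W i x|) * z x ^+ 2).
  by apply: lbmcMr; [apply: lbm_sum => i; exact: lbm_abs|exact: lbmcX].
rewrite -integD// -integ_sum; last by move=> i; exact: lbmc_abs.
apply: le_integ; [by apply: lbmc_sum => i; exact: lbmc_abs|exact: lbmcD|].
move=> x; rewrite mulr_sumr mulr_suml -big_split /=; apply: ler_sum => i _.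
apply: (le_trans (ler_normD _ _)); apply: lerD; last first.
  by rewrite normrM -expr2 [`|z x ^+ 2|]ger0_norm ?sqr_ge0.
rewrite normrM (ger0_norm (F0 x)); apply: ler_wpM2l => //.
set a := z x; set b := dz i x.
have ha : 0 <= (a - d * b) ^+ 2 / d by rewrite divr_ge0 ?sqr_ge0// ltW.
have hb : 0 <= (a + d * b) ^+ 2 / d by rewrite divr_ge0 ?sqr_ge0// ltW.
have ea : (a - d * b) ^+ 2 / d = a ^+ 2 / d + d * b ^+ 2 - (a * b + b * a) by field; rewrite gt_eqF.
have eb : (a + d * b) ^+ 2 / d = a ^+ 2 / d + d * b ^+ 2 + (a * b + b * a) by field; rewrite gt_eqF.
rewrite ler_norml; apply/andP; split; lra.
Qed.

(** Apply [weighted_poincare] to [|grad v|^2] times the square of a cutoff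
    between the radii [r] and [(r + s) / 2]. The weighted term is bounded by
    [trunc_energy], the gradient term by [grad_energy]; the latter gets the
    factor [k] because the cubes have half-side [k (s - r) / 2]. *)
Lemma energy_step (r s k V : R) : 0 < r -> r < s -> 0 < k -> n%:R * k ^+ 2 <= 1 ->
  0 < V -> integ (fun x => v x * ball_ind s x) <= V ->
  energy dv r <= 2 * k * grad_cst n * energy dv s + (36 * n%:R + 144) * s * V ^+ 2 / (((s - r) / 2) ^+ 3 * (k * (s - r)) ^+ n).
Proof.
move=> r0 rs k0 nk V0 hV.
rewrite -/K -/h; set d := (s - r) / 2; have d0 : 0 < d by rewrite divr_gt0// subr_gt0.
pose m := r + d; have rm : r < m by rewrite ltrDl.
have m0 : 0 < m by rewrite addr_gt0.
have md : m + d = s by rewrite /m /d; field.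
have s0 : 0 < s by exact: lt_trans rs.
have ms : m < s by rewrite -md ltrDl.
have a0 : 0 < k * d by rewrite mulr_gt0.
have nad : n%:R * (k * d) ^+ 2 <= d ^+ 2 by rewrite exprMn mulrA ler_piMl ?sqr_ge0.
have srd : s - r = 2 * d by rewrite /d; field.
have hz := C1d_cutoff n r m.
have hG := C1dM (C1d_sqgrad hdv) (C1dM hz hz).
pose G x := sqgrad dv x * (cutoff r m x * cutoff r m x).
have G0 x : 0 <= G x by rewrite /G mulr_ge0 ?sqgrad_ge0// -expr2 sqr_ge0.
have G_out x : m ^+ 2 <= rho x -> G x = 0 by move=> hx; rewrite /G (cutoff_out (ltW r0) rm hx) !mulr0.
have hV' : integ (fun x => v x * ball_ind (m + d) x) <= V by rewrite md.
have P := weighted_poincare hv v0 hG G0 m0 d0 a0 nad G_out V0 hV'.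
have okG : lbmc G := lbmc_C1d hG (bsupp_rho G_out).
have hr : h r <= integ G.
  apply: le_integ => // x; have [xr|xr] := leP (r ^+ 2) (rho x); first by rewrite ball_out// mulr0.
  by rewrite ball_in// /G (cutoff_in (ltW r0) rm (ltW xr)) !mulr1.
have hms : h m <= h s.
  apply: le_integ => // x; apply: ler_wpM2l; first exact: sqgrad_ge0.
  have [xm|xm] := leP (m ^+ 2) (rho x); first by rewrite ball_out// ball_ge0.
  by rewrite !ball_in// (lt_trans xm)// ltr_pXn2r ?nnegrE// ltW.
have DG := grad_G (ltW r0) rm; rewrite -/(h m) (_ : m - r = d) in DG; last by rewrite /m; ring.
move: P; rewrite /= (_ : 2 * (k * d) = k * (s - r)); last by rewrite srd; ring.
set A := (k * (s - r)) ^+ n; set l := 6 * V / A => P.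
have A0 : 0 < A by rewrite exprn_gt0// mulr_gt0// subr_gt0.
have l0 : 0 < l by rewrite divr_gt0// mulr_gt0.
have T := trunc_energy hv hdv v0 sup l0 s0.
have e3 : 0 < (d * s) ^+ 3 by rewrite exprn_gt0// mulr_gt0.
have hGX : integ (fun x => G x * (l / (l + v x)) ^+ 3) <=
    ((d * s) ^+ 3)^-1 * integ (fun x => sqgrad dv x * (l / (l + v x)) ^+ 3 * bump (s ^+ 2) x ^+ 3).
  have lX : lbm (fun x => (l / (l + v x)) ^+ 3) by apply: lbmX; exact: lbm_C1d (C1d_truncation l0 hv v0).
  have okp : lbmc (fun x : 'rV[R]_n => bump (s ^+ 2) x ^+ 3) by apply: lbmcX; exact: lbmc_bump.
  have okR : lbmc (fun x => sqgrad dv x * (l / (l + v x)) ^+ 3 * bump (s ^+ 2) x ^+ 3) := lbmcMr (lbmM lF lX) okp.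
  rewrite -(integZ _ okR); apply: le_integ; [exact: (lbmcMl okG lX)|exact: lbmcZ okR|].
  move=> x; have X0 : 0 <= (l / (l + v x)) ^+ 3.
    by apply: exprn_ge0; apply: divr_ge0; [exact: ltW|apply: addr_ge0 => //; exact: ltW].
  move: X0; set X := (l / _) ^+ 3 => X0; clearbody X.
  have F0 := sqgrad_ge0 dv x.
  have e0 : 0 <= ((d * s) ^+ 3)^-1 by rewrite invr_ge0 ltW.
  have [xm|xm] := leP (m ^+ 2) (rho x).
    rewrite (G_out x xm) mul0r; apply: mulr_ge0 => //; apply: mulr_ge0; first exact: mulr_ge0.
    by apply: exprn_ge0; exact: pos_ge0.
  have GF : G x <= sqgrad dv x.
    rewrite /G ler_piMr// -expr2; have /andP[c0 c1] := cutoff_bnd r m x.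
    exact: exprn_ile1.
  have p1 : 1 <= ((d * s) ^+ 3)^-1 * bump (s ^+ 2) x ^+ 3.
    rewrite mulrC ler_pdivlMr// mul1r.
    have hp : d * s <= bump (s ^+ 2) x.
      have dsm : d * s <= s ^+ 2 - m ^+ 2.
        rewrite -md (_ : (m + d) ^+ 2 - m ^+ 2 = d * (m + d) + d * m); last ring.
        by rewrite lerDl; apply: mulr_ge0; exact: ltW.
      have : s ^+ 2 - m ^+ 2 <= s ^+ 2 - rho x by rewrite lerD2l lerN2 ltW.
      move=> /(le_trans dsm) h1; rewrite /bump pos_id//; apply: le_trans h1.
      by apply: mulr_ge0; exact: ltW.
    have ds0 : 0 <= d * s by apply: mulr_ge0; exact: ltW.
    by apply: lerXn2r => //; rewrite nnegrE//; exact: le_trans hp.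
  have -> : ((d * s) ^+ 3)^-1 * (sqgrad dv x * X * bump (s ^+ 2) x ^+ 3) =
    sqgrad dv x * X * (((d * s) ^+ 3)^-1 * bump (s ^+ 2) x ^+ 3) by ring.
  apply: (@le_trans _ _ (sqgrad dv x * X)); first exact: ler_wpM2r.
  by apply: ler_peMr => //; exact: mulr_ge0.
have Vs0 : 0 <= integ (fun x => v x * ball_ind s x).
  by apply: integ_ge0 => x; apply: mulr_ge0 => //; exact: ball_ge0.
have hT : ((d * s) ^+ 3)^-1 * integ (fun x => sqgrad dv x * (l / (l + v x)) ^+ 3 * bump (s ^+ 2) x ^+ 3) <=
    (18 * n%:R + 72) * s * V ^+ 2 / (d ^+ 3 * A).
  rewrite mulrC ler_pdivrMr//; apply: (le_trans T).
  have -> : (18 * n%:R + 72) * s * V ^+ 2 / (d ^+ 3 * A) * (d * s) ^+ 3 = l * (3 * n%:R + 12) * s ^+ 4 * V.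
    by rewrite /l; field; rewrite !gt_eqF.
  apply: ler_wpM2l => //; apply: mulr_ge0; last by apply: exprn_ge0; exact: ltW.
  by apply: mulr_ge0; [exact: ltW|rewrite addr_ge0// mulr_ge0].
have hD : k * d * (K / d * h m) <= k * K * h s.
  have -> : k * d * (K / d * h m) = k * K * h m by field; rewrite gt_eqF.
  apply: ler_wpM2l => //; apply: mulr_ge0; first exact: ltW.
  by rewrite /K /grad_cst !addr_ge0// mulr_ge0// addr_ge0// mulr_ge0// sqr_ge0.
have hDG : k * d * \sum_i integ (fun x => `|sqgrad dv x * (cutoff r m x * dcutoff r m i x + dcutoff r m i x * cutoff r m x) +
      dsqgrad dv W i x * (cutoff r m x * cutoff r m x)|) <= k * K * h s.
  by apply: le_trans hD; apply: ler_wpM2l => //; exact: ltW.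
have -> : (36 * n%:R + 144) * s * V ^+ 2 / (d ^+ 3 * A) = 2 * ((18 * n%:R + 72) * s * V ^+ 2 / (d ^+ 3 * A)) by ring.
move: P hr (le_trans hGX hT) hDG; rewrite -/G.
set P1 := integ G; set P2 := integ _; set P3 := k * d * _; set P4 := _ / (d ^+ 3 * A); set P5 := h r.
have -> : 2 * k * K * h s = 2 * (k * K * h s) by ring.
set P6 := k * K * h s; clearbody P1 P2 P3 P4 P5 P6; lra.
Qed.
End step.
End local_energy.

(** * Energy bounded by the integral of the solution *)

Section iteration.
Context {R : realType}.

(** Iterating the recursive bound gives a geometric series of ratio [t b = 1/2]
    and the remainder [t^j E]. *)
Lemma absorb (h : nat -> R) (t b M E : R) : 0 <= t -> t * b = 2^-1 -> t < 1 -> 0 <= M ->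
  (forall j, h j <= E) -> (forall j, h j <= t * h j.+1 + M * b ^+ j) -> h 0 <= 2 * M.
Proof.
move=> t0 tb t1 M0 hE hs.
have H j : h 0 <= t ^+ j * h j + 2 * M * (1 - 2^-1 ^+ j).
  elim: j => [|j IH]; first by rewrite !expr0 mul1r subrr mulr0 addr0.
  apply: (le_trans IH).
  have := ler_wpM2l (exprn_ge0 j t0) (hs j).
  have -> : t ^+ j * (t * h j.+1 + M * b ^+ j) = t ^+ j.+1 * h j.+1 + M * 2^-1 ^+ j.
    by rewrite -tb exprMn exprS; ring.
  rewrite [2^-1 ^+ j.+1]exprS; lra.
have H2 j : h 0 <= t ^+ j * E + 2 * M.
  apply: (le_trans (H j)); apply: lerD; first by apply: ler_wpM2l => //; exact: exprn_ge0.
  by rewrite ler_piMr ?mulr_ge0// gerBl exprn_ge0// invr_ge0.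
have C : (fun j => t ^+ j * E + 2 * M) @ \oo --> 0 * E + 2 * M.
  apply: cvgD; last exact: cvg_cst.
  by apply: cvgM; [apply: cvg_expr; rewrite ger0_norm|exact: cvg_cst].
rewrite mul0r add0r in C; apply: (cvgr_to_ge C); exact: nearW.
Qed.

Section bound.
Variables (n : nat) (v : 'rV[R]_n -> R) (dv : 'I_n -> 'rV[R]_n -> R) (W : 'I_n -> 'I_n -> 'rV[R]_n -> R).
Hypotheses (hv : C1d v dv) (hdv : forall i, C1d (dv i) (W i)).
Hypotheses (v0 : forall x, 0 <= v x) (sup : forall x, \sum_i W i i x <= 0).
Hypothesis hst : linearly_stable dv W.

Lemma energy_mono r s : 0 <= r -> r <= s -> energy dv r <= energy dv s.
Proof.
move=> r0 rs; have lF : lbm (sqgrad dv) := lbm_C1d (C1d_sqgrad hdv).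
apply: le_integ; [exact: (lbmcMr lF (@lbmc_ball R n r))|exact: (lbmcMr lF (@lbmc_ball R n s))|].
move=> x; apply: ler_wpM2l; first exact: sqgrad_ge0.
have [xm|xm] := leP (r ^+ 2) (rho x); first by rewrite ball_out// ball_ge0.
rewrite !ball_in//; apply: (lt_le_trans xm); apply: lerXn2r; rewrite ?nnegrE//; exact: le_trans rs.
Qed.

(** Use [energy_step] along the radii [r (2 - 2^-j)]. The error term grows like
    [b^j] along this sequence, and [k] makes the factor of the energy equal to
    [1 / (2 b)], as [absorb] requires. *)
Lemma energy_le_L1 : exists2 C : R, 0 < C & forall r V, 0 < r -> 0 < V ->
  integ (fun x => v x * ball_ind (2 * r) x) <= V -> energy dv r <= C * V ^+ 2 / r ^+ (n + 2).
Proof.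
have n0 : 0 <= n%:R :> R by [].
have [K EK] : exists K : R, K = grad_cst n by exists (grad_cst n).
have K16 : 16 <= K.
  by rewrite EK /grad_cst lerDr addr_ge0// mulr_ge0// addr_ge0// mulr_ge0// sqr_ge0.
have Kn : n%:R <= K.
  rewrite EK /grad_cst; have : 0 <= 3 * n%:R ^+ 2 + 3 * n%:R :> R by rewrite addr_ge0// mulr_ge0// sqr_ge0.
  lra.
pose b : R := 2 ^+ (n + 3); have b1 : 1 <= b by rewrite exprn_ege1// ler1n.
pose k := (4 * K * b)^-1.
have Kb : 16 <= K * b.
  by rewrite (le_trans K16)// ler_peMr//; lra.
have k0 : 0 < k by rewrite invr_gt0 -mulrA mulr_gt0//; lra.
have kKb : k * (K * b) = 4^-1.
  by rewrite /k; field; apply/andP; split; apply: lt0r_neq0; lra.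
have k1 : k * 16 <= 4^-1 by rewrite -kKb ler_wpM2l// ltW.
have kK1 : k * K <= 4^-1.
  by rewrite -kKb ler_wpM2l ?(ltW k0)// ler_peMr//; lra.
have nk : n%:R * k ^+ 2 <= 1.
  have kn : k * n%:R <= k * K by rewrite ler_wpM2l// ltW.
  have -> : n%:R * k ^+ 2 = k * n%:R * k by ring.
  have h1 : k * n%:R * k <= 4^-1 * k by rewrite ler_wpM2r ?(ltW k0)// (le_trans kn).
  lra.
pose C1 := (36 * n%:R + 144) * 16 / k ^+ n.
have C10 : 0 < C1 by rewrite divr_gt0 ?exprn_gt0// mulr_gt0// ltr_wpDl// mulr_ge0.
have b0 : 0 < b by lra.
exists (2 * (C1 * b)); first by apply: mulr_gt0 => //; exact: mulr_gt0.
move=> r V r0 V0 hV.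
pose M := C1 * b * V ^+ 2 / r ^+ (n + 2).
have rn0 : 0 < r ^+ (n + 2) by rewrite exprn_gt0.
have M0 : 0 <= M.
  by apply: divr_ge0 (ltW rn0); apply: mulr_ge0 (sqr_ge0 _); apply: mulr_ge0; exact: ltW.
pose q (j : nat) : R := 2^-1 ^+ j.
have q0 j : 0 < q j by rewrite exprn_gt0// invr_gt0.
have q1 j : q j <= 1 by rewrite exprn_ile1// ?invr_ge0// invf_le1// ler1n.
pose rj j := r * (2 - q j).
have rj0 j : 0 < rj j by rewrite mulr_gt0//; have := q1 j; lra.
have rj2 j : rj j <= 2 * r by rewrite /rj; have := mulr_gt0 r0 (q0 j); lra.
have -> : 2 * (C1 * b) * V ^+ 2 / r ^+ (n + 2) = 2 * M by rewrite /M; ring.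
have -> : energy dv r = energy dv (rj 0%N) by rewrite /rj /q expr0; congr energy; ring.
apply: (@absorb (fun j => energy dv (rj j)) (2 * k * K) b M (energy dv (2 * r))) => //.
- by rewrite mulr_ge0// ?mulr_ge0//; lra.
- by rewrite /k; field; apply/andP; split; apply: lt0r_neq0; lra.
- lra.
- by move=> j; apply: energy_mono => //; exact: ltW.
move=> j.
have dj : rj j.+1 - rj j = r * q j.+1 by rewrite /rj /q exprS; field.
have rr : rj j < rj j.+1 by rewrite -subr_gt0 dj mulr_gt0.
have hV' : integ (fun x => v x * ball_ind (rj j.+1) x) <= V.
  apply: le_trans hV; have lv := lbm_C1d hv.
  apply: le_integ; [exact: (lbmcMr lv (@lbmc_ball R n _))|exact: (lbmcMr lv (@lbmc_ball R n _))|].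
  move=> x; apply: ler_wpM2l => //.
  have [xm|xm] := leP (rj j.+1 ^+ 2) (rho x); first by rewrite ball_out// ball_ge0.
  rewrite !ball_in//; apply: (lt_le_trans xm); apply: lerXn2r; rewrite ?nnegrE//; first exact: ltW.
  by apply: mulr_ge0 => //; exact: ltW.
have S := energy_step hv hdv v0 sup hst (rj0 j) rr k0 nk V0 hV'.
apply: (le_trans S); rewrite -EK lerD2l dj.
have qb : (q j.+1 ^+ n * q j.+1 ^+ 3) * (b * b ^+ j) = 1.
  by rewrite -exprD -exprS /q /b exprAC -!exprMn mulVf// !expr1n.
have qj := q0 j.+1; move: qb qj; set p := q j.+1; set B := b ^+ j => qb qj.
have kn0 : 0 < k ^+ n by rewrite exprn_gt0.
have rr0 : 0 < r ^+ n by rewrite exprn_gt0.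
have den : 0 < (r * p / 2) ^+ 3 * (k * (r * p)) ^+ n.
  by rewrite mulr_gt0// exprn_gt0// ?mulr_gt0// invr_gt0.
rewrite ler_pdivrMr//.
have -> : M * B * ((r * p / 2) ^+ 3 * (k * (r * p)) ^+ n) =
   (36 * n%:R + 144) * (2 * r) * V ^+ 2 * (p ^+ n * p ^+ 3 * (b * B)).
  rewrite /M /C1 exprD !exprMn; field.
  by rewrite !gt_eqF.
rewrite qb mulr1; apply: ler_wpM2r; first exact: sqr_ge0.
by apply: ler_wpM2l => //; rewrite addr_ge0// mulr_ge0.
Qed.
End bound.
End iteration.

(** * Stability tested with the radial derivative *)

Section radial_test.
Context {R : realType}.

Section final.
Variables (n : nat) (v : 'rV[R]_n -> R) (dv : 'I_n -> 'rV[R]_n -> R) (W : 'I_n -> 'I_n -> 'rV[R]_n -> R).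
Hypotheses (hv : C1d v dv) (hdv : forall i, C1d (dv i) (W i)).
Hypothesis hst : linearly_stable dv W.

(** The square of the integral in [energy_le_L1] is [o(r^(2 n))]. *)
Lemma energy_small (e : R) : (forall x, 0 <= v x) -> (forall x, \sum_i W i i x <= 0) ->
  (forall e, 0 < e -> exists x, v x < e) -> 0 < e ->
  exists2 r0 : R, 0 < r0 & forall r, r0 <= r -> energy dv r * r ^+ 2 <= e * r ^+ n.
Proof.
move=> v0 sup inf0 e0.
have [C C0 HC] := energy_le_L1 hv hdv v0 sup hst.
pose q := Num.sqrt (e / (C * 4 ^+ n)).
have c4 : 0 < C * 4 ^+ n by rewrite mulr_gt0// exprn_gt0.
have q0 : 0 < q by rewrite sqrtr_gt0 divr_gt0.
have q2 : q ^+ 2 = e / (C * 4 ^+ n) by rewrite sqr_sqrtr// ltW// divr_gt0.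
have [r0 r00 Hr0] := integ_ball_small hv hdv v0 sup q0 inf0.
exists r0 => // r rr; have r1 : 0 < r by exact: lt_le_trans rr.
have r2 : 0 < 2 * r by rewrite mulr_gt0.
have rr2 : r0 <= 2 * r by rewrite (le_trans rr)// ler_peMl ?(ltW r1)// ler1n.
have V0 : 0 < q * (2 * r) ^+ n by rewrite mulr_gt0// exprn_gt0.
have H := HC r _ r1 V0 (Hr0 _ rr2).
have rn : 0 < r ^+ n by rewrite exprn_gt0.
rewrite -ler_pdivlMr ?exprn_gt0//; apply: (le_trans H).
rewrite [(q * _) ^+ 2]exprMn q2 le_eqVlt; apply/orP; left; apply/eqP.
rewrite (_ : 4 = 2 ^+ 2); last ring.
rewrite !exprMn exprD; field.
by rewrite !gt_eqF// exprn_gt0.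
Qed.

Definition xgrad (x : 'rV[R]_n) := \sum_i x 0 i * dv i x.
Definition dxgrad (j : 'I_n) (x : 'rV[R]_n) := dv j x + \sum_i x 0 i * W i j x.

Lemma C1d_xgrad : C1d xgrad dxgrad.
Proof.
apply: (C1d_ext (C1d_sum _ (fun i => C1dM (@C1d_coord R n i) (hdv i)))) => // j x.
rewrite big_split /= /dxgrad addrC; congr (_ + _).
rewrite (bigD1 j)//= eqxx mul1r big1 ?addr0// => i /negbTE ij.
by rewrite eq_sym ij mul0r.
Qed.

(** Stability is tested with the product of [xgrad] and [z], and the linearized
    equations with [x_i xgrad z^2]. The potential then disappears; the second
    derivatives which remain form [x . grad (|grad v|^2)], and are integrated by
    parts as in Pohozaev's identity. *)
Lemma radial_ineq (z w : 'rV[R]_n -> R) : C1d z (fun i x => x 0 i * w x) -> bsupp z -> continuous w ->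
  integ (fun x => (n%:R - 2) * sqgrad dv x * z x ^+ 2 + 2 * sqgrad dv x * z x * w x * rho x
                  - 4 * xgrad x ^+ 2 * z x * w x) <=
  integ (fun x => xgrad x ^+ 2 * w x ^+ 2 * rho x).
Proof.
move=> hz bz cw.
pose c := xgrad; pose dc := dxgrad.
have hc : C1d c dc := C1d_xgrad.
pose E x := c x * (z x * z x).
pose dE j x := c x * (z x * (x 0 j * w x) + (x 0 j * w x) * z x) + dc j x * (z x * z x).
have hE : C1d E dE := C1dM hc (C1dM hz hz).
have okz : lbmc z := lbmc_C1d hz bz.
have bE : bsupp E by apply: bsuppMr; exact: bsuppM.
have okE : lbmc E := lbmc_C1d hE bE.
have okdE j : lbmc (dE j) := lbmc_C1dd j hE bE.
have [r hr] : exists r : R, forall x, r < `|x| -> z x = 0 by [].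
have [d [L [ld _ St Ln]]] := hst r.
have lx i : lbm (fun x : 'rV[R]_n => x 0 i) := lbm_C1d (@C1d_coord R n i).
have ldv i : lbm (dv i) := lbm_C1d (hdv i).
have lW i j : lbm (W i j) := lbm_C1dd j (hdv i).
have lc : lbm c := lbm_C1d hc.
have ldc j : lbm (dc j) := lbm_C1dd j hc.
have lF : lbm (sqgrad dv) := lbm_C1d (C1d_sqgrad hdv).
have hpsi i := C1dM (@C1d_coord R n i) hE.
have bpsi i : bsupp (fun x => x 0 i * E x) by exact: bsuppMr.
have okpsi i := lbmc_C1d (hpsi i) (bpsi i).
have okdpsi i j := lbmc_C1dd j (hpsi i) (bpsi i).
have Er x : r < `|x| -> E x = 0 by move=> /hr zx; rewrite /E zx !mulr0.
(* the linearized equations tested with [x_i E] and summed over [i] *)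
have L1 : integ (fun x => d x * c x * E x) =
    integ (fun x => (\sum_i W i i x) * E x) + integ (fun x => \sum_j (dc j x - dv j x) * dE j x).
  have -> : integ (fun x => d x * c x * E x) = \sum_i integ (fun x => d x * dv i x * (x 0 i * E x)).
    rewrite -integ_sum; last by move=> i; apply: lbmcMr (okpsi i); exact: lbmM.
    by apply: eq_integ => x; rewrite /c /xgrad mulr_sumr mulr_suml; apply: eq_bigr => i _; ring.
  have -> : \sum_i integ (fun x => d x * dv i x * (x 0 i * E x)) =
            \sum_i integ (fun x => \sum_j W i j x * (x 0 i * dE j x + (j == i)%:R * E x)).
    by apply: eq_bigr => i _; apply: (Ln _ _ i (hpsi i)) => x /Er ->; rewrite mulr0.
  rewrite -integ_sum; last by move=> i; apply: lbmc_sum => j; exact: (lbmcMr (lW i j) (okdpsi i j)).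
  rewrite -integD; last 2 first.
  - by apply: lbmcMr okE; exact: lbm_sum.
  - by apply: lbmc_sum => j; apply: lbmcMr (okdE j); exact: lbmB.
  apply: eq_integ => x; rewrite exchange_big /= mulr_suml -big_split /=; apply: eq_bigr => j _.
  have -> : dc j x - dv j x = \sum_i x 0 i * W i j x by rewrite /dc /dxgrad; ring.
  rewrite [RHS]addrC mulr_suml.
  have -> : W j j x * E x = \sum_i (j == i)%:R * W i j x * E x.
    rewrite (bigD1 j)//= eqxx mul1r big1 ?addr0// => i /negbTE ij.
    by rewrite eq_sym ij !mul0r.
  by rewrite -big_split /=; apply: eq_bigr => i _; ring.
have hcz := C1dM hc hz.
have S1 : integ (fun x => d x * c x * E x) <= integ (fun x => \sum_i (c x * (x 0 i * w x) + dc i x * z x) ^+ 2).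
  rewrite (_ : (fun x => d x * c x * E x) = fun x => d x * (c x * z x) ^+ 2); last by apply/funext => x; rewrite /E; ring.
  by apply: (St _ _ hcz) => x /hr ->; rewrite mulr0.
have I1 : integ (fun x => (\sum_i W i i x) * E x) = - integ (fun x => \sum_j dv j x * dE j x).
  rewrite -integN; last by apply: lbmc_sum => j; exact: lbmcMr.
  rewrite (_ : (fun x => (\sum_i W i i x) * E x) = fun x => \sum_i W i i x * E x); last first.
    by apply/funext => x; rewrite mulr_suml.
  rewrite (_ : (fun x => - _) = fun x => \sum_j - (dv j x * dE j x)); last first.
    by apply/funext => x; rewrite sumrN.
  rewrite !integ_sum; last 2 first.
  - by move=> j; apply: lbmcN; exact: lbmcMr.
  - by move=> i; exact: lbmcMr.
  apply: eq_bigr => i _; rewrite (integ_by_parts i (hdv i) hE bE) integN//; exact: lbmcMr.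
have okz2 : lbmc (fun x => z x ^+ 2) by exact: lbmcX.
have hxz i := C1dM (@C1d_coord R n i) (C1dM hz hz).
have bxz i : bsupp (fun x => x 0 i * (z x * z x)) by apply: bsuppMr; exact: bsuppM.
have lw : lbm w := lbm_cont cw.
have lrho : lbm (@rho R n) := lbm_C1d (@C1d_rho R n).
have okczw : lbmc (fun x => c x ^+ 2 * z x * w x) := lbmcMl (lbmcMr (lbmX 2 lc) okz) lw.
have okrzw : lbmc (fun x => rho x * z x * w x) := lbmcMl (lbmcMr lrho okz) lw.
have okA : lbmc (fun x => 2 * (c x ^+ 2 * z x * w x) + sqgrad dv x * z x ^+ 2) := lbmcD (lbmcZ 2 okczw) (lbmcMr lF okz2).
have lbmcB : lbmc (fun x => sqgrad dv x * (n%:R * z x ^+ 2 + 2 * (rho x * z x * w x))) :=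
  lbmcMr lF (lbmcD (lbmcZ n%:R okz2) (lbmcZ 2 okrzw)).
have okFx i : lbmc (fun x => dsqgrad dv W i x * (x 0 i * (z x * z x))).
  by apply: lbmcMr; [exact: lbm_C1dd i (C1d_sqgrad hdv)|exact: lbmc_C1d (hxz i) (bxz i)].
(* Pohozaev: integration by parts of [z^2 x . grad (|grad v|^2)] *)
have Q1 : integ (fun x => sqgrad dv x * (n%:R * z x ^+ 2 + 2 * (rho x * z x * w x))) =
     - integ (fun x => \sum_i dsqgrad dv W i x * (x 0 i * (z x * z x))).
  rewrite integ_sum; last exact: okFx.
  under [in RHS]eq_bigr => i _ do rewrite (integ_by_parts i (C1d_sqgrad hdv) (hxz i) (bxz i)).
  rewrite sumrN opprK -integ_sum; last first.
    by move=> i; apply: (lbmcMr lF); exact: lbmc_C1dd i (hxz i) (bxz i).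
  apply: eq_integ => x; rewrite -mulr_sumr; congr (_ * _).
  under [RHS]eq_bigr do rewrite eqxx mul1r.
  rewrite big_split /= sumr_const card_ord -[X in _ = _ + X]mulr_natl [RHS]addrC; congr (_ + _).
  rewrite /rho !mulr_suml mulr_sumr; apply: eq_bigr => i _; ring.
have P1 : integ (fun x => \sum_j dv j x * dE j x) =
   integ (fun x => 2 * (c x ^+ 2 * z x * w x) + sqgrad dv x * z x ^+ 2) -
   2^-1 * integ (fun x => sqgrad dv x * (n%:R * z x ^+ 2 + 2 * (rho x * z x * w x))).
  rewrite Q1 mulrN opprK -integZ; last by apply: lbmc_sum => i; exact: okFx.
  rewrite -integD//; last by apply: lbmcZ; apply: lbmc_sum => i; exact: okFx.
  apply: eq_integ => x.
  have -> : \sum_j dv j x * dE j x =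
     2 * c x * z x * w x * (\sum_j x 0 j * dv j x) + z x ^+ 2 * (\sum_j dv j x ^+ 2) +
     z x ^+ 2 * \sum_j dv j x * \sum_i x 0 i * W i j x.
    rewrite [X in X + _ + _]mulr_sumr [X in _ + X + _]mulr_sumr [X in _ + X]mulr_sumr -!big_split /=.
    apply: eq_bigr => j _; rewrite /dE /dc /dxgrad; move: (c x) => cx; set S := \sum_i _; ring.
  rewrite -/(xgrad x) -/c -/(sqgrad dv x).
  have -> : 2^-1 * (\sum_i dsqgrad dv W i x * (x 0 i * (z x * z x))) =
     z x ^+ 2 * \sum_j dv j x * \sum_i x 0 i * W i j x.
    have -> : \sum_i dsqgrad dv W i x * (x 0 i * (z x * z x)) =
              \sum_i \sum_j 2 * (z x ^+ 2 * (dv j x * (x 0 i * W i j x))).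
      apply: eq_bigr => i _; rewrite (dsqgradE hv hdv) -mulrA mulr_suml mulr_sumr.
      by apply: eq_bigr => j _; ring.
    rewrite exchange_big /= [LHS]mulr_sumr [RHS]mulr_sumr; apply: eq_bigr => j _.
    by rewrite !mulr_sumr; apply: eq_bigr => i _; field.
  by rewrite /c; ring.
have okD1 : lbmc (fun x => \sum_j dc j x * dE j x) by apply: lbmc_sum => j; exact: lbmcMr.
have okV1 : lbmc (fun x => \sum_j dv j x * dE j x) by apply: lbmc_sum => j; exact: lbmcMr.
have D1 : integ (fun x => \sum_j (dc j x - dv j x) * dE j x) =
  integ (fun x => \sum_j dc j x * dE j x) - integ (fun x => \sum_j dv j x * dE j x).
  by rewrite -integB//; apply: eq_integ => x; rewrite -sumrB; apply: eq_bigr => j _; ring.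
have okS : lbmc (fun x => \sum_i (c x * (x 0 i * w x) + dc i x * z x) ^+ 2).
  by apply: lbmc_sum => i; apply: lbmcX; exact: (lbmc_C1dd i hcz (@bsuppMr _ _ c z bz)).
have R1 : integ (fun x => xgrad x ^+ 2 * w x ^+ 2 * rho x) =
  integ (fun x => \sum_i (c x * (x 0 i * w x) + dc i x * z x) ^+ 2) - integ (fun x => \sum_j dc j x * dE j x).
  rewrite -integB//; apply: eq_integ => x; rewrite -sumrB /rho mulr_sumr; apply: eq_bigr => j _.
  by rewrite /dE /c; ring.
have G1 : integ (fun x => (n%:R - 2) * sqgrad dv x * z x ^+ 2 + 2 * sqgrad dv x * z x * w x * rho x
                  - 4 * xgrad x ^+ 2 * z x * w x) =
   integ (fun x => sqgrad dv x * (n%:R * z x ^+ 2 + 2 * (rho x * z x * w x))) -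
   2 * integ (fun x => 2 * (c x ^+ 2 * z x * w x) + sqgrad dv x * z x ^+ 2).
  rewrite -integZ// -integB//; last exact: lbmcZ.
  by apply: eq_integ => x; rewrite /c; ring.
rewrite G1 R1; lra.
Qed.
End final.
End radial_test.

(** * The weighted energy estimate *)

Section vanishing.
Context {R : realType}.

(** This is [(1 + |x|^2)^(- a / 2)]. *)
Definition weight n (a : R) (x : 'rV[R]_n) : R := expR (- (a / 2 * ln (1 + rho x))).

Lemma rho1_gt0 n (x : 'rV[R]_n) : 0 < 1 + rho x.
Proof. by rewrite ltr_pwDl// rho_ge0. Qed.

Lemma cont_rho1V n : continuous (fun x : 'rV[R]_n => (1 + rho x)^-1).
Proof.
apply: contV => [|x]; last by rewrite gt_eqF// rho1_gt0.
by apply: contD; [exact: cst_continuous|exact: C1d_cont (@C1d_rho R n)].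
Qed.

Lemma C1d_weight n a : C1d (@weight n a) (fun i x => x 0 i * (- (a / (1 + rho x)) * weight a x)).
Proof.
pose h (t : R) := expR (- (a / 2 * ln (1 + t))).
pose h' (t : R) := - (a / 2 / (1 + t)) * h t.
have dh (x : 'rV[R]_n) : is_derive (rho x) 1 h (h' (rho x)).
  have r1 : 0 < 1 + rho x := rho1_gt0 x.
  have h1 : is_derive (rho x) 1 (fun t => 1 + t) 1.
    have := is_deriveD (is_derive_cst (1 : R) (rho x) 1) (is_derive_id (rho x) 1).
    by move=> H; apply: is_derive_eq H _; rewrite add0r.
  have h2 : is_derive (rho x) 1 (fun t => ln (1 + t)) (1 + rho x)^-1.
    have := is_derive1_comp (f := @ln R) (g := fun t => 1 + t) (is_derive1_ln r1) h1.
    by move=> H; apply: is_derive_eq H _; rewrite mulr1.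
  have h3 : is_derive (rho x) 1 (fun t => - (a / 2 * ln (1 + t))) (- (a / 2 * (1 + rho x)^-1)).
    exact: is_deriveN (is_deriveZ (a / 2) h2).
  have := is_derive1_comp (f := @expR R) (g := fun t => - (a / 2 * ln (1 + t))) (is_derive_expR _) h3.
  by move=> H; apply: is_derive_eq H _; rewrite /h' /h; ring.
have cw : continuous (@weight n a).
  move=> x; apply: (@continuous_comp _ _ _ (@rho R n) h); first exact: (C1d_cont (@C1d_rho R n)).
  by apply/differentiable_continuous/derivable1_diffP; case: (dh x).
have ch : continuous (fun x : 'rV[R]_n => h' (rho x)).
  apply: contM; last exact: cw.
  by apply: contN; apply: contM; [exact: cst_continuous|exact: cont_rho1V].
apply: (C1d_ext (C1d_comp_at dh ch (@C1d_rho R n))) => // i x.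
rewrite /h' -/(weight a x) -[h (rho x)]/(weight a x); field; by rewrite gt_eqF// rho1_gt0.
Qed.

(** The integrand of [radial_ineq] at a point with [|x|^2 = p], for the product of
    the weight [g] and a cutoff with value [z] and gradient [t x]. For [t = 0]
    it is at least [2 a F (g z)^2 s], and this is where [a <= 4] is needed. *)
Lemma radial_algebra (F c2 p z t a s g : R) : 0 <= F -> 0 <= c2 -> c2 <= p * F -> 0 <= p ->
  0 <= z <= 1 -> t <= 0 -> 0 <= a <= 4 -> s * (1 + p) = 1 -> 0 <= s ->
  g ^+ 2 * (2 * a * F * z ^+ 2 * s - F * (10 * (- t * p) + (- t * p) ^+ 2)) <=
  2 * a * F * (g * z) ^+ 2 + 2 * F * (g * z) * (g * (t - a * z * s)) * p
  - 4 * c2 * (g * z) * (g * (t - a * z * s)) - c2 * (g * (t - a * z * s)) ^+ 2 * p.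
Proof.
move=> F0 c0 cp p0 /andP[z0 z1] t0 /andP[a0 a4] sp s0.
have ps : s * p = 1 - s by rewrite -sp; ring.
have s1 : s <= 1 by rewrite -sp ler_peMr// lerDl.
have ps0 : 0 <= s * p by exact: mulr_ge0.
have ps1 : s * p <= 1 by rewrite ps lerBlDr lerDl.
have q0 : 0 <= - t * p by rewrite mulr_ge0// oppr_ge0.
rewrite -subr_ge0.
(* the difference as a sum of nonnegative terms *)
have -> : 2 * a * F * (g * z) ^+ 2 + 2 * F * (g * z) * (g * (t - a * z * s)) * p
  - 4 * c2 * (g * z) * (g * (t - a * z * s)) - c2 * (g * (t - a * z * s)) ^+ 2 * p -
  g ^+ 2 * (2 * a * F * z ^+ 2 * s - F * (10 * (- t * p) + (- t * p) ^+ 2)) =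
  g ^+ 2 * (a * c2 * z ^+ 2 * s * (4 - a * (s * p)) + 4 * c2 * z * (- t)
    + 2 * F * (- t * p) * (1 - z) + (p * F - c2) * (- t) * (- t * p)
    + 2 * a * ((p * F) * (- t) - c2 * (- t) * (z * (s * p))) + 2 * F * (- t * p) * (4 - a)).
  have : 2 * a * F * (g * z) ^+ 2 * (s * p + s - 1) = 0 by rewrite ps subrK subrr mulr0.
  lra.
have nt0 : 0 <= - t by rewrite oppr_ge0.
apply: mulr_ge0; first exact: sqr_ge0.
rewrite !addr_ge0//.
- apply: mulr_ge0; first by rewrite !mulr_ge0// sqr_ge0.
  by rewrite subr_ge0; apply: le_trans a4; rewrite ler_piMr.
- by rewrite !mulr_ge0.
- by apply: mulr_ge0; [rewrite -mulrA !mulr_ge0|rewrite subr_ge0].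
- by rewrite mulr_ge0// mulr_ge0// subr_ge0.
- apply: mulr_ge0; first exact: mulr_ge0.
  rewrite subr_ge0; apply: (@le_trans _ _ (c2 * (- t))); last exact: ler_wpM2r.
  by rewrite ler_piMr ?mulr_ge0// mulr_ile1.
- by apply: mulr_ge0; [rewrite -mulrA !mulr_ge0|rewrite subr_ge0].
Qed.

Lemma sqgrad_eq0 n (du : 'I_n -> 'rV[R]_n -> R) : continuous (sqgrad du) ->
  (forall r, 0 < r -> energy du r = 0) -> forall x, sqgrad du x = 0.
Proof.
move=> cF e0 x; apply/eqP; rewrite eq_le sqgrad_ge0 andbT leNgt; apply/negP => Fx.
have F2 : 0 < sqgrad du x / 2 by rewrite divr_gt0.
have /cvgrPdist_lt/(_ _ F2)/nbhs_ballP[e /= ep He] := cF x.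
pose a := e / 2; have a0 : 0 < a by rewrite divr_gt0.
have ae : a < e by rewrite /a; lra.
pose r := 1 + 2 * rho x + 2 * n%:R * a ^+ 2.
have n0 : 0 <= n%:R :> R by [].
have na0 : 0 <= n%:R * a ^+ 2 by rewrite mulr_ge0// sqr_ge0.
have r1 : 1 <= r by have := rho_ge0 x; rewrite /r; lra.
have r0 : 0 < r by exact: lt_le_trans r1.
have lF : lbm (sqgrad du) := lbm_cont cF.
have okc : lbmc (fun y : 'rV[R]_n => cube_ind a (y - x)) := lbmc_shift (- x) (lbmc_cube n (ltW a0)).
have : sqgrad du x / 2 * (2 * a) ^+ n <= energy du r.
  have -> : (2 * a) ^+ n = integ (fun y => cube_ind a (y - x)).
    rewrite -(@integ_shift_ge0 _ _ x (fun y => cube_ind a (y - x))); last by move=> y; exact: cube_ge0.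
      rewrite -integ_cube ?(ltW a0)//; by apply: eq_integ => y; rewrite addrK.
    by case: okc => -[].
  rewrite -integZ//; apply: le_integ; [exact: lbmcZ|exact: (lbmcMr lF (@lbmc_ball R n r))|].
  move=> y; have [yx|yx] := pselect (forall i, `|(y - x) 0 i| <= a); last first.
    by rewrite cube_out// mulr0 mulr_ge0 ?sqgrad_ge0 ?ball_ge0.
  rewrite cube_in// mulr1 ball_in ?mulr1.
    have : `|sqgrad du x - sqgrad du y| < sqgrad du x / 2.
      apply: He; rewrite -ball_normE /= distrC; apply: le_lt_trans ae.
      exact: norm_le_coord (ltW a0) yx.
    by rewrite ltr_norml => /andP[_]; lra.
  have -> : y = x - (x - y) by rewrite subKr.
  have hy : rho (x - y) <= n%:R * a ^+ 2.
    by apply: rho_cube => i; have := yx i; rewrite !coordB distrC.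
  apply: (le_lt_trans (rhoB_le _ _)); apply: (@lt_le_trans _ _ r); first by rewrite /r; lra.
  by rewrite expr2 ler_peMl// ltW.
by rewrite e0// leNgt mulr_gt0// exprn_gt0// mulr_gt0.
Qed.

Lemma grad0_cst n (u : 'rV[R]_n -> R) du : C1d u du -> (forall i x, du i x = 0) ->
  forall x, u x = u 0.
Proof.
move=> hu d0 x.
have P y i h : 0 < h -> u (y + h *: delta_mx 0 i) = u y.
  by move=> h0; apply/eqP; rewrite -subr_eq0; have [c _ ->] := C1d_mvt y i hu h0; rewrite d0 mulr0.
have A y i h : u (y + h *: delta_mx 0 i) = u y.
  have [h0|h0|->] := ltgtP h 0; last by rewrite scale0r addr0.
    have := P (y + h *: delta_mx 0 i) i (- h); rewrite oppr_gt0 => /(_ h0).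
    by rewrite scaleNr addrK.
  exact: P.
have S (s : seq 'I_n) y : u (y + \sum_(i <- s) x 0 i *: delta_mx 0 i) = u y.
  elim: s y => [|i s IH] y; first by rewrite big_nil addr0.
  by rewrite big_cons addrA IH A.
by rewrite [in LHS](row_sum_delta x) -[X in u X]add0r S.
Qed.

Lemma weight_ge0 n (a : R) (x : 'rV[R]_n) : 0 <= weight a x. Proof. exact: expR_ge0. Qed.

(** The fourth power of the weight is [(1 + |x|^2)^(- m)]. *)
Lemma weight_decay n m (r : R) (x : 'rV[R]_n) : 0 < r -> r ^+ 2 <= rho x ->
  weight (m%:R / 2) x ^+ 2 <= (r ^+ m)^-1.
Proof.
move=> r0 hx.
have rm : 0 < r ^+ m by rewrite exprn_gt0.
have g4 : (weight (m%:R / 2) x ^+ 2) ^+ 2 * (1 + rho x) ^+ m = 1.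
  have -> : (1 + rho x) ^+ m = expR (m%:R * ln (1 + rho x)).
    by rewrite expRM_natl lnK// posrE rho1_gt0.
  rewrite /weight -!expRM_natl -expRD -[RHS]expR0; congr expR; field => //.
rewrite -(@ler_pXn2r _ 2)// ?nnegrE ?sqr_ge0 ?invr_ge0 ?(ltW rm)//.
have h1 : (r ^+ m) ^+ 2 <= (1 + rho x) ^+ m.
  rewrite exprAC; apply: lerXn2r; rewrite ?nnegrE ?sqr_ge0 ?(ltW (rho1_gt0 x))//.
  by apply: (le_trans hx); rewrite lerDr.
have w0 : 0 <= (weight (m%:R / 2) x ^+ 2) ^+ 2 by exact: sqr_ge0.
rewrite exprVn -[leRHS]mul1r ler_pdivlMr ?exprn_gt0// -[leRHS]g4; exact: ler_wpM2l.
Qed.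

Section concl.
Variables (n : nat) (v : 'rV[R]_n -> R) (dv : 'I_n -> 'rV[R]_n -> R) (W : 'I_n -> 'I_n -> 'rV[R]_n -> R).
Hypotheses (hv : C1d v dv) (hdv : forall i, C1d (dv i) (W i)).
Hypothesis hst : linearly_stable dv W.

Lemma xgrad_le x : xgrad dv x ^+ 2 <= rho x * sqgrad dv x.
Proof. exact: cauchy_schwarz_sum. Qed.

(** The cutoff varies only in the annulus between [r] and [2 r]. There the
    error [10 q + q^2] of [radial_algebra], with [q <= 6], is at most 96, and
    the squared weight is at most [r^(- m)]. *)
Lemma weighted_energy m (r : R) : n = m.+2 -> (0 < m <= 8)%N -> 0 < r ->
  integ (fun x => m%:R * sqgrad dv x * (weight (m%:R / 2) x * cutoff r (2 * r) x) ^+ 2 / (1 + rho x)) <=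
  96 / r ^+ m * energy dv (2 * r).
Proof.
move=> nm /andP[m0 m8] r0; pose a : R := m%:R / 2.
have a04 : 0 <= a <= 4.
  rewrite divr_ge0//= ler_pdivrMr// -natrM ler_nat; exact: m8.
have r2 : r < 2 * r by rewrite ltr_pMl// ltr1n.
have r00 := ltW r0.
pose g := @weight n a; pose z : 'rV[R]_n -> R := @cutoff R n r (2 * r).
pose D := (2 * r) ^+ 2 - r ^+ 2.
have D0 : 0 < D by rewrite /D; have := exprn_gt0 2 r0; lra.
(* the gradient of [z] at [x] is [t x] times [x] *)
pose t (x : 'rV[R]_n) := - (2 * dstep (((2 * r) ^+ 2 - rho x) / D) / D).
pose s (x : 'rV[R]_n) := (1 + rho x)^-1.
pose w x := g x * (t x - a * z x * s x).
have hz : C1d (fun x => g x * z x) (fun i x => x 0 i * w x).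
  apply: (C1d_ext (C1dM (@C1d_weight n a) (@C1d_cutoff R n r (2 * r)))) => // i x.
  by rewrite /dcutoff /w /t /s -/(g x) -/(z x) -/D; ring.
have bz : bsupp (fun x => g x * z x) by apply: bsuppMr; exact: bsupp_cutoff.
have cg : continuous g := C1d_cont (@C1d_weight n a).
have cz : continuous z := C1d_cont (@C1d_cutoff R n r (2 * r)).
have cs : continuous s := @cont_rho1V n.
have ct : continuous t.
  apply: contN; apply: contM; last exact: cst_continuous.
  apply: contM; first exact: cst_continuous.
  apply: (cont_comp dstep_cont); apply: contM; last exact: cst_continuous.
  by apply: contB; [exact: cst_continuous|exact: C1d_cont (@C1d_rho R n)].
have cw : continuous w.
  by apply: contM => //; apply: contB => //; apply: contM => //; apply: contM => //; exact: cst_continuous.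
have RI := radial_ineq hv hdv hst hz bz cw.
have lF : lbm (sqgrad dv) := lbm_C1d (C1d_sqgrad hdv).
have lc : lbm (xgrad dv) := lbm_C1d (C1d_xgrad hdv).
have okz : lbmc z := lbmc_C1d (@C1d_cutoff R n r (2 * r)) (bsupp_cutoff n r00 r2).
have lg : lbm g := lbm_cont cg.
have lw : lbm w := lbm_cont cw.
have lrho : lbm (@rho R n) := lbm_C1d (@C1d_rho R n).
have ls : lbm s := lbm_cont cs.
have okgz : lbmc (fun x => g x * z x) := lbmcMr lg okz.
have okE : lbmc (fun x => sqgrad dv x * ball_ind (2 * r) x) := lbmcMr lF (@lbmc_ball R n (2 * r)).
have okL : lbmc (fun x => m%:R * sqgrad dv x * (g x * z x) ^+ 2 / (1 + rho x)).
  by apply: (lbmcMl _ ls); apply: lbmcMr; [exact: lbmZ|exact: lbmcX].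
have okA : lbmc (fun x => (n%:R - 2) * sqgrad dv x * (g x * z x) ^+ 2 + 2 * sqgrad dv x * (g x * z x) * w x * rho x
                  - 4 * xgrad dv x ^+ 2 * (g x * z x) * w x).
  apply: lbmcB; first apply: lbmcD.
  - by apply: lbmcMr; [exact: lbmZ|exact: lbmcX].
  - by apply: (lbmcMl _ lrho); apply: (lbmcMl _ lw); apply: lbmcMr okgz; exact: lbmZ.
  - by apply: (lbmcMl _ lw); apply: lbmcMr okgz; apply: lbmZ; exact: lbmX.
have okB' : lbmc (fun x => xgrad dv x ^+ 2 * w x ^+ 2 * rho x).
  split; first by apply: lbmM => //; apply: lbmM; exact: lbmX.
  apply: (@bsupp_rho R n _ ((2 * r) ^+ 2)) => x hx.
  have -> : w x = 0; last by rewrite expr0n mulr0 mul0r.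
  rewrite /w /z (cutoff_out r00 r2 hx) /t dstep_out; last by left; rewrite pmulr_lle0 ?invr_gt0// subr_le0.
  by rewrite !mulr0 !mul0r oppr0 add0r mulr0.
rewrite -subr_ge0 /energy -(integZ _ okE) -(integB (lbmcZ _ okE) okL).
rewrite -subr_ge0 -integB// in RI.
apply: (le_trans RI); apply: le_integ; [exact: lbmcB|exact: (lbmcB (lbmcZ _ okE) okL)|].
move=> x.
have t0 : t x <= 0.
  rewrite oppr_le0; apply: divr_ge0; last exact: ltW.
  by apply: mulr_ge0 => //; exact: dstep_ge0.
have s0 : 0 <= s x by rewrite invr_ge0 ltW// rho1_gt0.
have s1 : s x * (1 + rho x) = 1 by rewrite mulVf// gt_eqF// rho1_gt0.
have A1 := radial_algebra (g x) (sqgrad_ge0 dv x) (sqr_ge0 (xgrad dv x)) (xgrad_le x) (rho_ge0 x)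
   (cutoff_bnd r (2 * r) x) t0 a04 s1 s0.
have err : g x ^+ 2 * (sqgrad dv x * (10 * (- t x * rho x) + (- t x * rho x) ^+ 2)) <=
   96 / r ^+ m * (sqgrad dv x * ball_ind (2 * r) x).
  have F0 := sqgrad_ge0 dv x.
  have r96 : 0 <= 96 / r ^+ m by apply: divr_ge0 => //; exact: exprn_ge0.
  have R0 : 0 <= 96 / r ^+ m * (sqgrad dv x * ball_ind (2 * r) x).
    by apply: mulr_ge0 => //; apply: mulr_ge0 => //; exact: ball_ge0.
  have [xr|xr] := leP (rho x) (r ^+ 2).
    rewrite /t dstep_out; last by right; rewrite ler_pdivlMr// mul1r lerD2l lerN2.
    by rewrite mulr0 mul0r oppr0 oppr0 mul0r mulr0 expr0n addr0 !mulr0.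
  have [xR|xR] := leP ((2 * r) ^+ 2) (rho x).
    rewrite /t dstep_out; last by left; rewrite pmulr_lle0 ?invr_gt0// subr_le0.
    by rewrite mulr0 mul0r oppr0 oppr0 mul0r mulr0 expr0n addr0 !mulr0.
  rewrite ball_in// mulr1.
  have q6 : 0 <= - t x * rho x <= 6.
    apply/andP; split; first by rewrite mulr_ge0 ?oppr_ge0 ?rho_ge0.
    rewrite /t opprK mulrAC ler_pdivrMr//.
    have := dstep_bnd (((2 * r) ^+ 2 - rho x) / D); have := dstep_ge0 (((2 * r) ^+ 2 - rho x) / D).
    set y := dstep _ => y0; rewrite ger0_norm// => y2.
    have : y * rho x <= 2 * (2 * r) ^+ 2 by apply: ler_pM => //; [exact: rho_ge0|exact: ltW].
    rewrite /D; have := sqr_ge0 r; lra.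
  have g1 : g x ^+ 2 <= (r ^+ m)^-1 := weight_decay m r0 (ltW xr).
  case/andP: q6; set q := - t x * rho x => q0 q6.
  have h96 : 10 * q + q ^+ 2 <= 96.
    have : q ^+ 2 <= 6 * q by rewrite expr2 ler_wpM2r.
    lra.
  have -> : 96 / r ^+ m * sqgrad dv x = (r ^+ m)^-1 * (sqgrad dv x * 96) by ring.
  apply: ler_pM; [exact: sqr_ge0| |exact: g1|exact: ler_wpM2l].
  by apply: mulr_ge0 => //; rewrite addr_ge0 ?sqr_ge0// mulr_ge0.
have n2 : n%:R - 2 = 2 * a.
  by rewrite nm -addn2 natrD /a; field.
have m2 : m%:R = 2 * a by rewrite /a; field.
rewrite n2 m2; move: A1 err; rewrite -/(z x) -/(s x) /w.
set X := 96 / r ^+ m * _; lra.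
Qed.
End concl.
End vanishing.

(** * The energy vanishes *)

Section conclusion.
Context {R : realType}.

Section vanish.
Variables (n : nat) (v : 'rV[R]_n -> R) (dv : 'I_n -> 'rV[R]_n -> R) (W : 'I_n -> 'I_n -> 'rV[R]_n -> R).
Hypotheses (hv : C1d v dv) (hdv : forall i, C1d (dv i) (W i)).
Hypothesis hst : linearly_stable dv W.
Hypotheses (v0 : forall x, 0 <= v x) (sup : forall x, \sum_i W i i x <= 0).
Hypothesis inf0 : forall e, 0 < e -> exists x, v x < e.
Hypothesis n10 : (n <= 10)%N.

Let energy_ge0 r : 0 <= energy dv r.
Proof. by apply: integ_ge0 => x; apply: mulr_ge0; [exact: sqgrad_ge0|exact: ball_ge0]. Qed.

(** When [n <= 2], the bound [energy_small] tends to 0 by itself. When [n >= 3],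
    it makes the right side of [weighted_energy] tend to 0, while the left side
    controls the energy of any fixed ball. *)
Lemma energy_eq0 r : 0 < r -> energy dv r = 0.
Proof.
move=> r0; apply/eqP; rewrite eq_le energy_ge0 andbT.
have [n2|n2] := leqP n 2.
  apply/ler_addgt0Pr => e e0; rewrite add0r.
  have [r1 r10 H] := energy_small hv hdv hst v0 sup inf0 e0.
  pose q := maxr (maxr r1 r) 1.
  have q1 : 1 <= q by rewrite /q le_max lexx orbT.
  have qr : r <= q by rewrite /q !le_max lexx orbT.
  have q0 : 0 < q by exact: lt_le_trans q1.
  have := H q; rewrite {1}/q !le_max lexx /= => /(_ isT) Hq.
  apply: (le_trans (energy_mono hdv (ltW r0) qr)).
  rewrite -(@ler_pM2r _ (q ^+ 2)) ?exprn_gt0//; apply: (le_trans Hq).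
  by apply: ler_wpM2l; [exact: ltW|exact: ler_weXn2l].
pose m := n.-2.
have nm : n = m.+2 by rewrite /m; case: n n2 => [|[|k]].
have m18 : (0 < m <= 8)%N.
  by move: (n2) (n10); rewrite /m; case: (n) => [|[|l]] //=; rewrite !ltnS => -> ->.
have m0 : (0 < m)%N by case/andP: m18.
have mR : 0 < m%:R :> R by rewrite ltr0n.
pose k : R := m%:R * expR (- (m%:R / 2 / 2 * ln (1 + r ^+ 2))) ^+ 2 / (1 + r ^+ 2).
have r12 : 0 < 1 + r ^+ 2 by rewrite ltr_pwDl// sqr_ge0.
have k0 : 0 < k by rewrite divr_gt0// mulr_gt0// exprn_gt0// expR_gt0.
apply/ler_addgt0Pr => e e0; rewrite add0r.
have e1 : 0 < e * k / (96 * 2 ^+ m).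
  by apply: divr_gt0; [exact: mulr_gt0|rewrite mulr_gt0 ?exprn_gt0].
have [r1 r10 H] := energy_small hv hdv hst v0 sup inf0 e1.
pose q := maxr r1 r.
have qr : r <= q by rewrite /q le_max lexx orbT.
have q0 : 0 < q by exact: lt_le_trans qr.
have q2 : r1 <= 2 * q.
  have : r1 <= q by rewrite /q le_max lexx.
  lra.
have lF : lbm (sqgrad dv) := lbm_C1d (C1d_sqgrad hdv).
have E1 := weighted_energy hv hdv hst nm m18 q0.
have low : k * energy dv r <= integ (fun x => m%:R * sqgrad dv x * (weight (m%:R / 2) x * cutoff q (2 * q) x) ^+ 2 / (1 + rho x)).
  have qq : q < 2 * q by rewrite ltr_pMl// ltr1n.
  have okz : lbmc (@cutoff R n q (2 * q)) := lbmc_C1d (@C1d_cutoff R n q (2 * q)) (bsupp_cutoff n (ltW q0) qq).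
  have okgz := lbmcMr (lbm_C1d (@C1d_weight R n (m%:R / 2))) okz.
  have okb : lbmc (fun x => sqgrad dv x * ball_ind r x) := lbmcMr lF (@lbmc_ball R n r).
  rewrite /energy -integZ//; apply: le_integ; first exact: lbmcZ.
    apply: lbmcMl; last exact: lbm_cont (@cont_rho1V R n).
    by apply: lbmcMr; [exact: lbmZ|exact: lbmcX].
  move=> x; have F0 := sqgrad_ge0 dv x; have p0 := rho_ge0 x; have p1 := rho1_gt0 x.
  have [xr|xr] := leP (r ^+ 2) (rho x).
    rewrite ball_out// !mulr0; apply: divr_ge0; last exact: ltW.
    by apply: mulr_ge0; [exact: mulr_ge0|exact: sqr_ge0].
  have xq : rho x <= q ^+ 2.
    by apply: (le_trans (ltW xr)); apply: lerXn2r; rewrite ?nnegrE// ltW.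
  rewrite ball_in// mulr1 (cutoff_in (ltW q0) qq xq) mulr1.
  have w1 : expR (- (m%:R / 2 / 2 * ln (1 + r ^+ 2))) <= weight (m%:R / 2) x.
    rewrite ler_expR lerN2; apply: ler_wpM2l; first by rewrite !divr_ge0.
    by rewrite ler_ln ?posrE// lerD2l ltW.
  have w2 : expR (- (m%:R / 2 / 2 * ln (1 + r ^+ 2))) ^+ 2 <= weight (m%:R / 2) x ^+ 2.
    by apply: lerXn2r w1; rewrite nnegrE; [exact: expR_ge0|exact: weight_ge0].
  have -> : m%:R * sqgrad dv x * weight (m%:R / 2) x ^+ 2 / (1 + rho x) =
    m%:R * weight (m%:R / 2) x ^+ 2 / (1 + rho x) * sqgrad dv x by ring.
  apply: ler_wpM2r => //; apply: ler_pM.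
  - by apply: mulr_ge0; [exact: ltW|exact: sqr_ge0].
  - by rewrite invr_ge0 ltW.
  - by apply: ler_wpM2l w2; exact: ltW.
  - by rewrite lef_pV2 ?posrE// lerD2l ltW.
rewrite -(@ler_pM2r _ k)// [leLHS]mulrC; apply: (le_trans low); apply: (le_trans E1).
have E2 := H _ q2.
have q4 : 0 < (2 * q) ^+ 2 by rewrite exprn_gt0// mulr_gt0.
have c0 : 0 <= 96 / q ^+ m by rewrite divr_ge0// exprn_ge0// ltW.
move: E2; rewrite -ler_pdivlMr// => E2.
apply: (le_trans (ler_wpM2l c0 E2)).
rewrite le_eqVlt; apply/orP; left; apply/eqP.
rewrite [in LHS]nm -[m.+2]addn2 exprD exprMn; field.
by rewrite !gt_eqF// exprn_gt0.
Qed.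
End vanish.
End conclusion.

Theorem theorem1 (R : realType) (N : nat) (hN : (1 <= N <= 10)%N)
    (f : R -> R) (f_lip : locally_lipschitz f) (f_ge0 : forall t, 0 <= f t)
    (u : 'rV[R]_N -> R) (u_bnd : has_lbound (range u))
    (u_sol : solution [set: 'rV[R]_N] f u)
    (u_stable : stable [set: 'rV[R]_N] f u) :
  exists c : R, forall x, u x = c.
Proof.
have [[u_diff u_C2] u_eq] := u_sol.
pose du i := partial i u; pose H i j := partial j (partial i u).
have hdu i : C1d (du i) (H i) by apply: class_C1d; exact: u_C2.
have hu : C1d u du.
  split=> [x|//|i]; first exact: u_diff.
  exact: C1d_cont (hdu i).
have H_eq x : - (\sum_i H i i x) = f (u x) by exact: u_eq.
have H_le0 x : \sum_i H i i x <= 0 by rewrite -oppr_ge0 H_eq.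
have hst := stable_linearized f_lip hu hdu H_eq u_stable.
pose v x := u x - inf (range u).
have hv : C1d v du by apply: (C1d_ext (C1dB hu (C1d_cst _ _))) => // i x; rewrite subr0.
have u_inf : has_inf (range u) by split=> //; exists (u 0); exists 0.
have v_ge0 x : 0 <= v x by rewrite subr_ge0; apply: ge_inf => //; exists x.
have v_inf e : 0 < e -> exists x, v x < e.
  move=> e0; have [_ [x _ <-] ux] := inf_adherent e0 u_inf.
  by exists x; rewrite /v ltrBlDl.
have /andP[_ N10] := hN.
have F0 : forall x, sqgrad du x = 0.
  apply: sqgrad_eq0 => [|r r0]; first exact: C1d_cont (C1d_sqgrad hdu).
  exact: (energy_eq0 hv hdu hst v_ge0 H_le0 v_inf N10 r0).
exists (u 0); apply: (grad0_cst hu) => i x.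
have := F0 x; rewrite /sqgrad => /eqP; rewrite psumr_eq0; last by move=> j _; exact: sqr_ge0.
by move=> /allP/(_ i (mem_index_enum i)); rewrite implyTb sqrf_eq0 => /eqP.
Qed.
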